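(* Let $X$ be a proper CAT$(-1)$ space and let $\Gamma\le\operatorname{Isom}(X)$ be finitely generated, non-elementary, and discrete, with $0<\delta_X(\Gamma)<\infty$. Fix a finite symmetric generating set $S$, distinct points $A,B\in\Lambda_\Gamma$, a point $o$ on the geodesic $(A,B)$, constants $D,L$ as in the context, and a map $g\mapsto\xi_g$ from $\Gamma$ to $\partial X$ with $\xi_g\in\{gA,gB\}$ and $d(go,[o,\xi_g))\le D$ for all $g$. (1) For every $q\in(0,1]$ with $P_{\Gamma,o}(q)<\infty$, the orbit map $g\mapsto go$ extends continuously and $\Gamma$-equivariantly to a map $\widehat\Gamma=\Gamma\sqcup\mathcal E(\Gamma)\to X\sqcup\Lambda_\Gamma$; its restriction $\Pi_o:\mathcal E(\Gamma)\to\Lambda_\Gamma$ is a surjective topological quotient map satisfying $\rho_o(\Pi_o\epsilon,\Pi_o\eta)\le d^{\mathcal E}_{q,o,S}(\epsilon,\eta)$ for all ends $\epsilon,\eta$ (i.e. it is $1$-Lipschitz); and $\mathcal H^q(\Lambda_\Gamma,\rho_o)=0$. (2) In particular, if $\delta_X(\Gamma)<1$, then $\dim_H(\Lambda_\Gamma,\rho_o)=\delta_X(\Gamma)$, $\Lambda_\Gamma$ is a Cantor set, and $\Gamma$ has infinitely many ends. (3) For every $m\ge2$ and every such $q$, $$\inf\{\mathcal W_{q,o}(Q;\xi):Q\subset\Gamma\text{ finite},\ c_\infty(Q)<m\}\ \ge\ \varepsilon_m(\Lambda_\Gamma,\rho_o)^q.$$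
   Context: $P_{\Gamma,o}(s)=\sum_{g\in\Gamma}e^{-s d(o,go)}$ and $\delta_X(\Gamma)=\inf\{s>0:P_{\Gamma,o}(s)<\infty\}$. $\Lambda_\Gamma\subseteq\partial X$ is the limit set. $\rho_o(\xi,\eta)=e^{-(\xi\mid\eta)_o}$ is the Bourdon metric on $\partial X$. $\mathcal H^q$ is $q$-dimensional Hausdorff measure and $\dim_H(E,d)=\inf\{q:\mathcal H^q(E,d)=0\}$. $X\sqcup\Lambda_\Gamma$ carries the subspace topology from the visual compactification $X\sqcup\partial X$. $D$ is a thin-triangle constant for $X$ (in every geodesic triangle, ideal vertices allowed, each side lies in the $D$-neighbourhood of the other two) and $L=\max_{s\in S}d(o,so)$. $\operatorname{Cay}(\Gamma,S)$ has vertex set $\Gamma$ and undirected edges $\{g,gs\}$, $s\in S$; $|g|_S$ is word length; $B_S(n)=\{g:|g|_S\le n\}$ for $n\ge0$, $B_S(-1)=\varnothing$. For finite $Q\subset\Gamma$, $\operatorname{Cay}(\Gamma,S)\setminus Q$ is the induced subgraph on $\Gamma\setminus Q$ and $c_\infty(Q)$ is the number of its infinite connected components. For an edge $e=\{g,gs\}$, $w_o(e)=\rho_o(\xi_g,\xi_{gs})$, and $\mathcal W_{q,o}(Q;\xi)=\sum_ew_o(e)^q$ over all undirected edges $e$ of $\operatorname{Cay}(\Gamma,S)\setminus Q$, each counted once. $\operatorname{pack}_\varepsilon(Z,d)=\sup\{|E|:E\subseteq Z,\ d(x,y)\ge\varepsilon\ \forall x\ne y\in E\}$ and $\varepsilon_m(Z,d)=\sup\{\varepsilon>0:\operatorname{pack}_\varepsilon(Z,d)\ge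 m\}$. Ends: a ray is a one-way infinite simple edge path; rays are equivalent if for every finite $Q$ they have tails in the same component of $\operatorname{Cay}(\Gamma,S)\setminus Q$; $\mathcal E(\Gamma)$ is the set of classes, and for an infinite component $U$ of $\operatorname{Cay}(\Gamma,S)\setminus Q$, $\mathcal E(U)$ is the set of ends with a tail in $U$; these sets form a basis of the end topology. On $\widehat\Gamma=\Gamma\sqcup\mathcal E(\Gamma)$ vertices are isolated and the sets $U\sqcup\mathcal E(U)$ are basic neighbourhoods of ends. $\Theta_{q,o,S}(n)=|S|e^{q(L+2D)}\sum_{|g|_S>n}e^{-qd(o,go)}$ for $n\ge-1$. For distinct ends, $N_S(\epsilon,\eta)$ is the largest $n\ge-1$ such that $\epsilon,\eta\in\mathcal E(U)$ for one component $U$ of $\operatorname{Cay}(\Gamma,S)\setminus B_S(n)$. $d^{\mathcal E}_{q,o,S}(\epsilon,\eta)=\Theta_{q,o,S}(N_S(\epsilon,\eta))^{1/q}$ for $\epsilon\ne\eta$ and $0$ for $\epsilon=\eta$; it is an ultrametric inducing the end topology. *)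

(* Defs.v *)
From HB Require Import structures.
From mathcomp Require Import all_boot all_order all_algebra.
From mathcomp Require Import generic_quotient finmap.
From mathcomp Require Import all_classical all_reals all_analysis.

Set Implicit Arguments.
Unset Strict Implicit.
Unset Printing Implicit Defensive.

Import Order.TTheory GRing.Theory Num.Theory.

Local Open Scope classical_set_scope.
Local Open Scope ring_scope.

(** * Metric geometry *)

Section MetricGeometry.
Context {R : realType}.

(* The hyperboloid model of the hyperbolic plane: [(x, y)] stands for the point
   [(x, y, sqrt (1 + x^2 + y^2))] of the upper sheet, and
   [cosh d(p, q) = - <p, q>] for the Lorentz form [<,>]. *)
Definition arcosh (u : R) : R := ln (u + Num.sqrt (u ^+ 2 - 1)).

Definition hyp_height (p : R * R) : R := Num.sqrt (1 + p.1 ^+ 2 + p.2 ^+ 2).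

Definition hyp_dist (p q : R * R) : R :=
  arcosh (hyp_height p * hyp_height q - p.1 * q.1 - p.2 * q.2).

Context {X : metricType R}.

Definition geodesic_on (I : set R) (c : R -> X) : Prop :=
  forall s t, I s -> I t -> mdist (c s) (c t) = `|s - t|.

Definition geodesic_segment (c : R -> X) (l : R) (x y : X) : Prop :=
  [/\ 0 <= l, geodesic_on `[0, l] c, c 0 = x & c l = y].

Definition geodesic_space : Prop :=
  forall x y : X, exists c l, geodesic_segment c l x y.

Definition proper_space : Prop :=
  forall (x : X) (r : R), compact [set y | mdist x y <= r].

(* [(p', q', r')] is a comparison triangle in the hyperbolic plane, [x'] and
   [y'] are the comparison points of [c s] in [p, q] and of [c' t] in [p, r].
   As [p], [q], [r] are arbitrary, this covers every pair of sides. *)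
Definition CAT_minus1 : Prop :=
  geodesic_space /\
  forall (p q r : X) (c c' : R -> X) (a b s t : R),
    geodesic_segment c a p q -> geodesic_segment c' b p r ->
    0 <= s <= a -> 0 <= t <= b ->
  forall p' q' r' x' y' : R * R,
    hyp_dist p' q' = mdist p q -> hyp_dist p' r' = mdist p r ->
    hyp_dist q' r' = mdist q r ->
    hyp_dist p' x' = s -> hyp_dist x' q' = a - s ->
    hyp_dist p' y' = t -> hyp_dist y' r' = b - t ->
    mdist (c s) (c' t) <= hyp_dist x' y'.

End MetricGeometry.
Arguments geodesic_space {R} X.
Arguments proper_space {R} X.
Arguments CAT_minus1 {R} X.

(** * The boundary at infinity and the visual compactification *)

(* The values of [ray_fun] at negative reals are irrelevant. *)
Record geo_ray {R : realType} (X : metricType R) := GeoRay {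
  ray_fun :> R -> X ;
  ray_geodesic : geodesic_on `[0, +oo[ ray_fun }.

HB.instance Definition _ (R : realType) (X : metricType R) :=
  gen_eqMixin (geo_ray X).
HB.instance Definition _ (R : realType) (X : metricType R) :=
  gen_choiceMixin (geo_ray X).

Section Boundary.
Context {R : realType} (X : metricType R).

Definition asymptotic (c c' : geo_ray X) : bool :=
  `[< exists K : R, forall t, 0 <= t -> mdist (c t) (c' t) <= K >].

Lemma asymptotic_refl : reflexive asymptotic.
Proof. by move=> c; apply/asboolP; exists 0 => t _; rewrite mdistxx. Qed.

Lemma asymptotic_sym : symmetric asymptotic.
Proof.
move=> c c'; apply/idP/idP => /asboolP[K hK]; apply/asboolP; exists K => t t0;
  by rewrite metric_sym; exact: hK.
Qed.

Lemma asymptotic_trans : transitive asymptotic.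
Proof.
move=> c' c c'' /asboolP[K hK] /asboolP[K' hK']; apply/asboolP.
exists (K + K') => t t0; apply: (le_trans (metric_triangle _ (c' t) _)).
by apply: lerD; [exact: hK | exact: hK'].
Qed.

Canonical asymptotic_equiv :=
  EquivRel asymptotic asymptotic_refl asymptotic_sym asymptotic_trans.

Definition boundary : Type := {eq_quot asymptotic}%qT.
HB.instance Definition _ := Choice.on boundary.
HB.instance Definition _ := EqQuotient.on boundary.

Inductive bordification := Inner of X | Bdry of boundary.

HB.instance Definition _ := gen_eqMixin bordification.
HB.instance Definition _ := gen_choiceMixin bordification.

End Boundary.

Definition ray_class {R : realType} {X : metricType R} (c : geo_ray X) :
  boundary X := \pi_(boundary X)%qT c.

Section Visual.
Context {R : realType} {X : metricType R}.

(* The geodesic ray [[o, xi)], parametrized by the nonnegative reals; existence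
   and uniqueness hold in proper CAT(-1) spaces. *)
Definition ray_from (o : X) (xi : boundary X) : R -> X :=
  xget (cst o)
    [set c : R -> X | exists c' : geo_ray X,
       [/\ ray_class c' = xi, c' 0 = o & c = c']].

Definition ray_set (o : X) (xi : boundary X) : set X :=
  ray_from o xi @` `[0, +oo[.

(* The projection of [z] to the closed ball of radius [r] about [o]: the point
   at distance [min r (d o z)] from [o] on the geodesic from [o] to [z]. *)
Definition ball_proj (o : X) (z : bordification X) (r : {nonneg R}) : X :=
  match z with
  | Inner x => xget o [set y | mdist o y = Num.min r%:num (mdist o x) /\
                               mdist o y + mdist y x = mdist o x]
  | Bdry xi => ray_from o xi r%:num
  end.

(* The cone topology on [X] with its boundary adjoined: the inverse limit
   topology with respect to the projections to the balls about [o]. *)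
Definition visual (o : X) : Type :=
  initial_topology
    (ball_proj o : bordification X -> prod_topology (fun _ : {nonneg R} => X)).
HB.instance Definition _ (o : X) := Topological.on (visual o).

Definition boundary_at (o : X) : Type :=
  initial_topology (@Bdry R X : boundary X -> visual o).
HB.instance Definition _ (o : X) := Topological.on (boundary_at o).

Definition gromov_product (o x y : X) : R :=
  (mdist o x + mdist o y - mdist x y) / 2.

Definition gromov_product_bdry (o : X) (xi eta : boundary X) : \bar R :=
  lim ((gromov_product o (ray_from o xi t) (ray_from o eta t))%:E
         @[t --> +oo%R]).

Definition bourdon (o : X) (xi eta : boundary X) : R :=
  fine (expeR (- gromov_product_bdry o xi eta)%E).

Definition side (p q : bordification X) : set (set X) :=
  match p, q with
  | Inner x, Inner y =>
      [set sigma | exists (c : R -> X) (l : R),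
         geodesic_segment c l x y /\ sigma = c @` `[0, l]]
  | Inner x, Bdry xi | Bdry xi, Inner x =>
      [set sigma | exists c : geo_ray X,
         [/\ ray_class c = xi, c 0 = x & sigma = c @` `[0, +oo[]]
  | Bdry xi, Bdry eta =>
      [set sigma | exists (c : R -> X) (cp cm : geo_ray X),
         [/\ geodesic_on setT c,
             forall t, 0 <= t -> cp t = c t /\ cm t = c (- t),
             ray_class cp = xi, ray_class cm = eta
           & sigma = range c]]
  end.

Definition thin_triangle_constant (D : R) : Prop :=
  forall (p q r : bordification X) (s1 s2 s3 : set X),
    side p q s1 -> side q r s2 -> side r p s3 ->
    forall x, s1 x -> (edist_inf (s2 `|` s3) x <= D%:E)%E.

End Visual.
Arguments thin_triangle_constant {R} X D.

(** * Hausdorff measure and packing *)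

Section Fractal.
Context {R : realType} {T : choiceType} (d : T -> T -> R).

Definition diam (U : set T) : \bar R :=
  ereal_sup ([set 0%E] `|`
             [set r | exists x y, [/\ U x, U y & r = (d x y)%:E]]).

(* With the convention [0 ^ 0 = 1] for nonempty sets, and gauge [0] for the
   empty set, the 0-dimensional measure is the counting measure. *)
Definition hausdorff_gauge (q : R) (U : set T) : \bar R :=
  if U == set0 then 0%E else poweR (diam U) q.

Definition hausdorff_premeasure (q delta : R) (E : set T) : \bar R :=
  ereal_inf [set (\sum_(0 <= i <oo) hausdorff_gauge q (U i))%E |
    U in [set U : nat -> set T |
      E `<=` \bigcup_i U i /\ forall i, (diam (U i) <= delta%:E)%E]].

Definition hausdorff_measure (q : R) (E : set T) : \bar R :=
  ereal_sup [set hausdorff_premeasure q delta E |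
    delta in [set delta | 0 < delta]].

Definition hausdorff_dim (E : set T) : \bar R :=
  ereal_inf [set q%:E | q in [set q | 0 <= q /\ hausdorff_measure q E = 0%E]].

(* The supremum may be taken over finite separated subsets. *)
Definition packing (eps : R) (Z : set T) : \bar R :=
  ereal_sup [set (#|` E |%:R)%:E | E in [set E : {fset T} |
    [set` E] `<=` Z /\
    forall x y, x \in E -> y \in E -> x <> y -> eps <= d x y]].

Definition packing_radius (m : nat) (Z : set T) : \bar R :=
  ereal_sup [set eps%:E | eps in [set eps |
    0 < eps /\ (m%:R%:E <= packing eps Z)%E]].

End Fractal.

(** * Cayley graphs and ends *)

Section Words.
Context {G : groupType} (S : set G).

Definition is_word (n : nat) (g : G) : Prop :=
  exists l : seq G, [/\ size l = n, (forall s, s \in l -> S s)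
                      & g = (\prod_(s <- l) s)%g].

Definition symmetric_generating_set : Prop :=
  [/\ finite_set S, (forall s, S s -> S s^-1%g)
    & forall g, exists n, is_word n g].

Definition word_length (g : G) : nat :=
  get [set n | is_word n g /\ forall k, is_word k g -> (n <= k)%N].

(* The index is an integer, so that [word_ball (-1)] is empty. *)
Definition word_ball (n : int) : set G := [set g | (word_length g)%:Z <= n].

(* Adjacency in the subgraph of the Cayley graph induced on the complement of
   [Q]. *)
Definition cay_adj (Q : set G) : rel G := fun g h =>
  `[< [/\ ~ Q g, ~ Q h
        & exists2 s, S s & h = (g * s)%g \/ g = (h * s)%g] >].

Definition component_of (Q : set G) (g : G) : set G :=
  [set h | exists2 p : seq G, path (cay_adj Q) g p & h = last g p].

Definition infinite_components (Q : set G) : set (set G) :=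
  [set U | infinite_set U /\ exists2 g, ~ Q g & U = component_of Q g].

Definition few_infinite_components (Q : set G) (m : nat) : Prop :=
  exists2 k, (k < m)%N & (infinite_components Q #= `I_k)%card.

Definition cay_edges (Q : set G) : set (set G) :=
  [set E | exists2 gh : G * G, cay_adj Q gh.1 gh.2 & E = [set gh.1; gh.2]].

Definition is_cay_ray (r : nat -> G) : Prop :=
  injective r /\ forall n, cay_adj set0 (r n) (r n.+1).

Record cay_ray := CayRay { cay_ray_fun :> nat -> G ; _ : is_cay_ray cay_ray_fun }.

HB.instance Definition _ := gen_eqMixin cay_ray.
HB.instance Definition _ := gen_choiceMixin cay_ray.

Definition tail_in (r : nat -> G) (U : set G) : Prop :=
  exists N, forall n, (N <= n)%N -> U (r n).

Definition same_end (r r' : cay_ray) : bool :=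
  `[< forall Q : set G, finite_set Q ->
      exists2 g, ~ Q g & tail_in r (component_of Q g) /\
                         tail_in r' (component_of Q g) >].

Lemma cay_adj_sym Q : symmetric (cay_adj Q).
Proof.
move=> g h; apply/idP/idP => /asboolP[Qg Qh [s Ss gh]]; apply/asboolP;
  by split=> //; exists s => //; tauto.
Qed.

Lemma component_of_refl Q g : component_of Q g g.
Proof. by exists [::]. Qed.

Lemma component_of_trans Q g h k :
  component_of Q g h -> component_of Q h k -> component_of Q g k.
Proof.
move=> [p gp ->] [p' hp' ->]; exists (p ++ p'); last by rewrite last_cat.
by rewrite cat_path gp.
Qed.

Lemma component_of_sym Q g h : component_of Q g h -> component_of Q h g.
Proof.
move=> [p gp ->]; exists (rev (belast g p)); first by
  rewrite rev_path; under eq_path do rewrite cay_adj_sym.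
by case: p gp => //= x p _; rewrite rev_cons last_rcons.
Qed.

Lemma component_of_eq Q g h k :
  component_of Q g k -> component_of Q h k ->
  component_of Q g = component_of Q h.
Proof.
move=> gk hk; apply/seteqP; split=> x xg.
- exact/(component_of_trans hk)/(component_of_trans (component_of_sym gk)).
- exact/(component_of_trans gk)/(component_of_trans (component_of_sym hk)).
Qed.

Lemma component_of_step Q g h :
  cay_adj Q g h -> component_of Q g h.
Proof. by move=> gh; exists [:: h] => //=; rewrite gh. Qed.

Lemma cay_ray_tail (r : cay_ray) Q : finite_set Q ->
  exists2 g, ~ Q g & tail_in r (component_of Q g).
Proof.
case: r => r [rinj radj] finQ /=.
have finP : finite_set (r @^-1` Q).
  by apply: finite_preimage => // m n _ _; exact: rinj.
have [N hN] : exists N, forall n, (N <= n)%N -> ~ Q (r n).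
  have /finite_seqP[l lE] := finP; exists (\max_(i <- l) i).+1 => n ltn Qrn.
  have nl : n \in l by have : [set` l] n by rewrite -lE.
  by move: ltn; rewrite ltnNge (leq_bigmax_seq n).
exists (r N); first exact: hN.
exists N => n /subnK <-; elim: (n - N)%N => [|k IH].
  exact: component_of_refl.
apply: (component_of_trans IH); apply: component_of_step; apply/asboolP.
move/asboolP: (radj (k + N)%N) => [_ _ rr].
by split=> //; apply: hN; rewrite ?addSn ?leqW ?leq_addl.
Qed.

Lemma same_end_refl : reflexive same_end.
Proof.
move=> r; apply/asboolP => Q finQ; have [g Qg rg] := cay_ray_tail r finQ.
by exists g.
Qed.

Lemma same_end_sym : symmetric same_end.
Proof.
move=> r r'; apply/idP/idP => /asboolP h; apply/asboolP => Q finQ;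
  by have [g Qg [? ?]] := h Q finQ; exists g.
Qed.

Lemma same_end_trans : transitive same_end.
Proof.
move=> r' r r'' /asboolP h /asboolP h'; apply/asboolP => Q finQ.
have [g Qg [rg [N r'g]]] := h Q finQ; have [g' Qg' [[N' r'g'] r''g']] := h' Q finQ.
exists g => //; split => //.
rewrite (component_of_eq (r'g (maxn N N') _) (r'g' (maxn N N') _)) //.
- exact: leq_maxl.
- exact: leq_maxr.
Qed.

Canonical same_end_equiv :=
  EquivRel same_end same_end_refl same_end_sym same_end_trans.

Definition end_space : Type := {eq_quot same_end}%qT.
HB.instance Definition _ := Choice.on end_space.
HB.instance Definition _ := EqQuotient.on end_space.

End Words.
Arguments cay_ray {G} S.
Arguments end_space {G} S.

Definition end_class {G : groupType} {S : set G} (r : cay_ray S) :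
  end_space S := \pi_(end_space S)%qT r.

Definition ends_in {G : groupType} (S U : set G) : set (end_space S) :=
  [set e | exists2 r : cay_ray S, end_class r = e & tail_in r U].
Arguments ends_in {G} S U.

(* The Freudenthal compactification of the Cayley graph, without its edges. *)
Inductive end_compactification {G : groupType} (S : set G) :=
  Vtx of G | End of end_space S.
Arguments Vtx {G S}.
Arguments End {G S}.

HB.instance Definition _ (G : groupType) (S : set G) :=
  gen_eqMixin (end_compactification S).
HB.instance Definition _ (G : groupType) (S : set G) :=
  gen_choiceMixin (end_compactification S).

Section EndTopology.
Context {G : groupType} (S : set G).

Definition end_subbase : set (set (end_space S)) :=
  [set O | exists Q U, [/\ finite_set Q, infinite_components S Q U
                        & O = ends_in S U]].

HB.instance Definition _ :=
  isSubBaseTopological.Build (end_space S) end_subbase id.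

Definition end_compactification_subbase : set (set (end_compactification S)) :=
  [set O | (exists g, O = [set Vtx g]) \/
           exists Q U, [/\ finite_set Q, infinite_components S Q U
                         & O = (Vtx @` U) `|` (End @` ends_in S U)]].

HB.instance Definition _ := isSubBaseTopological.Build
  (end_compactification S) end_compactification_subbase id.

(* Left translation by [g] on rays, ends and the end compactification. *)
Lemma translate_subproof (g : G) (r : cay_ray S) :
  is_cay_ray S (fun n => (g * r n)%g).
Proof.
case: r => r [rinj radj] /=; split => [m n /mulgI/rinj //|n].
have /asboolP[_ _ [s Ss rs]] := radj n; apply/asboolP; split=> //.
by exists s => //; rewrite -!mulgA; case: rs => ->; [left | right].
Qed.

Definition translate (g : G) (r : cay_ray S) : cay_ray S :=
  CayRay (translate_subproof g r).

Definition act_end (g : G) (e : end_space S) : end_space S :=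
  end_class (translate g (repr e)).

Definition act_end_compactification (g : G) (z : end_compactification S) :
  end_compactification S :=
  match z with Vtx h => Vtx (g * h)%g | End e => End (act_end g e) end.

(* The values at pairs of distinct ends are the only meaningful ones. *)
Definition end_level (e e' : end_space S) : int :=
  xget (-1) [set n | let sep k := exists2 g, ~ word_ball S k g &
                         let U := component_of S (word_ball S k) g in
                         ends_in S U e /\ ends_in S U e' in
                     [/\ -1 <= n, sep n & forall k, -1 <= k -> sep k -> k <= n]].

End EndTopology.

(** * Discrete groups of isometries *)

(* A subgroup of the isometry group of [X], as a group with a faithful
   isometric action on [X]. *)
Record isom_group {R : realType} (G : groupType) (X : metricType R) :=
  IsomGroup {
    isom_act :> G -> X -> X ;
    isom_act1 : forall x, isom_act 1%g x = x ;
    isom_actM : forall g h x, isom_act (g * h)%g x = isom_act g (isom_act h x) ;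
    isom_act_dist : forall g x y, mdist (isom_act g x) (isom_act g y) = mdist x y ;
    isom_act_faithful : forall g, (forall x, isom_act g x = x) -> g = 1%g }.

Section IsomGroup.
Context {R : realType} {G : groupType} {X : metricType R} (a : isom_group G X).

(* The topology of the isometry group is the compact-open topology. *)
Definition discrete_isom_group : Prop :=
  forall g, exists2 U : set {compact-open, X -> X},
    nbhs (a g : {compact-open, X -> X}) U & forall h, U (a h) -> h = g.

Lemma act_ray_subproof (g : G) (c : geo_ray X) :
  geodesic_on `[0, +oo[ (fun t => a g (c t)).
Proof. by move=> s t s0 t0; rewrite isom_act_dist; exact: ray_geodesic. Qed.

Definition act_ray (g : G) (c : geo_ray X) : geo_ray X :=
  GeoRay (act_ray_subproof g c).

Definition act_boundary (g : G) (xi : boundary X) : boundary X :=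
  ray_class (act_ray g (repr xi)).

Definition act_bordification (g : G) (z : bordification X) : bordification X :=
  match z with
  | Inner x => Inner (a g x)
  | Bdry xi => Bdry (act_boundary g xi)
  end.

Definition poincare_series (o : X) (s : R) : \bar R :=
  \esum_(g in [set: G]) (expR (- s * mdist o (a g o)))%:E.

Definition critical_exponent (o : X) : \bar R :=
  ereal_inf [set s%:E | s in [set s | 0 < s /\ (poincare_series o s < +oo)%E]].

Definition limit_set (o : X) : set (boundary_at o) :=
  [set xi | closure (range (fun g => Inner (a g o) : visual o)) (Bdry xi)].
Arguments limit_set : clear implicits.

Definition non_elementary (o : X) : Prop :=
  exists xi eta zeta : boundary X,
    [/\ limit_set o xi, limit_set o eta & limit_set o zeta] /\
    [/\ xi <> eta, eta <> zeta & xi <> zeta].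

Definition limit_completion (o : X) : set (visual o) :=
  range (@Inner R X) `|` (@Bdry R X @` limit_set o).

Definition generator_displacement (S : set G) (o : X) : R :=
  sup [set mdist o (a s o) | s in S].

(* The endpoints of [E] are unordered, which is harmless as [bourdon] is
   symmetric. *)
Definition edge_weight (o : X) (xi : G -> boundary X) (E : set G) : R :=
  xget 0 [set w | exists g h, E = [set g; h] /\ w = bourdon o (xi g) (xi h)].

Definition edge_energy (S : set G) (q : R) (o : X) (xi : G -> boundary X)
    (Q : set G) : \bar R :=
  \esum_(E in cay_edges S Q) (powR (edge_weight o xi E) q)%:E.

Definition tail_sum (S : set G) (D q : R) (o : X) (n : int) : \bar R :=
  ((#|` fset_set S |%:R
     * expR (q * (generator_displacement S o + 2 * D)))%:E *
   \esum_(g in [set g | (n < (word_length S g)%:Z)%R])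
      (expR (- q * mdist o (a g o)))%:E)%E.

(* [tail_sum] is finite when the Poincare series converges at [q]. *)
Definition end_dist (S : set G) (D q : R) (o : X) (e e' : end_space S) : R :=
  if e == e' then 0
  else powR (fine (tail_sum S D q o (end_level e e'))) q^-1.

End IsomGroup.
Arguments limit_set {R G X} a o _.
Arguments limit_completion {R G X} a o _.

Definition quotient_map {T U : topologicalType} (f : T -> U) : Prop :=
  (forall y, exists x, f x = y) /\
  forall V : set U, open V <-> open (f @^-1` V).

Definition homeomorphic (T U : topologicalType) : Prop :=
  exists (f : T -> U) (g : U -> T),
    [/\ continuous f, continuous g, cancel f g & cancel g f].

Definition is_cantor_set (T : topologicalType) : Prop :=
  homeomorphic cantor_space T.

(* Main.v *)
Require Import Defs.
From HB Require Import structures.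
From mathcomp Require Import all_boot all_order all_algebra.
From mathcomp Require Import generic_quotient finmap.
From mathcomp Require Import all_classical all_reals all_analysis.
From mathcomp Require Import ring lra.
From mathcomp Require Import zify.

(** The geometric input is one inequality.  Comparison with Stewart's theorem of
    the hyperbolic plane ([CAT_between]) bounds the distance from a point to a point
    of a geodesic, and it implies that [exp_gp o x y], the exponential of minus the
    Gromov product, satisfies the triangle inequality ([exp_gp_triangle]).  As the
    Gromov product increases along geodesics from [o], it extends to the
    bordification; the extension [rb] induces the cone topology near the boundary
    ([visual_cvg]) and restricts to the Bourdon metric ([bourdonE]).  All limits are
    taken along ultrafilters: in a proper space, the geodesics from [o] to points that
    go to infinity converge to a ray ([ray_ultralimit], [rb_ultralimit]).

    Let the Poincare series converge at [q <= 1].  Then the [q]-th power of [rb o] is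
    subadditive along paths of the Cayley graph, and an edge at [g] contributes at most
    a multiple of [expR (- q * d o (a g o))].  Following a simple path inside a
    component [U] of the complement of a finite set, one finds that the orbit of [U]
    has diameter at most a power of the part of the series that [U] carries
    ([orbit_diam]).  Far components carry little, so that the orbit converges along
    each end ([end_limit_exists]); the resulting map is continuous, equivariant and
    Lipschitz for the distance of the tails ([end_dist_bound]).  By Koenig's lemma
    the space of ends is compact and the map is onto the limit set
    ([end_space_compact], [end_limit_surj]), which makes it a quotient map.  The
    components off a ball of radius [n] cover the limit set by sets whose diameters
    have [q]-th powers adding up to a tail of the series; therefore the
    [q]-dimensional measure vanishes ([hausdorff_limit_set_eq0]).  The same path
    argument, with the points [xi g] in place of the orbit points, bounds the energy
    from below: among more separated limit points than there are infinite components,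
    two are limits of ends of one component ([packing_radius_energy]).

    The limit set is compact.  It is perfect by the dynamics of divergent families
    ([north_south]).  It is totally disconnected: the distances from one limit point to
    the others form a set of Lebesgue measure zero, so that arbitrarily small
    spheres miss the limit set ([limit_set_radius]).  Hence it is a Cantor set, and
    there are infinitely many ends.

    The remaining point is that the Hausdorff dimension is at least the critical
    exponent ([critical_exponent_le]).  Below this exponent the series diverges, and an
    ultrafilter that carries the divergence provides elements with orbit points close
    to one attracting point and inverses close to one repelling point.  As no point at
    infinity is fixed by the group ([no_fixed_point]), the two can be separated by a
    fixed element [k], and suitable finite sets of elements [g * k^-1] behave like
    the generators of a free semigroup: the points of words go to infinity, words
    that part after [u] are at distance at least a multiple of
    [expR (- d o (pt u))] ([word_branch]), and the children of a word weigh at least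
    as much as the word, if the weight of [u] is [expR (- s * d o (pt u))].  A cover
    of the limit set by sets of small total gauge would pick words of total weight
    less than that of the empty word, and some infinite word avoids all of them
    ([avoid_words], [cover_word]); its limit point is not covered. *)


Set Implicit Arguments.
Unset Strict Implicit.
Unset Printing Implicit Defensive.

Import Order.TTheory GRing.Theory Num.Theory.
Import numFieldNormedType.Exports.

Local Open Scope classical_set_scope.
Local Open Scope ring_scope.

(** * Hyperbolic comparison *)

Section HyperbolicPlane.
Context {R : realType}.
Implicit Types a b c s t : R.

Definition ch (t : R) : R := (expR t + expR (- t)) / 2.
Definition sh (t : R) : R := (expR t - expR (- t)) / 2.

Lemma ch_sh_sqr t : ch t ^+ 2 - sh t ^+ 2 = 1.
Proof. by have := expRxMexpNx_1 t; rewrite /ch /sh => e; field: e. Qed.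

Lemma ch_sh t : ch t + sh t = expR t.
Proof. by rewrite /ch /sh; field. Qed.

Lemma chD s t : ch (s + t) = ch s * ch t + sh s * sh t.
Proof. by rewrite /ch /sh opprD !expRD; field. Qed.

Lemma shD s t : sh (s + t) = sh s * ch t + ch s * sh t.
Proof. by rewrite /ch /sh opprD !expRD; field. Qed.

Lemma chN t : ch (- t) = ch t.
Proof. by rewrite /ch opprK addrC. Qed.

Lemma shN t : sh (- t) = - sh t.
Proof. by rewrite /sh opprK; field. Qed.

Lemma sh_ge0 t : 0 <= t -> 0 <= sh t.
Proof. by move=> t0; rewrite /sh divr_ge0// subr_ge0 ler_expR; lra. Qed.

Lemma sh_gt0 t : 0 < t -> 0 < sh t.
Proof. by move=> t0; rewrite /sh divr_gt0// subr_gt0 ltr_expR; lra. Qed.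

Lemma ch_gt0 t : 0 < ch t.
Proof. by rewrite /ch divr_gt0// addr_gt0// expR_gt0. Qed.

(** [ch] increases on the nonnegative reals because
   [ch t - ch s = 2 sh ((t - s) / 2) sh ((t + s) / 2)]. *)
Lemma ler_ch s t : `|s| <= t -> ch s <= ch t.
Proof.
rewrite ler_norml => /andP[st1 st2].
have -> : t = (t - s) / 2 + (t + s) / 2 by field.
have {1}-> : s = - ((t - s) / 2) + (t + s) / 2 by field.
rewrite !chD chN shN mulNr lerD2l.
have : 0 <= sh ((t - s) / 2) * sh ((t + s) / 2) by
  apply: mulr_ge0; apply: sh_ge0; lra.
lra.
Qed.

Lemma arcosh_ch t : 0 <= t -> arcosh (ch t) = t.
Proof.
move=> t0; rewrite /arcosh (_ : ch t ^+ 2 - 1 = sh t ^+ 2).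
  by rewrite sqrtr_sqr ger0_norm ?sh_ge0// ch_sh expRK.
by have := ch_sh_sqr t; lra.
Qed.

Lemma ch_le_arcosh t v : 0 <= t -> 0 < v -> t <= arcosh v -> ch t <= v.
Proof.
move=> t0 v0; rewrite /arcosh; have [v1|v1] := leP 1 v; last first.
  rewrite ler0_sqrtr; last by have := expr_le1 (n := 2) isT (ltW v0); rewrite (ltW v1); lra.
  by rewrite addr0 => /(le_trans t0); rewrite leNgt ln_lt0// v0.
set w := Num.sqrt _ => tv.
have w0 : 0 <= w by exact: sqrtr_ge0.
have w2 : w ^+ 2 = v ^+ 2 - 1 by rewrite sqr_sqrtr// subr_ge0 exprn_ege1.
have Et : expR t <= v + w by rewrite -[leRHS]lnK ?posrE ?ler_expR//; lra.
have E1 : 1 <= expR t by rewrite -expR0 ler_expR.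
have EN := expRxMexpNx_1 t.
rewrite /ch; set E := expR t in Et E1 EN *; set E' := expR (- t) in EN *.
have : (v + w - E) * (E - (v - w)) >= 0 by rewrite mulr_ge0//; nra.
nra.
Qed.

Lemma hyp_height_polar t (p : R * R) : p.1 ^+ 2 + p.2 ^+ 2 = sh t ^+ 2 ->
  hyp_height p = ch t.
Proof.
move=> p2; rewrite /hyp_height -addrA p2 (_ : 1 + _ = ch t ^+ 2).
  by rewrite sqrtr_sqr ger0_norm// ltW// ch_gt0.
by have := ch_sh_sqr t; lra.
Qed.

End HyperbolicPlane.

Section Betweenness.
Context {R : realType} {X : metricType R}.
Local Notation d := (@mdist R X).

Definition between (x p y : X) : Prop := d x p + d p y = d x y.

Lemma geodesic_dist (c : R -> X) l s t : geodesic_on `[0, l] c ->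
  0 <= s -> s <= t -> t <= l -> d (c s) (c t) = t - s.
Proof.
move=> cg s0 st tl; rewrite cg /= ?in_itv/=.
- by rewrite distrC ger0_norm// subr_ge0.
- by rewrite s0 (le_trans st).
- by rewrite tl (le_trans s0).
Qed.

Lemma segment_length (c : R -> X) l x y : geodesic_segment c l x y -> d x y = l.
Proof. by move=> [l0 cg <- <-]; rewrite (geodesic_dist cg)// subr0. Qed.

Lemma segment_between (c : R -> X) l x y t : geodesic_segment c l x y ->
  0 <= t -> t <= l -> d x (c t) = t /\ between x (c t) y.
Proof.
move=> cs t0 tl; have xyl := segment_length cs.
case: cs => l0 cg c0 cl; have xt : d x (c t) = t.
  by rewrite -c0 (geodesic_dist cg)// subr0.
split => //; rewrite /between xyl xt -cl (geodesic_dist cg)//; lra.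
Qed.

(** The concatenation of two geodesics is a geodesic here, as otherwise the triangle
    inequality would make [d x y] smaller than [d x p + d p y]. *)
Lemma between_segment (X_geo : geodesic_space X) x p y : between x p y ->
  exists c, geodesic_segment c (d x y) x y /\ c (d x p) = p.
Proof.
move=> xpy; have [c [l cs]] := X_geo x p; have [c' [l' cs']] := X_geo p y.
have xpl := segment_length cs; have pyl := segment_length cs'.
case: cs => l0 cg c0 cl; case: cs' => l'0 c'g c'0 c'l.
have xyl : d x y = l + l' by rewrite -xpy xpl pyl.
pose cc t := if t <= l then c t else c' (t - l).
have le_cc s t : 0 <= s -> s <= t -> t <= l + l' -> d (cc s) (cc t) = t - s.
  move=> s0 st tl; rewrite /cc; have [tl1|tl1] := leP t l.
    by rewrite (le_trans st tl1) (geodesic_dist cg).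
  have tl0 : 0 <= t - l by lra.
  have tl' : t - l <= l' by lra.
  have [sl|sl] := leP s l; last by rewrite (geodesic_dist c'g); lra.
  have d1 : d (c s) p = l - s by rewrite -cl (geodesic_dist cg).
  have d2 : d p (c' (t - l)) = t - l by rewrite -c'0 (geodesic_dist c'g)// subr0.
  have d3 : d x (c s) = s by rewrite -c0 (geodesic_dist cg)// subr0.
  have d4 : d (c' (t - l)) y = l' - (t - l) by rewrite -c'l (geodesic_dist c'g).
  have t1 := metric_triangle (c s) p (c' (t - l)).
  have t2 := metric_triangle x (c s) y.
  have t3 := metric_triangle (c s) (c' (t - l)) y.
  by apply/le_anti/andP; split; lra.
exists cc; split; last by rewrite /cc xpl lexx.
split; rewrite ?mdist_ge0// ?xyl.
- move=> s t /=; rewrite !in_itv/= => /andP[s0 sl] /andP[t0 tl].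
  have [st|/ltW st] := leP s t.
    by rewrite le_cc// distrC ger0_norm// subr_ge0.
  by rewrite metric_sym le_cc// ger0_norm// subr_ge0.
- by rewrite /cc l0.
- rewrite /cc; case: leP => [l'l|_]; last by rewrite addrAC subrr add0r.
  have l'0E : l' = 0 by lra.
  by rewrite l'0E addr0 cl -c'0 -l'0E.
Qed.

(** Stewart's theorem of hyperbolic geometry, which is an equality in the
    hyperbolic plane: there the point [p] of the segment [[o, y]] is, as a vector
    of Minkowski space, the combination of [o] and [y] with the weights
    [sh (d p y) / sh (d o y)] and [sh (d o p) / sh (d o y)]. *)
Lemma CAT_stewart (X_CAT : CAT_minus1 X) x o p y : between o p y ->
  ch (d x p) * sh (d o y) <= ch (d x o) * sh (d p y) + ch (d x y) * sh (d o p).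
Proof.
move=> opy; case: X_CAT => X_geo X_CAT.
have pE : d p y = d o y - d o p by rewrite -opy; lra.
have s0 : 0 <= d o p by exact: mdist_ge0.
have sa : d o p <= d o y by have := mdist_ge0 p y; lra.
have [a0|a0] := ltrP 0 (d o y); last first.
  have oy : d o y = 0 by have := mdist_ge0 o y; lra.
  have op : d o p = 0 by lra.
  by rewrite pE oy op subr0 /sh oppr0 subrr mul0r !mulr0 addr0.
have [b0|b0] := ltrP 0 (d x o); last first.
  have xo : x = o by apply: mdist_positivity; have := mdist_ge0 x o; lra.
  have := shD (d o y) (- d o p); rewrite -pE chN shN xo mdistxx => ->.
  by rewrite {2}/ch oppr0 expR0; lra.
have sha := sh_gt0 a0; have shb := sh_gt0 b0.
set C := (ch (d o y) * ch (d x o) - ch (d x y)) / (sh (d o y) * sh (d x o)).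
have CE : sh (d o y) * sh (d x o) * C = ch (d o y) * ch (d x o) - ch (d x y).
  by rewrite /C mulrC divfK// mulf_neq0// gt_eqF.
have C1 : `|C| <= 1.
  have M0 : 0 < sh (d o y) * sh (d x o) by exact: mulr_gt0.
  rewrite -(ler_pM2l M0) mulr1 -[X in X * `|C|]ger0_norm ?(ltW M0)//.
  rewrite -normrM CE ler_norml.
  have h1 : ch (d x y) <= ch (d o y + d x o).
    apply: ler_ch; rewrite ger0_norm ?mdist_ge0// addrC.
    exact: metric_triangle.
  have h2 : ch (d o y - d x o) <= ch (d x y).
    apply: ler_ch; rewrite ler_norml.
    have := metric_triangle o x y; have := metric_triangle x y o.
    by rewrite (metric_sym o x) (metric_sym y o) => *; apply/andP; split; lra.
  move: h1 h2; rewrite !chD chN shN mulrN => h1 h2.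
  by apply/andP; split; lra.
have C2 : C ^+ 2 <= 1 by rewrite -real_normK ?num_real// exprn_ile1.
set T := Num.sqrt (1 - C ^+ 2).
have T2 : T ^+ 2 = 1 - C ^+ 2 by rewrite sqr_sqrtr// subr_ge0.
have [c [cs cp]] := between_segment X_geo opy.
have [c' [b cs']] := X_geo o x; have bE := segment_length cs'.
have c'b : c' b = x by case: cs'.
have H t : hyp_height (sh t, 0 : R) = ch t.
  by apply: hyp_height_polar; rewrite /= expr0n/= addr0.
have Hx : hyp_height (sh (d x o) * C, sh (d x o) * T) = ch (d x o).
  apply: hyp_height_polar => /=; rewrite -[RHS]mulr1.
  have <- : C ^+ 2 + T ^+ 2 = 1 by rewrite T2 addrC subrK.
  by ring.
have /(X_CAT o y x c c' (d o y) b (d o p) b cs cs') : 0 <= d o p <= d o y.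
  by rewrite s0.
have b0' : 0 <= b <= b by rewrite lexx -bE mdist_ge0.
move=> /(_ b0' (0, 0) (sh (d o y), 0) (sh (d x o) * C, sh (d x o) * T)
  (sh (d o p), 0) (sh (d x o) * C, sh (d x o) * T)).
have H0 : hyp_height (0, 0 : R) = 1.
  by rewrite /hyp_height /= expr0n/= !addr0 sqrtr1.
rewrite /hyp_dist /= H0 !H Hx !mul0r ?mulr0 !mul1r !subr0 cp c'b.
have -> : ch (d o p) * ch (d o y) - sh (d o p) * sh (d o y) = ch (d o y - d o p).
  by rewrite chD chN shN; ring.
have -> : ch (d o y) * ch (d x o) - sh (d o y) * (sh (d x o) * C) = ch (d x y).
  by rewrite mulrA CE; ring.
have -> : ch (d x o) * ch (d x o) - sh (d x o) * C * (sh (d x o) * C) -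
    sh (d x o) * T * (sh (d x o) * T) = ch 0.
  have -> : ch 0 = 1 :> R by rewrite /ch oppr0 expR0; field.
  rewrite -(ch_sh_sqr (d x o)) -[X in _ = _ - X]mulr1.
  have <- : C ^+ 2 + T ^+ 2 = 1 by rewrite T2 addrC subrK.
  by ring.
rewrite !arcosh_ch ?mdist_ge0 ?subr_ge0//.
rewrite (metric_sym x o) -bE subrr (metric_sym y x) (metric_sym p x).
set V := ch (d o p) * _ - _.
move=> /(_ erefl erefl erefl erefl erefl erefl erefl) dV.
have Vsh : V * sh (d o y) = ch (d x o) * sh (d p y) + ch (d x y) * sh (d o p).
  have -> : V * sh (d o y) = ch (d o p) * ch (d x o) * sh (d o y) -
      sh (d o p) * (sh (d o y) * sh (d x o) * C) by rewrite /V (metric_sym o x); ring.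
  by rewrite CE pE shD chN shN; ring.
have V0 : 0 < V.
  have p1 := ch_gt0 (d x o); have p2 := ch_gt0 (d x y).
  rewrite -(pmulr_lgt0 _ sha) Vsh; have [s1|s1] := ltrP 0 (d o p).
    have := mulr_gt0 p2 (sh_gt0 s1).
    by have := mulr_ge0 (ltW p1) (sh_ge0 (mdist_ge0 p y)); lra.
  have r1 : 0 < d p y by rewrite pE; lra.
  have := mulr_gt0 p1 (sh_gt0 r1).
  by have := mulr_ge0 (ltW p2) (sh_ge0 s0); lra.
by rewrite (metric_sym o x) -Vsh ler_pM2r// ch_le_arcosh ?mdist_ge0.
Qed.

(** In the comparison theorem the weights [sh (d p y) / sh (d o y)] and
    [sh (d o p) / sh (d o y)] fall short of [expR (- d o p)] and
    [expR (- d p y)]; the terms that are lost this way dominate the terms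
    [expR (- d x o)] and [expR (- d x y)] of the hyperbolic cosines, because of
    the triangle inequality [d o y <= d x o + d x y].  All the geometry
    below rests on this inequality. *)
Lemma CAT_between (X_CAT : CAT_minus1 X) x o p y : between o p y ->
  2 * ch (d x p) <= expR (d x o - d o p) + expR (d x y - d p y).
Proof.
move=> opy; have := CAT_stewart X_CAT x opy.
have oy : d o y <= d x o + d x y.
  by rewrite (metric_sym x o); exact: metric_triangle.
have s0 := mdist_ge0 o p; have r0 := mdist_ge0 p y; move: opy; rewrite /between.
have [E|sr_neq0] := eqVneq (d o y) 0; last first.
  move=> srE; rewrite -srE in oy sr_neq0 *; move: oy sr_neq0 {srE}.
  move: s0 r0; set D := d x p; set b := d x o; set c := d x y.
  set s := d o p; set r := d p y => s0 r0 sr_le sr_neq0.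
  have sr0 : 0 < s + r by rewrite lt_neqAle eq_sym sr_neq0 addr_ge0.
  have shsr := sh_gt0 sr0; move: shsr; set A := ch D.
  rewrite /ch /sh opprD !expRD !expRN.
  set u := expR s; set v := expR r; set B := expR b; set K := expR c => shsr.
  have u0 : 0 < u by exact: expR_gt0.
  have v0 : 0 < v by exact: expR_gt0.
  have B0 : 0 < B by exact: expR_gt0.
  have K0 : 0 < K by exact: expR_gt0.
  have uvBK : u * v <= B * K by rewrite -!expRD ler_expR.
  have key : 0 <= (v - v^-1) * (K / (u * v) - B^-1) +
                  (u - u^-1) * (B / (u * v) - K^-1).
    have inv_le (w : R) : 1 <= w -> 0 <= w - w^-1.
      move=> w1; rewrite subr_ge0 (le_trans _ w1)// invf_le1//.
      exact: lt_le_trans w1.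
    apply: addr_ge0; apply: mulr_ge0; rewrite ?inv_le -?expR0 ?ler_expR//.
      by rewrite subr_ge0 ler_pdivlMr ?mulr_gt0// [_ * (_ * _)]mulrC ler_pdivrMr// (mulrC K).
    by rewrite subr_ge0 ler_pdivlMr ?mulr_gt0// [_ * (_ * _)]mulrC ler_pdivrMr.
  move=> st; rewrite -(ler_pM2r shsr) -mulrA.
  apply: (le_trans (ler_wpM2l _ st)) => //.
  rewrite -subr_ge0; match goal with |- is_true (0 <= ?g) =>
    have -> : g = ((v - v^-1) * (K / (u * v) - B^-1) +
                   (u - u^-1) * (B / (u * v) - K^-1)) / 2 end.
    by field; rewrite !gt_eqF.
  by rewrite divr_ge0.
move=> opy; have -> : p = o by apply/esym/mdist_positivity; lra.
have <- : o = y by exact: mdist_positivity.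
rewrite mdistxx !subr0 /ch [2 * _]mulrC divfK// lerD2l ler_expR.
by have := mdist_ge0 x o; lra.
Qed.

End Betweenness.

(** Bundling the two hypotheses on the space with its type keeps them out of the
    statements of the lemmas. *)
Record proper_CAT (R : realType) := ProperCAT {
  proper_CAT_space :> metricType R ;
  proper_CAT_proper : proper_space proper_CAT_space ;
  proper_CAT_CAT : CAT_minus1 proper_CAT_space }.

(** * Gromov products *)

Section GromovProduct.
Context {R : realType} {X : proper_CAT R}.
Let X_CAT := proper_CAT_CAT X.
Local Notation d := (@mdist R X).
Implicit Types (o x y z p q : X) (s t : R).

Definition exp_gp o x y : R := expR (- gromov_product o x y).

Lemma exp_gp_ge0 o x y : 0 <= exp_gp o x y.
Proof. exact: expR_ge0. Qed.

Lemma gromov_product_sym o x y : gromov_product o x y = gromov_product o y x.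
Proof. by rewrite /gromov_product (metric_sym x y) [d o x + _]addrC. Qed.

Lemma exp_gp_sym o x y : exp_gp o x y = exp_gp o y x.
Proof. by rewrite /exp_gp gromov_product_sym. Qed.

Lemma gromov_product_le o x y : gromov_product o x y <= d o x.
Proof.
rewrite /gromov_product; have := metric_triangle o x y; have := mdist_ge0 x y.
lra.
Qed.

Lemma gromov_product_ge0 o x y : 0 <= gromov_product o x y.
Proof.
rewrite /gromov_product; have := metric_triangle x o y.
rewrite (metric_sym x o); lra.
Qed.

Lemma gromov_product_origin o o' x y :
  gromov_product o x y <= gromov_product o' x y + d o o'.
Proof.
rewrite /gromov_product; have := metric_triangle o o' x.
have := metric_triangle o o' y; lra.
Qed.

Lemma gromov_product_compl o o' x :
  gromov_product o o' x + gromov_product o' o x = d o o'.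
Proof. rewrite /gromov_product (metric_sym o' o) (metric_sym o x); lra. Qed.

Lemma gromov_product_between o x y p q : between o p x -> between o q y ->
  gromov_product o p q <= gromov_product o x y.
Proof.
rewrite /between /gromov_product => <- <-.
have := metric_triangle x p y; have := metric_triangle p q y.
rewrite (metric_sym x p); lra.
Qed.

Lemma between_exists o x s : 0 <= s -> s <= d o x ->
  exists p, between o p x /\ d o p = s.
Proof.
move=> s0 sx; have [c [l cs]] := X_CAT.1 o x.
have [|op opx] := segment_between cs s0; first by rewrite -(segment_length cs).
by exists (c s).
Qed.

Lemma expR_le2ch s : expR s <= 2 * ch s.
Proof. by rewrite /ch [2 * _]mulrC divfK// lerDl expR_ge0. Qed.

(** A CAT(-1) space is strongly hyperbolic.  A path from [x] to [z] passes
    through the geodesic from [o] to [y]; the bounds on the distances of [x]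
    and of [z] to the point at distance [r] from [y] have a product whose value
    is smallest when the two terms [M] below agree, which determines [r]. *)
Lemma exp_gp_triangle o x y z :
  exp_gp o x z <= exp_gp o x y + exp_gp o y z.
Proof.
have t1 := metric_triangle x o y; have t2 := metric_triangle y o z.
have t3 := metric_triangle o y x; have t4 := metric_triangle o y z.
have t5 := metric_triangle o x y; have t6 := metric_triangle o z y.
pose r := (d x y + d y z - d o x - d o z + 2 * d o y) / 4.
rewrite (metric_sym x o) (metric_sym y o) (metric_sym y x) (metric_sym z y)
  in t1 t2 t3 t6.
have r0 : 0 <= r by rewrite /r; lra.
have rt : r <= d o y by rewrite /r; lra.
have [||p [opy op]] := @between_exists o y (d o y - r); [lra..|].
have py : d p y = r by move: opy; rewrite /between op; lra.
have hx := CAT_between X_CAT x opy; have hz := CAT_between X_CAT z opy.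
have {}hx := le_trans (expR_le2ch _) hx.
have {}hz := le_trans (expR_le2ch _) hz.
have := metric_triangle x p z; rewrite (metric_sym p z) => xpz.
rewrite -ler_expR expRD in xpz.
have {xpz hx hz} := le_trans xpz (ler_pM (expR_ge0 _) (expR_ge0 _) hx hz).
rewrite op py (metric_sym x o) (metric_sym z o) (metric_sym z y).
set E1 := expR _; set A1 := expR _; set A2 := expR _; set B1 := expR _.
set B2 := expR _ => le_prod.
pose M := expR ((d o x + d o z + d x y + d y z) / 2 - d o y).
pose a := expR ((d o x + d y z - d o y) / 2).
pose b := expR ((d o z + d x y - d o y) / 2).
have AB1 : A1 * B1 = M by rewrite -expRD; congr expR; rewrite /r; field.
have AB2 : A2 * B2 = M by rewrite -expRD; congr expR; rewrite /r; field.
have ab : a * b = M by rewrite -expRD; congr expR; field.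
have aa : a * a = A1 * B2 by rewrite -!expRD; congr expR; rewrite /r; field.
have bb : b * b = A2 * B1 by rewrite -!expRD; congr expR; rewrite /r; field.
have sq : expR (d x z / 2) <= a + b.
  rewrite -ler_sqr ?nnegrE ?addr_ge0 ?expR_ge0// expr2 -expRD.
  by rewrite (_ : _ + _ = d x z); [rewrite -/E1; nra|field].
have /(ler_wpM2r (expR_ge0 (- (d o x + d o z) / 2))) := sq.
rewrite mulrDl -!expRD /exp_gp /gromov_product => h.
apply: (le_trans _ (le_trans h _)).
  by rewrite ler_expR; lra.
by rewrite addrC lerD// ler_expR; lra.
Qed.

Lemma exp_gp_origin o o' x y : exp_gp o x y <= expR (d o o') * exp_gp o' x y.
Proof.
rewrite -expRD ler_expR; have := gromov_product_origin o' o x y.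
by rewrite metric_sym; lra.
Qed.

Lemma ch_small t e : 0 <= t -> 0 <= e -> 2 * ch t <= 2 + e ^+ 2 -> t <= 2 * e.
Proof.
move=> t0 e0; set u := expR (t / 2); set v := expR (- (t / 2)).
have uv : u * v = 1 by exact: expRxMexpNx_1.
have uu : u * u = expR t by rewrite -expRD; congr expR; field.
have vv : v * v = expR (- t) by rewrite -expRD; congr expR; field.
have u1 : 1 + t / 2 <= u by exact: expR_ge1Dx.
have v1 : v <= 1 by rewrite -expR0 ler_expR; lra.
rewrite /ch -uu -vv => h.
have uv2 : (u - v) ^+ 2 <= e ^+ 2 by nra.
have : u - v <= e by rewrite -ler_sqr ?nnegrE//; lra.
lra.
Qed.

(** Exponential divergence of geodesics: two geodesics from [o] remain together
    up to time about [gromov_product o x y].  One application of [CAT_between] to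
    each of the two sides of the triangle gives
    [2 ch (d p q) <= 2 + (expR (d o p) * exp_gp o x y) ^ 2]. *)
Lemma between_contract o x y p q : between o p x -> between o q y ->
  d o p = d o q -> d p q <= 2 * (expR (d o p) * exp_gp o x y).
Proof.
move=> opx oqy pq; apply: ch_small; rewrite ?mdist_ge0 ?mulr_ge0 ?expR_ge0//.
have h1 := CAT_between X_CAT p oqy; have h2 := CAT_between X_CAT y opx.
have {h2} h2 := le_trans (expR_le2ch _) h2.
apply: (le_trans h1).
rewrite (metric_sym p o) pq subrr expR0 -{1}[2]/(1 + 1) -addrA lerD2l.
have -> : expR (d p y - d q y) = expR (d y p) * expR (- d q y).
  by rewrite -expRD (metric_sym y p).
apply: (le_trans (ler_wpM2r (expR_ge0 _) h2)).
move: opx oqy; rewrite /between => opx oqy.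
rewrite mulrDl -!expRD (metric_sym y o) (metric_sym y x) -oqy pq.
rewrite (_ : _ - d q y = 0); last by ring.
rewrite expR0 lerD2l expr2 -expRD ler_expR /gromov_product.
by rewrite -opx -oqy pq; lra.
Qed.

Lemma between_unique o x p q : between o p x -> between o q x ->
  d o p = d o q -> p = q.
Proof.
move=> opx oqx pq; apply: mdist_positivity.
have := CAT_between X_CAT p oqx; rewrite (metric_sym p o) pq subrr expR0.
have -> : d p x = d q x by move: opx oqx; rewrite /between pq => <- /addrI.
rewrite subrr expR0 => h; apply/le_anti; rewrite mdist_ge0 andbT.
rewrite -[leRHS](mulr0 2); apply: ch_small => //; rewrite ?mdist_ge0//.
by rewrite expr0n addr0.
Qed.

End GromovProduct.

(** * Rays and the Gromov product on the bordification *)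

Section Rays.
Context {R : realType} {X : proper_CAT R}.
Local Notation d := (@mdist R X).
Implicit Types (o x y z p q : X) (s t : R) (c : geo_ray X).

Lemma ray_dist c s t : 0 <= s -> s <= t -> d (c s) (c t) = t - s.
Proof.
move=> s0 st; rewrite ray_geodesic /= ?in_itv/= ?andbT//.
  by rewrite distrC ger0_norm// subr_ge0.
exact: le_trans st.
Qed.

Lemma ray_between c s t : 0 <= s -> s <= t -> between (c 0) (c s) (c t).
Proof.
move=> s0 st; rewrite /between !ray_dist ?lexx//; first by ring.
exact: le_trans st.
Qed.

Lemma expR_le_eps (K e : R) : 0 < e -> exists2 T, 0 <= T &
  forall t, T <= t -> expR (K - t) < e.
Proof.
move=> e0; exists (Num.max 0 (K - ln e + 1)); first by rewrite le_max lexx.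
move=> t; rewrite ge_max => /andP[_ ht].
by rewrite -[ltRHS]lnK ?posrE// ltr_expR; lra.
Qed.

(** At a late time [u] the two rays, which stay at distance at most [K], have
    Gromov product at least [u - K / 2]; hence by [between_contract] their
    distance at time [t] is of the order of [expR (t + K / 2 - u)]. *)
Lemma ray_unique c c' : c 0 = c' 0 -> asymptotic c c' ->
  forall t, 0 <= t -> c t = c' t.
Proof.
move=> c0 /asboolP[K cK] t t0; apply: mdist_positivity; apply/le_anti.
rewrite mdist_ge0 andbT; apply/ler_addgt0Pr => e e0; rewrite add0r.
have e2 : 0 < e / 2 by exact: divr_gt0.
have [T T0 hT] := expR_le_eps (t + K / 2) e2.
pose u := Num.max t T; have tu : t <= u by rewrite le_max lexx.
have Tu : T <= u by rewrite le_max lexx orbT.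
have bc := ray_between c t0 tu; have := ray_between c' t0 tu.
have u0 := le_trans t0 tu.
have D v : 0 <= v -> d (c 0) (c v) = v by move=> v0; rewrite ray_dist ?subr0.
have D' v : 0 <= v -> d (c 0) (c' v) = v by move=> v0; rewrite c0 ray_dist ?subr0.
rewrite -c0 => bc'; have := between_contract bc bc'.
rewrite D// D'// => /(_ erefl)/le_trans; apply.
rewrite /exp_gp -expRD /gromov_product D// D'//.
have := cK u u0 => ck.
have : expR (t - (u + u - d (c u) (c' u)) / 2) <= expR (t + K / 2 - u).
  by rewrite ler_expR; lra.
by have := hT _ Tu; lra.
Qed.

(** [ball_proj] with the radius ranging over all reals, which makes arithmetic with
    radii possible. *)
Definition pr o (z : bordification X) (t : R) : X :=
  match z with
  | Inner x => xget o [set y | mdist o y = Num.min t (mdist o x) /\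
                               mdist o y + mdist y x = mdist o x]
  | Bdry xi => ray_from o xi t
  end.

Arguments pr : simpl never.

Lemma ball_projE o (z : bordification X) (r : {nonneg R}) : ball_proj o z r = pr o z r%:num.
Proof. by case: z. Qed.

Lemma pr_innerP o x t : 0 <= t ->
  d o (pr o (Inner x) t) = Num.min t (d o x) /\ between o (pr o (Inner x) t) x.
Proof.
move=> t0; rewrite /pr; case: xgetP => [y -> []//|] none; exfalso.
have [|| p [opx op]] := @between_exists _ X o x (Num.min t (d o x)).
- by rewrite le_min t0 mdist_ge0.
- by rewrite ge_min lexx orbT.
- exact: (none p).
Qed.

Lemma pr_innerE o x y t : 0 <= t -> between o y x -> d o y = Num.min t (d o x) ->
  pr o (Inner x) t = y.
Proof.
move=> t0 oyx oy; have [op opx] := pr_innerP o x t0.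
by apply: (between_unique opx oyx); rewrite oy.
Qed.

Lemma pr_inner_far o x t : 0 <= t -> d o x <= t -> pr o (Inner x) t = x.
Proof.
move=> t0 xt; apply: pr_innerE => //; first by rewrite /between mdistxx addr0.
by rewrite min_r.
Qed.

Lemma pr_inner_between o x s t : 0 <= s -> s <= t ->
  between o (pr o (Inner x) s) (pr o (Inner x) t).
Proof.
move=> s0 st; have t0 := le_trans s0 st.
have [pt ptx] := pr_innerP o x t0; set q := pr o (Inner x) t in pt ptx *.
have [||p [opq op]] := @between_exists _ X o q (Num.min s (d o x)).
- by rewrite le_min s0 mdist_ge0.
- by rewrite pt le_min !ge_min st lexx orbT.
rewrite (@pr_innerE _ _ p)//; move: opq ptx; rewrite /between => opq ptx.
apply/le_anti; rewrite metric_triangle andbT -ptx -opq -addrA lerD2l.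
exact: metric_triangle.
Qed.

Lemma pr_dist o x s t : 0 <= s -> s <= t -> t <= d o x ->
  d (pr o (Inner x) s) (pr o (Inner x) t) = t - s.
Proof.
move=> s0 st tx; have := pr_inner_between o x s0 st; rewrite /between.
have [-> _] := pr_innerP o x s0; have [-> _] := pr_innerP o x (le_trans s0 st).
rewrite !min_l ?(le_trans st)// => h.
by apply/eqP; rewrite eq_sym subr_eq addrC h.
Qed.

Section Ultralimit.
Context (o : X) (I : Type) (U : set_system I) (UU : UltraFilter U) (x : I -> X).
Context (x_oo : forall M, U [set i | M <= d o (x i)]).

Lemma pr_ultralimit t : 0 <= t -> exists p, forall e, 0 < e ->
  U [set i | d (pr o (Inner (x i)) t) p < e].
Proof.
move=> t0; pose f i := pr o (Inner (x i)) t.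
have := @proper_CAT_proper _ X o t; rewrite compact_ultra => cpt.
have UF : UltraFilter (f @ U).
  split; first exact: fmap_proper_filter.
  move=> G GF sub; apply/seteqP; split => // A GA.
  have [//|UA] := in_ultra_setVsetC (f @^-1` A) UU.
  have : G (~` A) by exact: sub.
  by move=> /(filterI GA); rewrite setICr => /filter_ex[].
have [|p [_ fp]] := cpt (f @ U) UF.
  change (U (f @^-1` [set y | d o y <= t])).
  apply: filterE => i /=; have [-> _] := pr_innerP o (x i) t0.
  by rewrite ge_min lexx.
exists p => e e0; have : U (f @^-1` ball p e) := fp _ (nbhsx_ballx p e e0).
apply: filterS => i /=.
by rewrite ballEmdist /= metric_sym.
Qed.

(** As the closed balls are compact, the geodesics from [o] to [x i] converge
    pointwise along the ultrafilter, which takes the place of a diagonal sequence;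
    as [x i] goes to infinity, the limit is a geodesic ray. *)
Lemma ray_ultralimit : exists c, c 0 = o /\ forall t e, 0 <= t -> 0 < e ->
  U [set i | d (pr o (Inner (x i)) t) (c t) < e].
Proof.
have : forall t : R, exists p, 0 <= t -> forall e, 0 < e ->
    U [set i | d (pr o (Inner (x i)) t) p < e].
  move=> t; have [t0|t0] := leP 0 t; last by exists o => ?; lra.
  by have [p hp] := pr_ultralimit t0; exists p.
move=> /choice[c hc].
have c_geo : geodesic_on `[0, +oo[ c.
  suff H s t : 0 <= s -> s <= t -> d (c s) (c t) = t - s.
    move=> s t /=; rewrite !in_itv/= !andbT => s0 t0.
    have [st|/ltW st] := leP s t; first by rewrite H// distrC ger0_norm ?subr_ge0.
    by rewrite metric_sym H// ger0_norm ?subr_ge0.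
  move=> s0 st; have t0 := le_trans s0 st.
  have near_eq (e : R) : 0 < e -> `|d (c s) (c t) - (t - s)| <= e.
    move=> e0; have e2 : 0 < e / 2 by exact: divr_gt0.
    have [i /= [[xi hs] ht]] :=
      filter_ex (filterI (filterI (x_oo t) (hc s s0 _ e2)) (hc t t0 _ e2)).
    have := pr_dist s0 st xi.
    move: hs ht; set p := pr _ _ s; set q := pr _ _ t => hs ht <-.
    have := metric_triangle (c s) p (c t); have := metric_triangle p q (c t).
    have := metric_triangle p (c s) q; have := metric_triangle (c s) (c t) q.
    rewrite (metric_sym (c s) p) (metric_sym (c t) q) => *.
    by rewrite ler_norml; apply/andP; split; lra.
  apply/le_anti/andP; split; apply/ler_addgt0Pr => e /near_eq;
    by rewrite ler_norml => /andP[]; lra.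
exists (GeoRay c_geo); split => /=; last by move=> t e t0 e0; exact: hc.
apply: mdist_positivity; apply/le_anti; rewrite mdist_ge0 andbT.
apply/ler_addgt0Pr => e e0; rewrite add0r.
have [i /=] := filter_ex (hc 0 (lexx 0) e e0).
have [pE _] := pr_innerP o (x i) (lexx 0).
rewrite min_l ?mdist_ge0// in pE.
by rewrite -(mdist_positivity _ _ pE) metric_sym => /ltW.
Qed.

End Ultralimit.
End Rays.
#[global] Arguments pr : simpl never.

Section BoundaryRays.
Context {R : realType} {X : proper_CAT R}.
Local Notation d := (@mdist R X).
Implicit Types (o x y p q : X) (s t : R) (c : geo_ray X).
Implicit Types (z w : bordification X) (xi eta : boundary X).

Lemma nat_ultrafilter : exists U : set_system nat, UltraFilter U /\ \oo `<=` U.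
Proof. exact: (ultraFilterLemma (eventually_filter)). Qed.

Lemma ultra_nat_ge (U : set_system nat) : UltraFilter U -> \oo `<=` U ->
  forall M : R, U [set n | M <= n%:R].
Proof.
move=> UU Uoo M; apply: Uoo; exists (Num.truncn `|M|).+1 => // n /= hn.
apply: le_trans (ler_norm M) _; apply/ltW/(lt_le_trans (truncnS_gt _)).
by rewrite ler_nat.
Qed.

Lemma ray_class_eq c c' : ray_class c = ray_class c' <-> asymptotic c c'.
Proof. by split => [/eqmodP|h]//; apply/eqmodP. Qed.

(** The ray is a limit of the segments from [o] to far points of [c].  For a
    point [p] of such a segment, [CAT_between] bounds the distance to the point of
    [c] at the same time by the excess of [d p (c 0)] and [d p (x n)] over the
    distances measured along [c], that is by a multiple of [d o (c 0)]. *)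
Lemma ray_exists o c : exists c', c' 0 = o /\ asymptotic c c'.
Proof.
have [U [UU Uoo]] := nat_ultrafilter.
pose K := d o (c 0); pose x (n : nat) := c n%:R.
have xn (n : nat) : d (c 0) (x n) = n%:R by rewrite ray_dist// subr0.
have x_oo M : U [set n | M <= d o (x n)].
  have := ultra_nat_ge UU Uoo (M + K); apply: filterS => n /=.
  have := metric_triangle (c 0) o (x n); rewrite xn (metric_sym (c 0)) -/K.
  lra.
have [c' [c'0 hc']] := ray_ultralimit UU x_oo.
exists c'; split => //; apply/asboolP; exists (K + 2) => t t0.
have [n /= [[tn tx] near]] := filter_ex (filterI (filterI (ultra_nat_ge UU Uoo t)
  (x_oo t)) (hc' t 1 t0 ltr01)).
have [ps psx] := pr_innerP o (x n) t0.
move: near ps psx; set p := pr o _ t; rewrite min_l// => near ps.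
rewrite /between ps => psx.
have := CAT_between (proper_CAT_CAT X) p (ray_between c t0 tn); rewrite -/(x n).
rewrite !ray_dist// subr0 => /(le_trans (expR_le2ch _)) h.
have h1 : d p (c 0) <= t + K by rewrite -ps (metric_sym o p); exact: metric_triangle.
have h2 : d p (x n) - (n%:R - t) <= K.
  have := metric_triangle o (c 0) (x n); rewrite xn -/K. lra.
have h3 : expR (d p (c t)) <= expR (K + 1).
  apply: (le_trans h); rewrite [leRHS]expRD.
  apply: (@le_trans _ _ (expR K + expR K)).
    by rewrite lerD// ler_expR; lra.
  have := expR_ge1Dx (1 : R); have := expR_gt0 K; nra.
rewrite ler_expR in h3.
by have := metric_triangle (c t) p (c' t); rewrite (metric_sym (c t) p); lra.
Qed.

Lemma ray_fromP o xi : exists c, [/\ ray_class c = xi, c 0 = o &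
  forall t, ray_from o xi t = c t].
Proof.
rewrite /ray_from; case: xgetP => [f -> [c [cxi c0 ->]]|none]; first by exists c.
have [c' [c'0 cc']] := ray_exists o (repr xi).
exfalso; apply: (none (c' : R -> X)); exists c'; split => //.
by rewrite -[xi]reprK; apply/esym/ray_class_eq.
Qed.

Lemma ray_fromE o xi c t : ray_class c = xi -> c 0 = o -> 0 <= t ->
  ray_from o xi t = c t.
Proof.
move=> cxi c0 t0; have [c' [c'xi c'0 ->]] := ray_fromP o xi.
by apply: ray_unique; rewrite ?c'0 ?c0//; apply/ray_class_eq; rewrite c'xi cxi.
Qed.

Definition reach o z t : R :=
  if z is Inner x then Num.min t (d o x) else t.

Lemma pr_reach o z t : 0 <= t -> d o (pr o z t) = reach o z t.
Proof.
case: z => [x|xi] t0 /=; first by case: (pr_innerP o x t0).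
have [c [_ c0 cE]] := ray_fromP o xi.
by rewrite /pr cE -c0 ray_dist ?subr0.
Qed.

Lemma pr_between o z s t : 0 <= s -> s <= t ->
  between o (pr o z s) (pr o z t).
Proof.
case: z => [x|xi] s0 st; first exact: pr_inner_between.
have [c [_ <- cE]] := ray_fromP o xi; rewrite /pr !cE.
exact: ray_between.
Qed.

(** The exponential of minus the Gromov product of [z] and [w], which is
    monotone along the geodesics from [o] to [z] and [w]; on the boundary this is
    the Bourdon metric. *)
Definition rb o z w : R :=
  inf [set exp_gp o (pr o z t) (pr o w t) | t in [set t | 0 <= t]].

Lemma exp_gp_pr_antitone o z w s t : 0 <= s -> s <= t ->
  exp_gp o (pr o z t) (pr o w t) <= exp_gp o (pr o z s) (pr o w s).
Proof.
move=> s0 st; rewrite ler_expR lerN2.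
by apply: gromov_product_between; exact: pr_between.
Qed.

Lemma rb_has_inf o z w :
  has_inf [set exp_gp o (pr o z t) (pr o w t) | t in [set t | 0 <= t]].
Proof.
split; first by exists (exp_gp o (pr o z 0) (pr o w 0)), 0 => //=.
by exists 0 => _ [t _ <-]; exact: exp_gp_ge0.
Qed.

Lemma rb_le o z w t : 0 <= t -> rb o z w <= exp_gp o (pr o z t) (pr o w t).
Proof.
by move=> t0; apply: ge_inf; [exact: (rb_has_inf o z w).2 | exists t].
Qed.

Lemma rb_ge o z w m :
  (forall t, 0 <= t -> m <= exp_gp o (pr o z t) (pr o w t)) -> m <= rb o z w.
Proof.
move=> h; apply: lb_le_inf; first exact: (rb_has_inf o z w).1.
by move=> _ [t t0 <-]; exact: h.
Qed.

Lemma rb_approx o z w e : 0 < e -> exists2 T, 0 <= T &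
  forall t, T <= t -> exp_gp o (pr o z t) (pr o w t) < rb o z w + e.
Proof.
move=> e0; have [_ [T T0 <-] hT] := inf_adherent e0 (rb_has_inf o z w).
by exists T => // t Tt; apply: le_lt_trans hT; exact: exp_gp_pr_antitone.
Qed.

Lemma rb_ge0 o z w : 0 <= rb o z w.
Proof. by apply: rb_ge => t _; exact: exp_gp_ge0. Qed.

Lemma rb_le1 o z w : rb o z w <= 1.
Proof.
by apply: (le_trans (rb_le o z w (lexx 0))); rewrite -expR0 ler_expR oppr_le0 gromov_product_ge0.
Qed.

Lemma rb_sym o z w : rb o z w = rb o w z.
Proof.
by rewrite /rb; congr inf; apply: eq_imagel => t _; rewrite exp_gp_sym.
Qed.

Lemma rb_triangle o z w u : rb o z u <= rb o z w + rb o w u.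
Proof.
apply/ler_addgt0Pr => e e0; have e2 : 0 < e / 2 by exact: divr_gt0.
have [T T0 hT] := rb_approx o z w e2; have [T' T'0 hT'] := rb_approx o w u e2.
pose t := Num.max T T'.
have := hT t; rewrite le_max lexx => /(_ isT).
have := hT' t; rewrite le_max lexx orbT => /(_ isT) h' h.
have t0 : 0 <= t by rewrite le_max T0.
apply: (le_trans (rb_le o z u t0)).
by have := exp_gp_triangle o (pr o z t) (pr o w t) (pr o u t); lra.
Qed.

Lemma rb_inner o x y : rb o (Inner x) (Inner y) = exp_gp o x y.
Proof.
apply/le_anti/andP; split.
  pose t := Num.max (d o x) (d o y).
  have t0 : 0 <= t by rewrite le_max mdist_ge0.
  by apply: (le_trans (rb_le _ _ _ t0)); rewrite !pr_inner_far// le_max lexx ?orbT.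
apply: rb_ge => t t0; rewrite ler_expR lerN2.
exact: gromov_product_between (pr_innerP o x t0).2
  (pr_innerP o y t0).2.
Qed.

Lemma rb_inner_ge o x z : expR (- d o x) <= rb o (Inner x) z.
Proof.
apply: rb_ge => t t0; rewrite ler_expR lerN2.
apply: (le_trans (gromov_product_le _ _ _)); rewrite pr_reach//=.
by rewrite ge_min lexx orbT.
Qed.

Lemma rb_bdry_refl o xi : rb o (Bdry xi) (Bdry xi) = 0.
Proof.
apply/le_anti; rewrite rb_ge0 andbT; apply/ler_addgt0Pr => e e0; rewrite add0r.
have [T T0 /(_ T (lexx T))] := expR_le_eps 0 e0; rewrite sub0r => /ltW.
apply: le_trans; apply: (le_trans (rb_le _ _ _ T0)).
by rewrite ler_expR /gromov_product mdistxx pr_reach//= lerN2; lra.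
Qed.

(** The estimate [between_contract] passes to points at infinity. *)
Lemma rb_contract o z w t : 0 <= t -> reach o z t = t -> reach o w t = t ->
  d (pr o z t) (pr o w t) <= 2 * (expR t * rb o z w).
Proof.
move=> t0 zt wt; apply/ler_addgt0Pr => e e0.
have e' : 0 < e / (2 * expR t) by rewrite divr_gt0// mulr_gt0// expR_gt0.
have [T T0 hT] := rb_approx o z w e'.
pose u := Num.max t T; have tu : t <= u by rewrite le_max lexx.
have := hT u; rewrite le_max lexx orbT => /(_ isT) {}hT.
have := between_contract (pr_between o z t0 tu) (pr_between o w t0 tu).
rewrite !pr_reach// zt wt => /(_ erefl)/le_trans; apply.
have -> : e = 2 * (expR t * (e / (2 * expR t))).
  by field; rewrite gt_eqF// expR_gt0.
by rewrite -mulrDr -mulrDr ler_pM2l// ler_pM2l ?expR_gt0// ltW.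
Qed.

Lemma rb_eq0 o xi eta : rb o (Bdry xi) (Bdry eta) = 0 -> xi = eta.
Proof.
move=> e0; have [c [cxi c0 cE]] := ray_fromP o xi.
have [c' [c'eta c'0 c'E]] := ray_fromP o eta.
rewrite -cxi -c'eta; apply/ray_class_eq/asboolP; exists 0 => t t0.
have := @rb_contract o (Bdry xi) (Bdry eta) t t0 erefl erefl.
by rewrite e0 !mulr0 /pr cE c'E.
Qed.

(** The ray [c'] from [o] that is asymptotic to [c] stays at distance at most [K]
    from it, so that the Gromov product of [c t] with the far points of [c'] is at
    least [t - K]. *)
Lemma rb_ray_cvg o c e : 0 < e -> exists2 T, 0 <= T &
  forall t, T <= t -> rb o (Inner (c t)) (Bdry (ray_class c)) < e.
Proof.
move=> e0; have [c' [c'xi c'0 cE]] := ray_fromP o (ray_class c).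
have /ray_class_eq/asboolP[K cK] := c'xi.
have [T T0 hT] := expR_le_eps K e0; exists T => // t Tt.
apply: le_lt_trans (hT t Tt); have t0 := le_trans T0 Tt.
apply/ler_addgt0Pr => e' e'0.
pose s := Num.max t (d o (c t)).
have s0 : 0 <= s by rewrite le_max t0.
have ts : t <= s by rewrite le_max lexx.
apply: (le_trans (rb_le _ _ _ s0)).
rewrite pr_inner_far//; last by rewrite le_max lexx orbT.
have K0 := cK t t0.
apply: (@le_trans _ _ (expR (K - t))); last by rewrite lerDl ltW.
rewrite ler_expR /pr cE /gromov_product.
have := @ray_dist _ _ c' _ _ (lexx 0) s0; rewrite c'0 => ->.
have := metric_triangle o (c t) (c' t); have := @ray_dist _ _ c' _ _ (lexx 0) t0.
rewrite c'0 => ->; rewrite (metric_sym _ (c' t)) => tri.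
have := metric_triangle (c t) (c' t) (c' s); rewrite (ray_dist c' t0 ts).
rewrite (metric_sym _ (c' t)).
have : 0 <= K by exact: le_trans (mdist_ge0 _ _) K0.
by lra.
Qed.

End BoundaryRays.

(** * The cone topology *)

Lemma initial_cvg (S : choiceType) (T : topologicalType) (f : S -> T)
    (F : set_system S) (s : S) : Filter F ->
  F --> (s : initial_topology f) <-> f @ F --> f s.
Proof.
move=> FF; split => [Fs U Us|fF U [/= _ [[V oV <-] Vs VU]]].
  by apply: Fs; exact: initial_continuous.
by rewrite /nbhs /=; apply: filterS VU _; apply: fF; exact: open_nbhs_nbhs.
Qed.

Section VisualTopology.
Context {R : realType} {X : proper_CAT R}.
Local Notation d := (@mdist R X).
Implicit Types (o x y p q : X) (s t : R) (c : geo_ray X).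
Implicit Types (z w : bordification X) (xi eta : boundary X).

(** Convergence in the cone topology is convergence of the projections to all
    balls.  If the projection of [z] to the ball of radius [T] is within [1] of the
    ray to [xi], then the Gromov product of [z] and [xi] is at least [T - 1 / 2];
    conversely, [rb_contract] bounds the distance of the projections to a given
    ball by a multiple of [rb o z (Bdry xi)]. *)
Lemma visual_cvg o (F : set_system (bordification X)) xi : Filter F ->
  F --> (Bdry xi : visual o) <-> forall e, 0 < e -> F [set z | rb o z (Bdry xi) < e].
Proof.
move=> FF; transitivity (forall r : {nonneg R}, forall e, 0 < e ->
    F [set z | d (pr o z r%:num) (pr o (Bdry xi) r%:num) < e]).
  rewrite /visual initial_cvg; split => [/cvg_sup h r e e0|h].
    have /initial_cvg fF := h r.
    have : F [set z | ball (pr o (Bdry xi) r%:num) e (ball_proj o z r)].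
      exact: fF _ (nbhsx_ballx _ e e0).
    apply: filterS => z /=.
    by rewrite ballEmdist /= metric_sym !ball_projE.
  apply/cvg_sup => r.
  apply/(@initial_cvg _ X (fun f : {nonneg R} -> X => f r)) => U /nbhs_ballP[e e0 sub].
  suff : F [set z | U (ball_proj o z r)] by [].
  apply: filterS (h r e e0) => z /= hz; apply: sub.
  by rewrite ballEmdist /= metric_sym !ball_projE.
split=> h.
- move=> e e0.
  have [T T0 /(_ T (lexx T)) hT] := expR_le_eps 1 e0.
  have := h (NngNum T0) 1 ltr01; apply: filterS => z /=.
  set p := pr o z T => pT; apply: le_lt_trans hT.
  apply: (le_trans (rb_le _ _ _ T0)); rewrite ler_expR -/p.
  have := pr_reach o (Bdry xi) T0; rewrite /= => qT.
  rewrite /gromov_product qT; have := metric_triangle o p (pr o (Bdry xi) T).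
  by rewrite qT; lra.
- move=> r e e0; have : 0 <= r%:num by []; move: (r%:num) => {r} t t0.
  pose e' := Num.min (expR (- t)) (e / (2 * expR t)).
  have e'0 : 0 < e'.
    by rewrite lt_min expR_gt0 divr_gt0// mulr_gt0// expR_gt0.
  have := h _ e'0; apply: filterS => z /=; rewrite lt_min => /andP[h1 h2].
  have zt : reach o z t = t.
    case: z h1 {h2} => //= x h1; rewrite min_l//.
    have := le_lt_trans (rb_inner_ge o x (Bdry xi)) h1.
    by rewrite ltr_expR ltrN2 => /ltW.
  have := rb_contract t0 zt (erefl : reach o (Bdry xi) t = t).
  move/le_lt_trans; apply.
  by move: h2; rewrite ltr_pdivlMr ?mulr_gt0 ?expR_gt0// mulrC mulrA.
Qed.

Lemma boundary_cvg o (F : set_system (boundary X)) xi : Filter F ->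
  F --> (xi : boundary_at o) <->
  forall e, 0 < e -> F [set eta | rb o (Bdry eta) (Bdry xi) < e].
Proof.
move=> FF; rewrite /boundary_at initial_cvg.
exact: (visual_cvg o (F := (@Bdry R X) @ F)).
Qed.

Lemma bdry_closureP o xi (A : set (bordification X)) :
  closure (A : set (visual o)) (Bdry xi) <->
  forall e, 0 < e -> exists2 z, A z & rb o z (Bdry xi) < e.
Proof.
split => [cl e e0|h B Bxi].
  have : nbhs (Bdry xi : visual o) [set z | rb o z (Bdry xi) < e].
    by apply: (visual_cvg o xi _).1 e0 => //; exact: cvg_id.
  by move=> /cl[z [Az ze]]; exists z.
pose F := filter_from [set e : R | 0 < e] (fun e => [set z | rb o z (Bdry xi) < e]).
have FF : Filter F.
  apply: filter_from_filter; first by exists 1 => /=.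
  move=> e e' /= e0 e'0; exists (Num.min e e') => /=; first by rewrite lt_min e0.
  by move=> z /=; rewrite lt_min => /andP[].
have : F B.
  by apply: (visual_cvg o xi FF).2 => // e e0; exists e.
by move=> [e e0 eB]; have [z Az ze] := h e e0; exists z; split => //; exact: eB.
Qed.

(** The Gromov product increases along the two rays, so that its limit is a
    supremum; it is [+oo], and [bourdon] vanishes, exactly at equal points. *)
Lemma bourdonE o xi eta : bourdon o xi eta = rb o (Bdry xi) (Bdry eta).
Proof.
rewrite /bourdon /gromov_product_bdry.
set f := fun t => gromov_product o (ray_from o xi t) (ray_from o eta t).
rewrite -[lim _]/(lim ((f t)%:E @[t --> +oo])).
have fE t : expR (- f t) = exp_gp o (pr o (Bdry xi) t) (pr o (Bdry eta) t) by [].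
have [r0|r0] := eqVneq (rb o (Bdry xi) (Bdry eta)) 0.
  rewrite r0; have -> : lim ((f t)%:E @[t --> +oo]) = +oo%E; last by [].
  apply: cvg_lim => //; apply/cvgeyPge => A.
  have [T T0 hT] := rb_approx o (Bdry xi) (Bdry eta) (expR_gt0 (- A)).
  near=> t; have /hT : T <= t by near: t; apply: nbhs_pinfty_ge; rewrite num_real.
  by rewrite r0 add0r -fE ltr_expR ltrN2 lee_fin => /ltW.
set r := rb _ _ _ in r0 *.
have {}r0 : 0 < r by rewrite lt_neqAle eq_sym r0; exact: rb_ge0.
have -> : lim ((f t)%:E @[t --> +oo]) = (- ln r)%:E.
  apply: cvg_lim => //; apply: cvg_EFin; first by near=> t.
  rewrite /comp /=; have -> : (fun t => f t) = (fun t => - ln (expR (- f t))).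
    by apply/funext => t; rewrite expRK opprK.
  apply: cvgN.
  suff cvr : expR (- f t) @[t --> +oo] --> r.
    exact: (cvg_comp _ _ cvr (continuous_ln r0)).
  apply/cvgrPdist_le => e e0.
  have [T T0 hT] := rb_approx o (Bdry xi) (Bdry eta) e0.
  near=> t; have tT : T <= t by near: t; apply: nbhs_pinfty_ge; rewrite num_real.
  have := hT t tT; have := rb_le o (Bdry xi) (Bdry eta) (le_trans T0 tT).
  by rewrite -fE -/r ler_norml => *; apply/andP; split; lra.
by rewrite /= opprK lnK.
Unshelve. all: by end_near.
Qed.

End VisualTopology.

(** * Convergence to the boundary and the action on it *)

Section BoundaryLimits.
Context {R : realType} {X : proper_CAT R}.
Local Notation d := (@mdist R X).
Implicit Types (o x y p q : X) (s t : R) (c : geo_ray X).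
Implicit Types (z w : bordification X) (xi eta : boundary X).

(** By [visual_cvg] this is convergence to [xi] in the cone topology. *)
Definition tends o {I : Type} (U : set_system I) (z : I -> bordification X) xi :=
  forall e, 0 < e -> U [set i | rb o (z i) (Bdry xi) < e].

Section Filter.
Context {I : Type} (U : set_system I) {UU : Filter U}.

Lemma tends_near o (z w : I -> bordification X) xi :
  (forall e, 0 < e -> U [set i | rb o (w i) (z i) < e]) ->
  tends o U z xi -> tends o U w xi.
Proof.
move=> zw zxi e e0; have e2 : 0 < e / 2 by exact: divr_gt0.
apply: filterS (filterI (zw _ e2) (zxi _ e2)) => i /= [h1 h2].
by have := rb_triangle o (w i) (z i) (Bdry xi); lra.
Qed.

Lemma tends_inner_oo o (x : I -> X) xi : tends o U (fun i => Inner (x i)) xi ->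
  forall M, U [set i | M <= d o (x i)].
Proof.
move=> h M; apply: filterS (h _ (expR_gt0 (- M))) => i /=.
have := rb_inner_ge o (x i) (Bdry xi) => h1 /(le_lt_trans h1).
by rewrite ltr_expR ltrN2 => /ltW.
Qed.

End Filter.

Lemma tends_unique o (I : Type) (U : set_system I) {UU : ProperFilter U}
    (z : I -> bordification X) xi eta :
  tends o U z xi -> tends o U z eta -> xi = eta.
Proof.
move=> h h'; apply: (@rb_eq0 _ _ o); apply/le_anti; rewrite rb_ge0 andbT.
apply/ler_addgt0Pr => e e0; rewrite add0r.
have e2 : 0 < e / 2 by exact: divr_gt0.
have [i /= [h1 h2]] := filter_ex (filterI (h _ e2) (h' _ e2)).
have := rb_triangle o (Bdry xi) (z i) (Bdry eta).
by rewrite (rb_sym o (Bdry xi) (z i)); lra.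
Qed.

(** The limit is the class of the limit of the geodesics from [o]. *)
Lemma rb_ultralimit o (I : Type) (U : set_system I) (UU : UltraFilter U)
    (x : I -> X) :
  (forall M, U [set i | M <= d o (x i)]) ->
  exists xi, tends o U (fun i => Inner (x i)) xi.
Proof.
move=> x_oo; have [c [c0 hc]] := ray_ultralimit UU x_oo.
exists (ray_class c) => e e0.
have [T T0 /(_ T (lexx T)) hT] := expR_le_eps 1 e0.
apply: filterS (filterI (x_oo T) (hc T 1 T0 ltr01)) => i /= [Tx near].
apply: le_lt_trans hT; apply: (le_trans (rb_le _ _ _ T0)).
have cE : pr o (Bdry (ray_class c)) T = c T by exact: ray_fromE.
have cT : d o (c T) = T by rewrite -c0 ray_dist// subr0.
rewrite cE ler_expR /gromov_product cT.
by have := metric_triangle o (pr o (Inner (x i)) T) (c T); rewrite cT; lra.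
Qed.

(** Inequalities between the values of [rb] at two base points hold as soon as they
    hold for points of the space. *)
Lemma rb_inner_approx o o' z w e : 0 < e -> exists x y,
  [/\ `|rb o z w - exp_gp o x y| <= e & `|rb o' z w - exp_gp o' x y| <= e].
Proof.
have approx1 z' e' : 0 < e' -> exists x, forall u,
    `|rb o z' u - rb o (Inner x) u| <= e' /\
    `|rb o' z' u - rb o' (Inner x) u| <= e'.
  case: z' => [x|xi] e'0.
    by exists x => u; rewrite !subrr !normr0 ltW.
  have [T T0 hT] := rb_ray_cvg o (repr xi) e'0.
  have [T' T'0 hT'] := rb_ray_cvg o' (repr xi) e'0.
  pose t := Num.max T T'.
  have := hT t; rewrite le_max lexx => /(_ isT) {}hT.
  have := hT' t; rewrite le_max lexx orbT => /(_ isT) {}hT'.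
  have xiE : ray_class (repr xi) = xi by rewrite /ray_class reprK.
  exists (repr xi t) => u; rewrite xiE in hT hT'.
  have diff v z1 z2 : rb v z1 z2 < e' -> `|rb v z2 u - rb v z1 u| <= e'.
    have := rb_triangle v z1 z2 u; have := rb_triangle v z2 z1 u.
    by rewrite (rb_sym v z2 z1) ler_norml => *; apply/andP; split; lra.
  by split; exact: diff.
move=> e0; have e2 : 0 < e / 2 by exact: divr_gt0.
have [x hx] := approx1 z _ e2; have [y hy] := approx1 w _ e2.
exists x, y; have [h1 h1'] := hx w; have [h2 h2'] := hy (Inner x).
rewrite -!rb_inner; split.
  rewrite (splitr e) (le_trans _ (lerD h1 h2))//.
  rewrite (rb_sym o w) (rb_sym o (Inner y)); apply: le_trans (ler_normD _ _).
  by rewrite addrA subrK.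
rewrite (splitr e) (le_trans _ (lerD h1' h2'))//.
rewrite (rb_sym o' w) (rb_sym o' (Inner y)); apply: le_trans (ler_normD _ _).
by rewrite addrA subrK.
Qed.

Lemma rb_origin o o' z w : rb o z w <= expR (d o o') * rb o' z w.
Proof.
set K := expR _; have K0 : 0 < K by exact: expR_gt0.
apply/ler_addgt0Pr => e e0.
have e'0 : 0 < e / (1 + K) by rewrite divr_gt0// addr_gt0.
have [x [y []]] := rb_inner_approx o o' z w e'0.
rewrite !ler_norml => /andP[_ h1] /andP[h2 _].
have := exp_gp_origin o o' x y; rewrite -/K => h3.
have eE : e = e / (1 + K) + K * (e / (1 + K)).
  by field; rewrite gt_eqF// addr_gt0.
set e' := e / _ in e'0 h1 h2 eE; rewrite eE.
have : K * exp_gp o' x y <= K * (rb o' z w + e') by rewrite ler_pM2l//; lra.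
by rewrite mulrDr; lra.
Qed.

(** For points of the space this is [gromov_product_compl]: the two Gromov products
    add up to [d o o']. *)
Lemma rb_compl o o' z :
  rb o' z (Inner o) * rb o z (Inner o') = expR (- d o o').
Proof.
have approx e : 0 < e ->
    `|rb o' z (Inner o) * rb o z (Inner o') - expR (- d o o')| <= e.
  move=> e0; have e2 : 0 < e / 2 by exact: divr_gt0.
  have [x h] : exists x, `|rb o' z (Inner o) - exp_gp o' x o| <= e / 2 /\
                         `|rb o z (Inner o') - exp_gp o x o'| <= e / 2.
    case: z => [x|xi]; first by exists x; rewrite !rb_inner !subrr normr0 ltW.
    have [T T0 hT] := rb_ray_cvg o (repr xi) e2.
    have [T' T'0 hT'] := rb_ray_cvg o' (repr xi) e2.
    pose t := Num.max T T'.
    have := hT t; rewrite le_max lexx => /(_ isT) {}hT.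
    have := hT' t; rewrite le_max lexx orbT => /(_ isT) {}hT'.
    have xiE : ray_class (repr xi) = xi by rewrite /ray_class reprK.
    exists (repr xi t); rewrite xiE in hT hT'; rewrite -!rb_inner.
    set x := Inner _ in hT hT' *.
    have diff v u z1 z2 : rb v z1 z2 < e / 2 -> `|rb v z2 u - rb v z1 u| <= e / 2.
      have := rb_triangle v z1 z2 u; have := rb_triangle v z2 z1 u.
      by rewrite (rb_sym v z2 z1) ler_norml => *; apply/andP; split; lra.
    by split; exact: diff.
  have <- : exp_gp o' x o * exp_gp o x o' = expR (- d o o').
    rewrite -expRD (gromov_product_sym o' x) (gromov_product_sym o x).
    by rewrite -(gromov_product_compl o o' x); congr expR; ring.
  case: h => hA hB; have B1 := rb_le1 o z (Inner o').
  have A1 : exp_gp o' x o <= 1.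
    by rewrite -expR0 ler_expR oppr_le0 gromov_product_ge0.
  rewrite -[X in `|X|](_ : (rb o' z (Inner o) - exp_gp o' x o) * rb o z (Inner o')
    + exp_gp o' x o * (rb o z (Inner o') - exp_gp o x o') = _); last by ring.
  apply: (le_trans (ler_normD _ _)); rewrite !normrM (splitr e) lerD//.
    by rewrite -[leRHS]mulr1 ler_pM// ger0_norm// rb_ge0.
  by rewrite -[leRHS]mul1r ler_pM// ger0_norm// exp_gp_ge0.
apply/le_anti/andP; split; apply/ler_addgt0Pr => e /approx;
  by rewrite ler_norml => /andP[]; lra.
Qed.

(** The point [x] is its own projection to the ball of radius [d o x], and
    [rb_contract] compares it with the projection of [xi]. *)
Lemma rb_near_ray o x xi c C : ray_class c = xi -> c 0 = o ->
  rb o (Inner x) (Bdry xi) <= C * expR (- d o x) -> d x (c (d o x)) <= 2 * C.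
Proof.
move=> cxi c0 h; have x0 := mdist_ge0 o x.
have := @rb_contract _ _ o (Inner x) (Bdry xi) _ x0.
rewrite /= minxx => /(_ erefl erefl).
rewrite pr_inner_far// /pr (ray_fromE cxi c0)// => /le_trans; apply.
rewrite ler_pM2l//; have := ler_wpM2l (expR_ge0 (d o x)) h.
by rewrite mulrCA expRxMexpNx_1 mulr1.
Qed.

End BoundaryLimits.

Section Action.
Context {R : realType} {X : proper_CAT R} {G : groupType} (a : isom_group G X).
Local Notation d := (@mdist R X).
Local Notation "g ** z" := (act_bordification a g z) (at level 40).
Implicit Types (o x y p q : X) (s t : R) (c : geo_ray X) (g h : G).
Implicit Types (z w : bordification X) (xi eta : boundary X).

Lemma act_ray_class g c : act_boundary a g (ray_class c) = ray_class (act_ray a g c).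
Proof.
apply/ray_class_eq; have /ray_class_eq/asboolP[K hK] :
    ray_class (repr (ray_class c)) = ray_class c by rewrite {1}/ray_class reprK.
by apply/asboolP; exists K => t t0 /=; rewrite isom_act_dist; exact: hK.
Qed.

Lemma boundary_ray xi : exists c, ray_class c = xi.
Proof. by exists (repr xi); rewrite /ray_class reprK. Qed.

Lemma act_boundary1 xi : act_boundary a 1%g xi = xi.
Proof.
have [c <-] := boundary_ray xi; rewrite act_ray_class; apply/ray_class_eq/asboolP.
by exists 0 => t t0 /=; rewrite isom_act1 mdistxx.
Qed.

Lemma act_boundaryM g h xi :
  act_boundary a (g * h)%g xi = act_boundary a g (act_boundary a h xi).
Proof.
have [c <-] := boundary_ray xi; rewrite !act_ray_class.
by apply/ray_class_eq/asboolP; exists 0 => t t0 /=; rewrite isom_actM mdistxx.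
Qed.

Lemma act_boundaryK g : cancel (act_boundary a g) (act_boundary a g^-1%g).
Proof. by move=> xi; rewrite -act_boundaryM mulVg act_boundary1. Qed.

Lemma act_boundary_inj g : injective (act_boundary a g).
Proof. exact: can_inj (act_boundaryK g). Qed.

Lemma isom_dist1 o g : d o (a g^-1%g o) = d o (a g o).
Proof. by rewrite -(isom_act_dist a g) -isom_actM mulgV isom_act1 metric_sym. Qed.

Lemma isom_distV o g h : d (a g o) (a h o) = d o (a (g^-1 * h)%g o).
Proof. by rewrite -(isom_act_dist a g^-1%g) -!isom_actM mulVg isom_act1. Qed.

Lemma isom_distM o g h : d o (a (g * h)%g o) <= d o (a g o) + d o (a h o).
Proof.
apply: (le_trans (metric_triangle _ (a g o) _)).
by rewrite isom_actM isom_act_dist.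
Qed.

Lemma pr_act o g z t : 0 <= t -> pr (a g o) (g ** z) t = a g (pr o z t).
Proof.
case: z => [x|xi] t0 /=.
  have [ox oxx] := pr_innerP o x t0.
  by apply: pr_innerE; rewrite /between ?isom_act_dist.
have [c [cxi c0 cE]] := ray_fromP o xi.
rewrite /pr cE (@ray_fromE _ _ _ _ (act_ray a g c))//= ?c0//.
by rewrite -act_ray_class cxi.
Qed.

Lemma rb_act_origin o g z w : rb (a g o) (g ** z) (g ** w) = rb o z w.
Proof.
rewrite /rb; congr inf; apply: eq_imagel => t /= t0; rewrite !pr_act//.
by rewrite /exp_gp /gromov_product !isom_act_dist.
Qed.

Lemma rb_act o g z w : rb o (g ** z) (g ** w) <= expR (d o (a g o)) * rb o z w.
Proof. by rewrite -(rb_act_origin o g z w); exact: rb_origin. Qed.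

Lemma tends_act o g (I : Type) (U : set_system I) {UU : Filter U}
    (z : I -> bordification X) xi :
  tends o U z xi -> tends o U (fun i => g ** z i) (act_boundary a g xi).
Proof.
move=> h e e0; set K := expR (d o (a g o)).
have e'0 : 0 < e / K by rewrite divr_gt0// expR_gt0.
apply: filterS (h _ e'0) => i /=; rewrite ltr_pdivlMr ?expR_gt0// mulrC => hi.
exact: le_lt_trans (rb_act o g (z i) (Bdry xi)) hi.
Qed.

Lemma tends_act_mulr o (U : set_system G) {UU : Filter U} xi k :
  tends o U (fun g => Inner (a g o)) xi ->
  tends o U (fun g => Inner (a (g * k)%g o)) xi.
Proof.
move=> Uxi; apply: tends_near (Uxi) => e e0.
have [T _ hT] := expR_le_eps (d o (a k o)) e0.
apply: filterS (tends_inner_oo Uxi T) => g /= /hT; apply: le_lt_trans.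
rewrite rb_inner ler_expR /gromov_product isom_actM isom_act_dist.
have := metric_triangle o (a g (a k o)) (a g o); rewrite isom_act_dist.
by rewrite (metric_sym (a k o) o); lra.
Qed.

(** The source of all the dynamics: [act_boundary a g] can leave [xi] far from
    [a g o] only if [xi] is close to [a g^-1 o]. *)
Lemma rb_act_compl o g xi :
  rb o (Bdry (act_boundary a g xi)) (Inner (a g o)) *
  rb o (Bdry xi) (Inner (a g^-1%g o)) = expR (- d o (a g o)).
Proof.
rewrite -(isom_dist1 o g) -(rb_compl _ _ (Bdry xi)); congr (_ * _).
by rewrite -[RHS](rb_act_origin _ g) -isom_actM mulgV isom_act1.
Qed.

End Action.

(** * Geodesic rays and ends of the Cayley graph *)

Lemma ultra_finite (I : Type) (T : choiceType) (U : set_system I)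
    (f : I -> T) (A : set T) : UltraFilter U -> finite_set A ->
  U [set i | A (f i)] -> exists2 t, A t & U [set i | f i = t].
Proof.
move=> UU /finite_seqP[s ->]; elim: s => [|t s IH] Us.
  by have [] := filter_ex Us.
have [|h] := in_ultra_setVsetC [set i | f i = t] UU.
  by exists t => //=; rewrite inE eqxx.
have [|u us Uu] := IH.
  apply: filterS (filterI h Us) => i /= [hi].
  by rewrite inE => /orP[/eqP|].
by exists u => //=; rewrite inE (us : u \in s) orbT.
Qed.

(** It suffices to test the subbasic neighbourhoods of a point; the hypothesis on
    [B] is the form in which the topology generated by [D] presents its open
    sets. *)
Lemma subbase_nbhs (T : choiceType) (D : set (set T))
    (F : set_system T) (B : set T) x : Filter F ->
  (forall O, D O -> O x -> F O) ->
  (exists2 D', D' `<=` finI_from D id & \bigcup_(O in D') O = B) -> B x -> F B.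
Proof.
move=> FF h [D' D'sub <-] [C D'C Cx]; have [E ED CE] := D'sub C D'C.
apply: (@filterS _ _ _ C); first by move=> y Cy; exists C.
rewrite -CE; apply: filter_bigI => O OE; apply: h; first by apply/set_mem/ED.
by move: Cx; rewrite -CE; apply.
Qed.

Section WordLength.
Context {G : groupType} (S : set G) (S_gen : symmetric_generating_set S).
Implicit Types (g h s : G) (n m k : nat).
Local Notation wl := (word_length S).
Local Notation ball n := (word_ball S (Posz n)).

Let S_fin : finite_set S.
Proof. by case: S_gen. Qed.

Lemma is_wordM n m g h : is_word S n g -> is_word S m h -> is_word S (n + m) (g * h)%g.
Proof.
move=> [l [<- lS ->]] [l' [<- l'S ->]]; exists (l ++ l').
split; rewrite ?size_cat ?big_cat// => s; rewrite mem_cat => /orP[/lS|/l'S]//.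
Qed.

Lemma word_lengthP g : is_word S (wl g) g /\ forall k, is_word S k g -> (wl g <= k)%N.
Proof.
rewrite /word_length; apply: (@getPex _ [set n | is_word S n g /\ _]).
have [_ _ /(_ g)[n gn]] := S_gen.
have ex : exists n, `[< is_word S n g >] by exists n; apply/asboolP.
exists (ex_minn ex); case: ex_minnP => m /asboolP gm hm; split => // k gk.
by apply: hm; apply/asboolP.
Qed.

Lemma word_length_is_word g : is_word S (wl g) g.
Proof. exact: (word_lengthP g).1. Qed.

Lemma word_length_le k g : is_word S k g -> (wl g <= k)%N.
Proof. exact: (word_lengthP g).2. Qed.

Lemma ballP n g : ball n g <-> (wl g <= n)%N.
Proof. by rewrite /word_ball /= lez_nat. Qed.

Lemma ball_finite n : finite_set (ball n).
Proof.
have words k : finite_set [set g | is_word S k g].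
  elim: k => [|k IH].
    apply: (sub_finite_set _ (finite_set1 1%g)) => g [l [/size0nil -> _ ->]].
    by rewrite big_nil.
  apply: (sub_finite_set _ (finite_image2 (fun s g => (s * g)%g) S_fin IH)).
  move=> g [[|s l] [//= [lk] lS gE]].
  exists s; first by apply: lS; rewrite inE eqxx.
  exists (\prod_(j <- l) j)%g; last by rewrite gE big_cons.
  by exists l; split => // t tl; apply: lS; rewrite inE tl orbT.
apply: (sub_finite_set _ (bigcup_finite (finite_II n.+1) (fun k _ => words k))).
by move=> g /ballP gn; exists (wl g) => //; exact: word_length_is_word.
Qed.

Lemma finite_sub_ball (Q : set G) : finite_set Q -> exists n, Q `<=` ball n.
Proof.
move=> /finite_seqP[l ->]; exists (\max_(g <- l) wl g)%N => g /= gl.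
by apply/ballP; rewrite (leq_bigmax_seq g).
Qed.

(** A geodesic word for every group element, and the vertex that the geodesic
    from [1] to [g] so obtained visits at time [k]. *)
Definition geo_word g : seq G :=
  xget [::] [set l | [/\ size l = wl g, (forall s, s \in l -> S s)
                 & g = (\prod_(s <- l) s)%g]].

Lemma geo_wordP g : [/\ size (geo_word g) = wl g,
  (forall s, s \in geo_word g -> S s) & g = (\prod_(s <- geo_word g) s)%g].
Proof.
rewrite /geo_word; case: xgetP => [l -> //|none].
by have [l hl] := word_length_is_word g; case: (none l).
Qed.

Definition prefix_at k g : G := (\prod_(s <- take k (geo_word g)) s)%g.

Lemma prefix_at_full g : prefix_at (wl g) g = g.
Proof. by have [gs _ gE] := geo_wordP g; rewrite /prefix_at -gs take_size. Qed.

Lemma prefix_at_length k g : (k <= wl g)%N -> wl (prefix_at k g) = k.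
Proof.
move=> kg; have [gs gS gE] := geo_wordP g; apply/eqP; rewrite eqn_leq.
have w1 : is_word S k (prefix_at k g).
  exists (take k (geo_word g)); split=> [|s /mem_take /gS//|//].
  by rewrite size_takel// gs.
rewrite word_length_le//=.
have w2 : is_word S (wl g - k) (\prod_(s <- drop k (geo_word g)) s)%g.
  exists (drop k (geo_word g)); split=> [|s /mem_drop /gS//|//].
  by rewrite size_drop gs.
have := word_length_le (is_wordM (word_length_is_word (prefix_at k g)) w2).
rewrite /prefix_at -big_cat cat_take_drop -gE.
by lia.
Qed.

Lemma prefix_at_step k g : (k < wl g)%N ->
  exists2 s, S s & prefix_at k.+1 g = (prefix_at k g * s)%g.
Proof.
move=> kg; have [gs gS gE] := geo_wordP g.
exists (nth 1%g (geo_word g) k); first by apply/gS/mem_nth; rewrite gs.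
by rewrite /prefix_at (take_nth 1%g) ?gs// -cats1 big_cat big_seq1.
Qed.

Lemma component_prefix n g : (n < wl g)%N ->
  component_of S (ball n) (prefix_at n.+1 g) g.
Proof.
move=> ng; suff H k : (n < k)%N -> (k <= wl g)%N ->
    component_of S (ball n) (prefix_at n.+1 g) (prefix_at k g).
  by rewrite -[X in component_of _ _ _ X]prefix_at_full; exact: H.
elim: k => // k IH; rewrite ltnS leq_eqVlt => /orP[/eqP <- _|nk kg].
  exact: component_of_refl.
apply: (component_of_trans (IH nk (ltnW kg))); apply: component_of_step.
have [s Ss sE] := prefix_at_step kg; apply/asboolP; split.
- by move=> /ballP; rewrite prefix_at_length ?(ltnW kg)//; lia.
- by move=> /ballP; rewrite prefix_at_length//; lia.
- by exists s => //; left.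
Qed.

Lemma tail_in_infinite (r : cay_ray S) (U : set G) : tail_in r U -> infinite_set U.
Proof.
case: r => r [r_inj radj] [N hN] /= Ufin.
have : finite_set (r @^-1` U).
  by apply: finite_preimage => // m n _ _; exact: r_inj.
move=> /finite_seqP[l lE]; pose n := maxn N (\max_(i <- l) i).+1.
have : (r @^-1` U) n by apply: hN; exact: leq_maxl.
rewrite lE /= => nl; have := leq_maxr N (\max_(i <- l) i).+1.
by rewrite -/n ltnNge (leq_bigmax_seq n).
Qed.

Lemma component_not_in (Q : set G) g h :
  ~ Q g -> component_of S Q g h -> ~ Q h.
Proof.
move=> Qg [p gp ->]; elim: p g Qg gp => [|k p IH] g Qg //= /andP[/asboolP[_ Qk _] kp].
exact: IH.
Qed.

Lemma component_mono (Q Q' : set G) g h : Q' `<=` Q ->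
  component_of S Q g h -> component_of S Q' g h.
Proof.
move=> Q'Q [p gp ->]; exists p => //; apply: sub_path gp => x y /asboolP[Qx Qy xy].
by apply/asboolP; split => // [/Q'Q|/Q'Q].
Qed.

(** Rays that meet each sphere about [1] once represent every end and have a
    prescribed position relative to the balls. *)
Definition geodesic_cay_ray (r : nat -> G) : Prop :=
  (forall k, wl (r k) = k) /\ forall k, exists2 s, S s & r k.+1 = (r k * s)%g.

Lemma geodesic_cay_rayP (r : nat -> G) : geodesic_cay_ray r -> is_cay_ray S r.
Proof.
move=> [rl rs]; split=> [m n mn|n]; first by rewrite -(rl m) -(rl n) mn.
by apply/asboolP; split => //; have [s Ss ->] := rs n; exists s => //; left.
Qed.

Lemma geodesic_cay_ray_component (r : nat -> G) n k : geodesic_cay_ray r ->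
  (n < k)%N -> component_of S (ball n) (r n.+1) (r k).
Proof.
move=> [rl rs]; elim: k => // k IH; rewrite ltnS leq_eqVlt => /orP[/eqP <-|nk].
  exact: component_of_refl.
apply: (component_of_trans (IH nk)); apply: component_of_step; apply/asboolP.
split; last by have [s Ss ->] := rs k; exists s => //; left.
  by move=> /ballP; rewrite rl; lia.
by move=> /ballP; rewrite rl; lia.
Qed.

Lemma ball_off (r : nat -> G) n : geodesic_cay_ray r -> ~ ball n (r n.+1).
Proof. by move=> [rl _] /ballP; rewrite rl; lia. Qed.

Lemma geodesic_tail (r : nat -> G) n : geodesic_cay_ray r ->
  tail_in r (component_of S (ball n) (r n.+1)).
Proof. by move=> rg; exists n.+1 => k; exact: geodesic_cay_ray_component. Qed.

(** Koenig's lemma: the vertices at which the geodesics from [1] to [g] meet the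
    spheres stabilize along the ultrafilter. *)
Lemma konig (U : set_system G) : UltraFilter U ->
  (forall n, U (~` ball n)) ->
  exists r, geodesic_cay_ray r /\ forall n, U (component_of S (ball n) (r n.+1)).
Proof.
move=> UU Uoo.
have Uwl k : U [set g | (k < wl g)%N].
  by apply: filterS (Uoo k) => g; rewrite /= ballP => /negP; rewrite -ltnNge.
have : forall k, exists h, wl h = k /\ U [set g | prefix_at k g = h].
  move=> k; have [|h hk Uh] := ultra_finite (f := prefix_at k) UU (ball_finite k).
    apply: filterS (Uwl k) => g /= kg; apply/ballP.
    by rewrite prefix_at_length// ltnW.
  exists h; split => //; have [g /= [kg <-]] := filter_ex (filterI (Uwl k) Uh).
  by rewrite prefix_at_length// ltnW.
move=> /choice[r hr]; exists r; split; last first.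
  move=> n; apply: filterS (filterI (Uwl n) (hr n.+1).2) => g /= [ng <-].
  exact: component_prefix.
split=> k; first by case: (hr k).
have [g /= [kg [h1 h2]]] :=
  filter_ex (filterI (Uwl k) (filterI (hr k).2 (hr k.+1).2)).
by have := prefix_at_step kg; rewrite h1 h2.
Qed.

Lemma end_class_eq (r r' : cay_ray S) : end_class r = end_class r' <-> same_end r r'.
Proof. by split => [/eqmodP|h]//; apply/eqmodP. Qed.

Lemma end_classE (e : end_space S) : exists r, end_class r = e.
Proof. by exists (repr e); rewrite /end_class reprK. Qed.

Lemma same_end_tail (Q : set G) g (r r' : cay_ray S) : finite_set Q ->
  same_end r r' -> tail_in r (component_of S Q g) -> tail_in r' (component_of S Q g).
Proof.
move=> Qfin /asboolP/(_ Q Qfin)[h Qh [[N hN] [N' hN']]] [M hM].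
exists N' => n /hN'; have := hM (maxn M N) (leq_maxl _ _).
by move=> /component_of_eq/(_ (hN (maxn M N) (leq_maxr _ _))) ->.
Qed.

Lemma ends_inP (Q : set G) g (r : cay_ray S) : finite_set Q ->
  ends_in S (component_of S Q g) (end_class r) <-> tail_in r (component_of S Q g).
Proof.
move=> Qfin; split=> [[r' /end_class_eq r'r]|]; last by exists r.
exact: same_end_tail.
Qed.

(** Balls are cofinal among the finite sets, and a single late vertex of [r] in the
    component of [r'] decides in which component [r] ends. *)
Lemma geodesic_same_end (r r' : cay_ray S) : geodesic_cay_ray r' ->
  (forall n, exists2 k, (n <= k)%N & component_of S (ball n) (r' n.+1) (r k)) ->
  same_end r r'.
Proof.
move=> r'g h; apply/asboolP => Q Qfin; have [n Qn] := finite_sub_ball Qfin.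
have [g Qg [N rg]] := cay_ray_tail r Qfin.
exists g => //; split; first by exists N.
have [k nk rk] := h (maxn n N).
have Nk : (N <= k)%N by exact: leq_trans (leq_maxr _ _) nk.
have sub m : (n <= m)%N -> Q `<=` ball m.
  by move=> nm x /Qn /ballP xn; apply/ballP; exact: leq_trans nm.
exists (maxn n N).+1 => m hm; apply: (component_of_trans (rg k Nk)).
apply: (@component_mono (ball (maxn n N))); first exact: sub (leq_maxl _ _).
exact: component_of_trans (component_of_sym rk) (geodesic_cay_ray_component r'g hm).
Qed.

(** Applied to the vertices of any ray of the end, [konig] gives a geodesic ray
    that lies in the same components. *)
Lemma end_geodesic (e : end_space S) :
  exists r : cay_ray S, geodesic_cay_ray r /\ end_class r = e.
Proof.
have [r <-] := end_classE e; have [V [VU Voo]] := nat_ultrafilter.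
have Vge k : V [set n | (k <= n)%N] by apply: Voo; exists k.
have r_inj : injective r by case: r => r [].
have UU : UltraFilter ((r : nat -> G) @ V).
  split; first exact: fmap_proper_filter.
  move=> F FF sub; apply/seteqP; split => // A FA.
  have [//|VA] := in_ultra_setVsetC (r @^-1` A) VU.
  have : F (~` A) by exact: sub.
  by move=> /(filterI FA); rewrite setICr => /filter_ex[].
have [|h [hg hU]] := konig UU.
  move=> n; have [g gn [N hN]] := cay_ray_tail r (ball_finite n).
  change (V [set k | ~ ball n (r k)]); apply: filterS (Vge N) => k /= /hN.
  exact: component_not_in.
exists (CayRay (geodesic_cay_rayP hg)); split => //; apply/end_class_eq.
rewrite same_end_sym; apply: geodesic_same_end => // n.
have : V [set k | component_of S (ball n) (h n.+1) (r k)] := hU n.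
by move=> /(filterI (Vge n))/filter_ex[k [nk hk]]; exists k.
Qed.

Lemma end_in_component (Q : set G) (e : end_space S) : finite_set Q ->
  exists2 U, infinite_components S Q U & ends_in S U e.
Proof.
move=> Qfin; have [r <-] := end_classE e; have [g Qg rg] := cay_ray_tail r Qfin.
exists (component_of S Q g); last by exists r.
by split; [exact: tail_in_infinite rg | exists g].
Qed.

Lemma end_cvg (F : set_system (end_space S)) (e : end_space S) : Filter F ->
  (forall Q U, finite_set Q -> infinite_components S Q U -> ends_in S U e ->
     F (ends_in S U)) -> F --> e.
Proof.
move=> FF h B; rewrite nbhsE => -[C [oC Ce] CB]; apply: filterS CB _.
by apply: (subbase_nbhs FF _ oC Ce) => O [Q [U [Qfin QU ->]]]; exact: h QU.
Qed.

Lemma geodesic_end_cvg (F : set_system (end_space S)) (r : cay_ray S) : Filter F ->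
  geodesic_cay_ray r ->
  (forall n, F (ends_in S (component_of S (ball n) (r n.+1)))) ->
  F --> end_class r.
Proof.
move=> FF rg h; apply: end_cvg => Q _ Qfin [_ [g Qg ->]] /(ends_inP _ _ Qfin)[N rN].
have [n Qn] := finite_sub_ball Qfin.
apply: filterS (h n) => e [r' <- [M hM]]; exists r' => //; exists M => m /hM rm.
apply: (component_of_trans (rN (maxn n.+1 N) (leq_maxr _ _))).
apply: (component_mono Qn); apply: component_of_trans rm; apply: component_of_sym.
by apply: geodesic_cay_ray_component => //; exact: leq_maxl.
Qed.

(** Along an ultrafilter of ends, the vertices that the geodesic representatives
    visit at a given time take a single value; these values form a geodesic ray,
    whose end is the limit. *)
Lemma end_space_compact : compact [set: end_space S].
Proof.
rewrite compact_ultra => V VU _.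
have /choice[geo hgeo] := end_geodesic.
have : forall k, exists h, wl h = k /\ V [set e | geo e k = h].
  move=> k; have [|h hk Vh] :=
      ultra_finite (f := fun e => geo e k : G) VU (ball_finite k).
    by apply: filterE => e /=; apply/ballP; rewrite (hgeo e).1.1.
  by exists h; split => //; have [e /= <-] := filter_ex Vh; rewrite (hgeo e).1.1.
move=> /choice[r hr].
have rg : geodesic_cay_ray r.
  split=> k; first by case: (hr k).
  have [e /= [h1 h2]] := filter_ex (filterI (hr k).2 (hr k.+1).2).
  by have := (hgeo e).1.2 k; rewrite h1 h2.
exists (end_class (CayRay (geodesic_cay_rayP rg))); split => //=.
apply: geodesic_end_cvg => // n; apply: filterS (hr n.+1).2 => e /= <-.
rewrite -[X in ends_in _ _ X](hgeo e).2; exists (geo e) => //.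
exact: geodesic_tail (hgeo e).1.
Qed.

Lemma end_compactification_nbhs (O : set (end_compactification S)) z :
  end_compactification_subbase O -> O z -> nbhs z O.
Proof.
move=> hO Oz; rewrite nbhsE; exists O => //; split => //.
exists [set O]; last by rewrite bigcup_set1.
by move=> _ ->; exact: (@finI_from1 _ _ _ id).
Qed.

Lemma end_nbhs (U : set G) Q (e : end_space S) : finite_set Q ->
  infinite_components S Q U -> ends_in S U e -> nbhs e (ends_in S U).
Proof.
move=> Qfin QU Ue; rewrite nbhsE; exists (ends_in S U) => //; split => //.
exists [set ends_in S U]; last by rewrite bigcup_set1.
by move=> _ ->; apply: (@finI_from1 _ _ _ id); exists Q, U.
Qed.

Lemma component_simple_path (Q : set G) g u v : ~ Q g ->
  component_of S Q g u -> component_of S Q g v ->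
  exists p, [/\ path (cay_adj S Q) u p, last u p = v, uniq (u :: p)
              & {subset u :: p <= component_of S Q g}].
Proof.
move=> Qg gu gv.
have [p up ->] : component_of S Q u v by exact: component_of_trans (component_of_sym gu) gv.
case/shortenP: up => q uq q_uniq _; exists q; split => // x xq.
apply/mem_set; apply: (component_of_trans gu).
case/splitPl: xq uq => p1 p2 <-; rewrite cat_path => /andP[up1 _].
by exists p1.
Qed.

End WordLength.

(** * Orbital masses and the boundary map *)

Section PowerSums.
Context {R : realType}.
Implicit Types (x y q : R).

(** The proportions [x / (x + y)] and [y / (x + y)] increase when they are raised to
    a power [q <= 1], and they add up to [1]. *)
Lemma powR_subadd q x y : 0 < q <= 1 -> 0 <= x -> 0 <= y ->
  powR (x + y) q <= powR x q + powR y q.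
Proof.
move=> /andP[q0 q1] x0 y0; have [xy|xy] := leP (x + y) 0.
  have -> : x = 0 by lra.
  have -> : y = 0 by lra.
  by rewrite addr0 lerDl powR_ge0.
have s0 : x + y != 0 by rewrite gt_eqF.
have part z : 0 <= z -> z <= x + y ->
    powR (x + y) q * (z / (x + y)) <= powR z q.
  move=> z0 zxy; have zE : z = (x + y) * (z / (x + y)) by rewrite mulrC divfK.
  rewrite [X in _ <= powR X _]zE powRM ?(ltW xy) ?divr_ge0// ?(ltW xy)//.
  rewrite ler_wpM2l ?powR_ge0//; have [->|zn0] := eqVneq z 0.
    by rewrite mul0r powR_ge0.
  rewrite ger1_powR// divr_gt0//= ?lt_neqAle 1?eq_sym ?zn0//.
  by rewrite ler_pdivrMr// mul1r.
apply: (le_trans _ (lerD (part x x0 _) (part y y0 _))); rewrite ?lerDl ?lerDr//.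
by rewrite -mulrDr -mulrDl divff// mulr1.
Qed.

Lemma ler_powR_root q x m : 0 < q -> 0 <= x -> powR x q <= m ->
  x <= powR m q^-1.
Proof.
move=> q0 x0 xm; have m0 : 0 <= m by exact: le_trans (powR_ge0 _ _) xm.
have -> : x = powR (powR x q) q^-1 by rewrite -powRrM divff ?powRr1// gt_eqF.
by apply: ge0_ler_powR; rewrite ?nnegrE ?powR_ge0 ?invr_ge0 ?(ltW q0).
Qed.

Lemma ltr_powR_root q x e : 0 < q -> 0 <= x -> 0 < e -> x < powR e q ->
  powR x q^-1 < e.
Proof.
move=> q0 x0 e0 xe.
have -> : e = powR (powR e q) q^-1 by rewrite -powRrM divff ?powRr1 ?gt_eqF// ltW.
by apply: gt0_ltr_powR; rewrite ?nnegrE ?invr_gt0 ?powR_ge0.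
Qed.

Lemma powR_expR x q : powR (expR x) q = expR (q * x).
Proof. by rewrite /powR gt_eqF ?expR_gt0// expRK. Qed.

Lemma le_esum_sub (T : choiceType) (A B : set T) (f : T -> \bar R) : A `<=` B ->
  (\esum_(x in A) f x <= \esum_(x in B) f x)%E.
Proof.
move=> AB; apply: ge_ereal_sup => _ [F [Ffin FA] <-]; apply: esum_ge.
by exists F => //; split => //; exact: subset_trans AB.
Qed.

End PowerSums.

Section Mass.
Context {R : realType} {X : proper_CAT R} {G : groupType} (a : isom_group G X).
Context (o : X) (q : R).
Context (q_gt0 : 0 < q) (Pq : (poincare_series a o q < +oo)%E).
Local Notation d := (@mdist R X).
Implicit Types (g h : G) (A B U : set G).

Definition wt g : R := expR (- q * d o (a g o)).

Lemma wt_ge0 g : 0 <= wt g.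
Proof. exact: expR_ge0. Qed.

Definition mass A : R := fine (\esum_(g in A) (wt g)%:E).

Lemma mass_fin A : (\esum_(g in A) (wt g)%:E)%E = (mass A)%:E.
Proof.
rewrite /mass fineK// ge0_fin_numE; last by apply: esum_ge0 => g _; rewrite lee_fin wt_ge0.
by apply: le_lt_trans Pq; exact: le_esum_sub.
Qed.

Lemma mass_ge0 A : 0 <= mass A.
Proof. by apply/fine_ge0/esum_ge0 => g _; rewrite lee_fin wt_ge0. Qed.

Lemma mass_le A B : A `<=` B -> mass A <= mass B.
Proof. by move=> AB; rewrite -lee_fin -!mass_fin; exact: le_esum_sub. Qed.

Lemma mass_seq (l : seq G) A : uniq l -> [set` l] `<=` A ->
  \sum_(g <- l) wt g <= mass A.
Proof.
move=> lu lA; rewrite -lee_fin -mass_fin; apply: esum_ge.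
exists [set` l]; first by split => //; exact: finite_seq.
by rewrite -fsbig_seq// sumEFin.
Qed.

Lemma wt_mass g A : A g -> wt g <= mass A.
Proof.
move=> Ag; have := @mass_seq [:: g] A isT; rewrite big_seq1; apply.
by move=> h /=; rewrite inE => /eqP ->.
Qed.

Lemma mass_split A B : mass A = mass (A `&` B) + mass (A `&` ~` B).
Proof.
apply: EFin_inj; rewrite EFinD -!mass_fin; apply: esumID => g _.
by rewrite lee_fin wt_ge0.
Qed.

Lemma mass_cofinite e : 0 < e -> exists2 F, finite_set F & mass (~` F) < e.
Proof.
move=> e0; have : ((mass setT - e)%:E < \esum_(g in setT) (wt g)%:E)%E.
  by rewrite mass_fin lte_fin; lra.
rewrite /esum => /ereal_sup_gt[_ [F [Ffin _] <-]] hF; exists F => //.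
have : ((mass setT - e)%:E < (mass F)%:E)%E.
  apply: (lt_le_trans hF); rewrite -mass_fin; apply: esum_ge.
  by exists F => //; split.
by rewrite lte_fin (mass_split setT F) !setTI; lra.
Qed.

(** Each of these elements contributes at least [expR (- q * M)] to a convergent
    series. *)
Lemma orbit_finite M : finite_set [set g | d o (a g o) <= M].
Proof.
have wt_ge g : d o (a g o) <= M -> expR (- q * M) <= wt g.
  by move=> gM; rewrite ler_expR !mulNr lerN2 ler_pM2l.
have [F Ffin hF] := mass_cofinite (expR_gt0 (- q * M)).
apply: (sub_finite_set _ Ffin) => g /= gM; apply: contrapT => Fg.
by have := le_trans (wt_ge g gM) (wt_mass (Fg : (~` F) g)); lra.
Qed.

End Mass.

Section Paths.
Context {R : realType} {X : proper_CAT R} {G : groupType} (a : isom_group G X).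
Context (S : set G) (S_gen : symmetric_generating_set S).
Context (o : X) (q : R) (q01 : 0 < q <= 1).
Context (Pq : (poincare_series a o q < +oo)%E).
Local Notation d := (@mdist R X).
Local Notation L := (generator_displacement a S o).
Local Notation ball n := (word_ball S (Posz n)).
Local Notation wt := (wt a o q).
Local Notation mass := (mass a o q).
Implicit Types (g h u v : G) (Q U : set G) (phi : G -> bordification X).

Let q_gt0 : 0 < q.
Proof. by case/andP: q01. Qed.

Let S_fin : finite_set S.
Proof. by case: S_gen. Qed.

Lemma displacement_le s : S s -> d o (a s o) <= L.
Proof.
move=> Ss; apply: ub_le_sup; last by exists s.
have [l lE] : exists l : seq G, S = [set` l] by exact/finite_seqP.
exists (\sum_(s <- l) d o (a s o)) => _ [t + <-]; rewrite lE /= => tl.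
by rewrite (big_rem t)//= lerDl sumr_ge0// => *; exact: mdist_ge0.
Qed.

Lemma displacement_ge0 : 0 <= L.
Proof.
have [->|/set0P[s Ss]] := eqVneq S set0.
  by rewrite /generator_displacement image_set0 sup0.
exact: le_trans (mdist_ge0 _ _) (displacement_le Ss).
Qed.

Lemma adjacent_dist Q g h : cay_adj S Q g h -> d (a g o) (a h o) <= L.
Proof.
move=> /asboolP[_ _ [s Ss [->|->]]].
  by rewrite isom_actM isom_act_dist displacement_le.
by rewrite isom_actM metric_sym isom_act_dist displacement_le.
Qed.

Lemma adjacent_orbit Q g h : cay_adj S Q g h ->
  powR (rb o (Inner (a g o)) (Inner (a h o))) q <= expR (q * L) * wt g.
Proof.
move=> gh; rewrite rb_inner powR_expR /wt -expRD ler_expR mulNr -mulrN.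
rewrite -mulrDr ler_pM2l// /gromov_product.
have := adjacent_dist gh; have := metric_triangle o (a h o) (a g o).
by rewrite (metric_sym (a h o)); lra.
Qed.

(** As [q <= 1], the [q]-th power of [rb o] satisfies the triangle inequality
    too. *)
Lemma path_energy Q phi g p : path (cay_adj S Q) g p -> p != [::] ->
  powR (rb o (phi g) (phi (last g p))) q <=
  \sum_(uv <- zip (belast g p) p) powR (rb o (phi uv.1) (phi uv.2)) q.
Proof.
elim: p g => //= h p IH g /andP[gh hp] _; rewrite big_cons /=.
have [->|pN] := eqVneq p [::]; first by rewrite /= big_nil addr0.
apply: (le_trans _ (lerD (lexx _) (IH h hp pN))).
apply: (le_trans _ (powR_subadd q01 (rb_ge0 _ _ _) (rb_ge0 _ _ _))).
by rewrite ge0_ler_powR ?nnegrE ?addr_ge0 ?rb_ge0 ?(ltW q_gt0)// rb_triangle.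
Qed.

(** Each edge of a simple path is charged to its first vertex. *)
Lemma component_orbit_bound Q c g h : ~ Q c ->
  component_of S Q c g -> component_of S Q c h ->
  powR (rb o (Inner (a g o)) (Inner (a h o))) q <=
  expR (q * L) * mass (component_of S Q c).
Proof.
move=> Qc cg ch; have [p [gp <- gp_uniq sub]] := component_simple_path Qc cg ch.
have le_sum : forall p g, path (cay_adj S Q) g p ->
    powR (rb o (Inner (a g o)) (Inner (a (last g p) o))) q <=
    expR (q * L) * \sum_(x <- g :: p) wt x.
  move=> p'; elim: p' => [|k p' IH] k' /=.
    rewrite big_seq1 rb_inner powR_expR /wt -expRD ler_expR => _.
    rewrite /gromov_product mdistxx subr0 mulNr -mulrN -mulrDr ler_pM2l//.
    by have := displacement_ge0; lra.
  move=> /andP[kk kp]; rewrite big_cons mulrDr.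
  apply: (le_trans _ (lerD (adjacent_orbit kk) (IH k kp))).
  apply: (le_trans _ (powR_subadd q01 (rb_ge0 _ _ _) (rb_ge0 _ _ _))).
  by rewrite ge0_ler_powR ?nnegrE ?addr_ge0 ?rb_ge0 ?(ltW q_gt0)// rb_triangle.
apply: (le_trans (le_sum _ _ gp)); rewrite ler_pM2l ?expR_gt0//.
apply: mass_seq => // x /= xp; exact/set_mem/sub.
Qed.

(** A bound for the diameter of the orbit of a component [U], and hence for that of
    the set of limits of the ends of [U]. *)
Definition comp_diam U : R := powR (expR (q * L) * mass U) q^-1.

Lemma orbit_diam Q c g h : ~ Q c ->
  component_of S Q c g -> component_of S Q c h ->
  rb o (Inner (a g o)) (Inner (a h o)) <= comp_diam (component_of S Q c).
Proof.
move=> Qc cg ch; apply: ler_powR_root => //; first exact: rb_ge0.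
exact: component_orbit_bound.
Qed.

Lemma comp_diam_le U V : U `<=` V -> comp_diam U <= comp_diam V.
Proof.
move=> UV; rewrite ge0_ler_powR ?nnegrE ?mulr_ge0 ?expR_ge0 ?mass_ge0//.
  by rewrite invr_ge0 ltW.
by rewrite ler_pM2l ?expR_gt0// mass_le.
Qed.

Lemma mass_tail e : 0 < e -> exists n, mass (~` ball n) < e.
Proof.
move=> e0; have [F Ffin hF] := mass_cofinite Pq e0.
have [n Fn] := finite_sub_ball S Ffin; exists n.
by apply: le_lt_trans hF; apply: mass_le => //; exact: subsetC.
Qed.

Lemma comp_diam_tail e : 0 < e -> exists n, comp_diam (~` ball n) < e.
Proof.
move=> e0; pose e' := powR e q / expR (q * L).
have e'0 : 0 < e' by rewrite divr_gt0 ?powR_gt0 ?expR_gt0.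
have [n hn] := mass_tail e'0; exists n.
apply: ltr_powR_root; rewrite ?mulr_ge0 ?expR_ge0 ?mass_ge0//.
by rewrite mulrC -ltr_pdivlMr ?expR_gt0.
Qed.

Lemma component_sub_compl Q c : ~ Q c -> component_of S Q c `<=` ~` Q.
Proof. by move=> Qc x; exact: component_not_in. Qed.

Lemma cay_ray_oo (r : cay_ray S) M : \oo [set n | M <= d o (a (r n) o)].
Proof.
have [c Qc [N hN]] := cay_ray_tail r (orbit_finite q_gt0 Pq M).
by exists N => // n /= /hN /(component_not_in Qc) /= /negP; rewrite -ltNge => /ltW.
Qed.

(** The limit along an ultrafilter is a limit, because the tails of the ray lie in
    components whose orbits have small diameter. *)
Lemma ray_limit (r : cay_ray S) :
  exists xi, tends o \oo (fun n => Inner (a (r n) o)) xi.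
Proof.
have [V [VU Voo]] := nat_ultrafilter.
have [|xi hxi] := rb_ultralimit (o := o) VU (x := fun n => a (r n) o).
  by move=> M; apply: Voo; exact: cay_ray_oo.
exists xi => e e0; have e2 : 0 < e / 2 by exact: divr_gt0.
have [n hn] := comp_diam_tail e2.
have [c nc [N rc]] := cay_ray_tail r (ball_finite S_gen n).
exists N => // k /= Nk.
have Vge : V [set i | (N <= i)%N] by apply: Voo; exists N.
have [i /= [Ni hi]] := filter_ex (filterI Vge (hxi _ e2)).
apply: (le_lt_trans (rb_triangle _ _ (Inner (a (r i) o)) _)).
have := orbit_diam nc (rc k Nk) (rc i Ni).
have := comp_diam_le (component_sub_compl nc); lra.
Qed.

(** By [tends_unique] this determines the map, and all its properties follow from
    it. *)
Definition is_end_limit (Pi : end_space S -> boundary X) : Prop :=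
  forall r : cay_ray S,
    tends o \oo (fun n => Inner (a (r n) o)) (Pi (end_class r)).

Lemma end_limit_exists : exists Pi, is_end_limit Pi.
Proof.
have /choice[lim hlim] := ray_limit.
exists (fun e => lim (repr e)) => r e e0.
have /asboolP same : same_end (repr (end_class r)) r.
  by apply/end_class_eq; rewrite {1}/end_class reprK.
have e2 : 0 < e / 2 by exact: divr_gt0.
have [n hn] := comp_diam_tail e2.
have [c nc [[N rc] [M rc']]] := same _ (ball_finite S_gen n).
have [K _ hK] := hlim (repr (end_class r)) _ e2.
exists M => // k /= /rc' kc.
have := hK (maxn K N) (leq_maxl _ _); rewrite /= => h1.
apply: (le_lt_trans (rb_triangle _ _ (Inner (a (repr (end_class r) (maxn K N)) o)) _)).
have := orbit_diam nc kc (rc _ (leq_maxr K N)).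
have := comp_diam_le (component_sub_compl nc); lra.
Qed.

Section EndLimit.
Context (Pi : end_space S -> boundary X) (Pi_lim : is_end_limit Pi).

Lemma end_limit_orbit Q c g e : ~ Q c -> finite_set Q ->
  component_of S Q c g -> ends_in S (component_of S Q c) e ->
  rb o (Inner (a g o)) (Bdry (Pi e)) <= comp_diam (component_of S Q c).
Proof.
move=> Qc Qfin cg [r <- [N rN]]; apply/ler_addgt0Pr => e' e'0.
have [M _ hM] := Pi_lim r e'0.
apply: (le_trans (rb_triangle _ _ (Inner (a (r (maxn M N)) o)) _)).
have := hM (maxn M N) (leq_maxl _ _) => /= h1.
by have := orbit_diam Qc cg (rN _ (leq_maxr M N)); lra.
Qed.

Lemma end_limit_diam Q c e e' : ~ Q c -> finite_set Q ->
  ends_in S (component_of S Q c) e -> ends_in S (component_of S Q c) e' ->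
  rb o (Bdry (Pi e)) (Bdry (Pi e')) <= comp_diam (component_of S Q c).
Proof.
move=> Qc Qfin ce [r <- [N rN]]; apply/ler_addgt0Pr => e1 e10.
have [M _ hM] := Pi_lim r e10.
apply: (le_trans (rb_triangle _ _ (Inner (a (r (maxn M N)) o)) _)).
have := hM (maxn M N) (leq_maxl _ _) => /= h1.
have := end_limit_orbit Qc Qfin (rN _ (leq_maxr M N)) ce.
by rewrite (rb_sym o (Inner _)); lra.
Qed.

End EndLimit.

End Paths.

(** * The boundary map on the end compactification *)

Section LimitSet.
Context {R : realType} {X : proper_CAT R} {G : groupType} (a : isom_group G X).
Context (o : X).
Local Notation d := (@mdist R X).
Implicit Types (g h : G) (xi eta : boundary X).

Lemma limitP xi : limit_set a o xi <->
  forall e, 0 < e -> exists g, rb o (Inner (a g o)) (Bdry xi) < e.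
Proof.
rewrite /limit_set /= bdry_closureP; split => h e e0.
  by have [_ [g _ <-] ge] := h e e0; exists g.
by have [g ge] := h e e0; exists (Inner (a g o)) => //; exists g.
Qed.

Lemma tends_limit (I : Type) (F : set_system I) {FF : ProperFilter F} (g : I -> G) xi :
  tends o F (fun i => Inner (a (g i) o)) xi -> limit_set a o xi.
Proof.
by move=> h; apply/limitP => e e0; have [i /= hi] := filter_ex (h e e0); exists (g i).
Qed.

Lemma limit_ultrafilter xi : limit_set a o xi -> exists U : set_system G,
  UltraFilter U /\ tends o U (fun g => Inner (a g o)) xi.
Proof.
move=> /limitP h.
pose F := filter_from [set e : R | 0 < e]
  (fun e => [set g | rb o (Inner (a g o)) (Bdry xi) < e]).
have FF : ProperFilter F.
  apply: filter_from_proper; last by move=> e e0; have [g ge] := h e e0; exists g.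
  apply: filter_from_filter; first by exists 1 => /=.
  move=> e e' /= e0 e'0; exists (Num.min e e') => /=; first by rewrite lt_min e0.
  by move=> z /=; rewrite lt_min => /andP[].
have [U [UU FU]] := ultraFilterLemma FF.
by exists U; split => // e e0; apply: FU; exists e.
Qed.

Lemma limit_act g xi : limit_set a o xi -> limit_set a o (act_boundary a g xi).
Proof.
move=> /limitP h; apply/limitP => e e0.
have [|k hk] := h (e / expR (d o (a g o))); first by rewrite divr_gt0// expR_gt0.
exists (g * k)%g; rewrite isom_actM.
apply: (le_lt_trans (rb_act a o g (Inner (a k o)) (Bdry xi))).
by rewrite mulrC -ltr_pdivlMr ?expR_gt0.
Qed.

Lemma limit_set_cvg (F : set_system (limit_set a o)) (x : limit_set a o) : Filter F ->
  F --> x <->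
  forall e, 0 < e -> F [set y | rb o (Bdry (val y)) (Bdry (val x)) < e].
Proof.
move=> FF; rewrite (initial_cvg set_val).
exact: (boundary_cvg o (F := set_val @ F)).
Qed.

Lemma limit_set_nbhs (x : limit_set a o) e : 0 < e ->
  nbhs x [set y | rb o (Bdry (val y)) (Bdry (val x)) < e].
Proof. exact: (limit_set_cvg x (nbhs_filter x)).1 (fun A => id) e. Qed.

Lemma limit_set_hausdorff : hausdorff_space (limit_set a o).
Proof.
move=> x y xy; apply: val_inj; apply: (@rb_eq0 _ _ o).
apply/le_anti; rewrite rb_ge0 andbT; apply/ler_addgt0Pr => e e0; rewrite add0r.
have e2 : 0 < e / 2 by exact: divr_gt0.
have [z [/= zx zy]] := xy _ _ (limit_set_nbhs x e2) (limit_set_nbhs y e2).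
have := rb_triangle o (Bdry (val x)) (Bdry (val z)) (Bdry (val y)).
by rewrite (rb_sym o (Bdry (val x)) (Bdry (val z))); lra.
Qed.

End LimitSet.

Section BoundaryMap.
Context {R : realType} {X : proper_CAT R} {G : groupType} (a : isom_group G X).
Context (S : set G) (S_gen : symmetric_generating_set S).
Context (o : X) (q : R) (q01 : 0 < q <= 1).
Context (Pq : (poincare_series a o q < +oo)%E).
Local Notation d := (@mdist R X).
Local Notation L := (generator_displacement a S o).
Local Notation ball n := (word_ball S (Posz n)).
Local Notation wt := (wt a o q).
Local Notation mass := (mass a o q).
Local Notation comp_diam := (comp_diam a S o q).
Implicit Types (g h u v : G) (Q U : set G).

Let q_gt0 : 0 < q.
Proof. by case/andP: q01. Qed.

Context (Pi : end_space S -> boundary X) (Pi_lim : is_end_limit a o Pi).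

Lemma end_limit_mem e : limit_set a o (Pi e).
Proof.
have [r <-] := end_classE e.
exact: (@tends_limit _ _ _ _ _ _ \oo _ (fun n => r n)) (Pi_lim r).
Qed.

(** When the orbit tends to [xi] along an ultrafilter, [konig] singles out a geodesic
    ray; each component in which the ray ends belongs to the ultrafilter, and the
    orbits of these components are small. *)
Lemma end_limit_surj xi : limit_set a o xi -> exists e, Pi e = xi.
Proof.
move=> /limit_ultrafilter[U [UU Uxi]].
have Uoo n : U (~` ball n).
  have /finite_seqP[l lE] := ball_finite S_gen n.
  pose M := \sum_(g <- l) d o (a g o) + 1.
  apply: filterS (tends_inner_oo Uxi M) => g /= Mg; rewrite lE /= => gl.
  move: Mg; rewrite /M (big_rem g)//=.
  have : 0 <= \sum_(h <- rem g l) d o (a h o) by apply: sumr_ge0 => *; exact: mdist_ge0.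
  lra.
have [r [rg Ur]] := konig S_gen UU Uoo.
exists (end_class (CayRay (geodesic_cay_rayP rg))).
apply: (@rb_eq0 _ _ o); apply/le_anti; rewrite rb_ge0 andbT.
apply/ler_addgt0Pr => e e0; rewrite add0r.
have e2 : 0 < e / 2 by exact: divr_gt0.
have [n hn] := comp_diam_tail S q01 Pq e2.
have [g /= [gc gxi]] := filter_ex (filterI (Ur n) (Uxi _ e2)).
have rn := ball_off (n := n) rg.
have re : ends_in S (component_of S (ball n) (r n.+1))
    (end_class (CayRay (geodesic_cay_rayP rg))).
  by eexists; first reflexivity; exact: geodesic_tail.
have := end_limit_orbit S_gen q01 Pq Pi_lim rn (ball_finite S_gen n) gc re.
have := comp_diam_le S q01 Pq (component_sub_compl (S := S) rn).
rewrite (rb_sym o (Bdry (Pi _)) (Bdry xi)).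
have := rb_triangle o (Bdry xi) (Inner (a g o))
  (Bdry (Pi (end_class (CayRay (geodesic_cay_rayP rg))))).
rewrite (rb_sym o (Bdry xi) (Inner _)); lra.
Qed.

Definition Pi_set (e : end_space S) : limit_set a o :=
  exist _ (Pi e) (mem_set (@end_limit_mem e)).

Lemma small_component (e : end_space S) eps : 0 < eps ->
  exists n c, [/\ ~ ball n c, infinite_components S (ball n) (component_of S (ball n) c),
    ends_in S (component_of S (ball n) c) e &
    comp_diam (component_of S (ball n) c) < eps].
Proof.
move=> eps0; have [n hn] := comp_diam_tail S q01 Pq eps0.
have [U [Uinf [c nc UE]] Ue] := end_in_component e (ball_finite S_gen n).
rewrite UE in Uinf Ue; exists n, c; split => //; first by split => //; exists c.
exact: le_lt_trans (comp_diam_le S q01 Pq (component_sub_compl (S := S) nc)) hn.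
Qed.

Lemma Pi_set_continuous : continuous Pi_set.
Proof.
move=> e; apply: (limit_set_cvg (F := Pi_set @ nbhs e) _ _).2 => eps eps0.
have [n [c [nc cinf ce ceps]]] := small_component e eps0.
have bfin := ball_finite S_gen n.
apply: filterS (end_nbhs bfin cinf ce) => e' /= ce'.
by apply: le_lt_trans ceps; exact: (end_limit_diam S_gen q01 Pq Pi_lim nc).
Qed.

(** A continuous surjection from a compact space to a Hausdorff space is a
    quotient map. *)
Lemma Pi_set_quotient : quotient_map Pi_set.
Proof.
have surj x : exists e, Pi_set e = x.
  have [e eE] := end_limit_surj (set_mem (valP x)).
  by exists e; exact: val_inj.
split=> // V; split; first by move/continuousP: Pi_set_continuous; exact.
move=> oV; rewrite -[V]setCK openC; apply: compact_closed.
  exact: limit_set_hausdorff.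
have -> : ~` V = Pi_set @` (~` (Pi_set @^-1` V)).
  apply/seteqP; split=> [x Vx|_ [e Ve <-]//].
  by have [e eE] := surj x; exists e => //=; rewrite eE.
apply: continuous_compact; first exact/continuous_subspaceT/Pi_set_continuous.
apply: (subclosed_compact _ (end_space_compact S_gen)) => //.
by rewrite closedC.
Qed.

Definition compactification_map (z : end_compactification S) : bordification X :=
  match z with Vtx g => Inner (a g o) | End e => Bdry (Pi e) end.

Lemma compactification_map_mem z : limit_completion a o (compactification_map z).
Proof.
case: z => [g|e]; first by left; exists (a g o).
by right; exists (Pi e) => //; exact: end_limit_mem.
Qed.

Definition F_set (z : end_compactification S) : limit_completion a o :=
  exist _ (compactification_map z) (mem_set (@compactification_map_mem z)).

Lemma F_set_continuous : continuous F_set.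
Proof.
case=> [g|e].
  move=> U /nbhs_singleton Ug.
  have : nbhs (Vtx g : end_compactification S) [set Vtx g].
    by apply: end_compactification_nbhs => //; left; exists g.
  by apply: filterS => _ ->.
apply: (initial_cvg set_val (F := F_set @ nbhs (End e)) _ _).2.
apply: (visual_cvg o (F := set_val @ (F_set @ nbhs (End e))) _ _).2 => eps eps0.
have [n [c [nc cinf ce ceps]]] := small_component e eps0.
have bfin := ball_finite S_gen n; set U := component_of S (ball n) c in cinf ce ceps.
have : nbhs (End e : end_compactification S) ((Vtx @` U) `|` (End @` ends_in S U)).
  apply: end_compactification_nbhs; last by right; exists e.
  by right; exists (ball n), U.
apply: filterS => _ /= [[g Ug <-]|[e' Ue' <-]]; apply: le_lt_trans ceps.
  exact: (end_limit_orbit S_gen q01 Pq Pi_lim nc).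
exact: (end_limit_diam S_gen q01 Pq Pi_lim nc).
Qed.

Lemma Pi_act g e : Pi (act_end g e) = act_boundary a g (Pi e).
Proof.
have [r rE] := end_classE e.
apply: (@tends_unique _ _ o _ \oo _ (fun n => Inner (a (g * repr e n)%g o))).
  exact: (Pi_lim (translate g (repr e))).
have h : tends o \oo (fun n => Inner (a (repr e n) o)) (Pi e).
  by have := Pi_lim (repr e); rewrite /end_class reprK.
move=> eps eps0; apply: filterS (tends_act a g h eps0) => n /=.
by rewrite isom_actM.
Qed.

Lemma compactification_map_act g z :
  compactification_map (act_end_compactification g z) =
  act_bordification a g (compactification_map z).
Proof. by case: z => [h|e] /=; rewrite ?isom_actM// Pi_act. Qed.

(** Since [S] generates, the Cayley graph is connected; [word_ball S (-1)] is
    empty. *)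
Lemma component_full g : component_of S (word_ball S (-1)) 1%g g.
Proof.
have [_ _ /(_ g)[n [l [_ lS ->]]]] := S_gen.
elim/last_ind: l lS => [|l s IH] lS; first by rewrite big_nil; exact: component_of_refl.
apply: (component_of_trans (IH _)); first by move=> t tl; apply: lS; rewrite mem_rcons inE tl orbT.
apply: component_of_step; apply/asboolP; split=> //.
by exists s; [apply: lS; rewrite mem_rcons inE eqxx|left; rewrite -cats1 big_cat big_seq1].
Qed.

Lemma end_levelP (e e' : end_space S) : exists c,
  [/\ ~ word_ball S (end_level e e') c,
      ends_in S (component_of S (word_ball S (end_level e e')) c) e &
      ends_in S (component_of S (word_ball S (end_level e e')) c) e'].
Proof.
rewrite /end_level; case: xgetP => [n -> [_ [c nc [ce ce']] _]|_]; first by exists c.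
exists 1%g; split=> //.
  by have [r <-] := end_classE e; exists r => //; exists 0%N => n _; exact: component_full.
by have [r <-] := end_classE e'; exists r => //; exists 0%N => n _; exact: component_full.
Qed.

Lemma word_ball_finite (n : int) : finite_set (word_ball S n).
Proof.
case: n => n; first exact: ball_finite.
by apply: (sub_finite_set _ (finite_set0 _)) => g.
Qed.

(** At their common level both ends lie in one component, whose mass is at most the
    tail of the Poincare series beyond this level; the constant of [tail_sum]
    exceeds the factor [expR (q * L)] of [comp_diam]. *)
Lemma end_dist_bound (D : R) (e e' : end_space S) : 0 <= D ->
  bourdon o (Pi e) (Pi e') <= end_dist a D q o e e'.
Proof.
move=> D0; rewrite bourdonE /end_dist; case: eqVneq => [->|_].
  by rewrite rb_bdry_refl.
have [c [nc ce ce']] := end_levelP e e'; set n := end_level e e' in nc ce ce' *.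
apply: le_trans (end_limit_diam S_gen q01 Pq Pi_lim nc (word_ball_finite n) ce ce') _.
have S_fin : finite_set S by case: S_gen.
have S_card : 1 <= #|` fset_set S |%:R :> R.
  rewrite ler1n cardfs_gt0; apply/eqP => S0.
  have [r _] := end_classE e; case: r => r [_ /(_ 0%N)/asboolP[_ _ [s Ss _]]].
  have : s \in fset_set S by rewrite in_fset_set// mem_set.
  by rewrite S0.
rewrite /tail_sum -/wt (mass_fin Pq) -EFinM /=.
rewrite ge0_ler_powR ?invr_ge0 ?(ltW q_gt0) ?nnegrE ?mulr_ge0 ?expR_ge0 ?mass_ge0//.
apply: ler_pM; rewrite ?expR_ge0 ?mass_ge0//.
  rewrite -[leLHS]mul1r ler_pM ?expR_ge0// ler_expR ler_pM2l//; lra.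
apply: mass_le => // g /(component_not_in nc); rewrite /word_ball /= => /negP.
by rewrite -ltNge.
Qed.

(** There are finitely many components, because each of them contains a vertex of
    the sphere of radius [n + 1]. *)
Lemma level_components n : exists l : seq (set G),
  [/\ forall U, U \in l -> exists2 c, ~ ball n c & U = component_of S (ball n) c,
      forall e, exists2 U, U \in l & ends_in S U e &
      \sum_(U <- l) mass U <= mass (~` ball n)].
Proof.
pose comps := [set U | exists2 c, ~ ball n c & U = component_of S (ball n) c].
have : finite_set comps.
  apply: (sub_finite_set _ (finite_image (component_of S (ball n))
    (ball_finite S_gen n.+1))) => U [c nc ->].
  have nc' : (n < word_length S c)%N by rewrite ltnNge; apply/negP => /ballP.
  exists (prefix_at S n.+1 c).
    by apply/ballP; rewrite prefix_at_length.
  apply: (component_of_eq (k := c)); first exact: component_prefix.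
  exact: component_of_refl.
move=> /finite_seqP[l0 l0E]; pose l := undup l0.
have lE U : U \in l <-> comps U by rewrite mem_undup l0E.
exists l; split=> [U /lE//|e|].
  have [U [_ UE] Ue] := end_in_component e (ball_finite S_gen n).
  by exists U => //; exact/lE.
have disj U V : U \in l -> V \in l -> U != V -> V `<=` ~` U.
  move=> /lE[c _ UE] /lE[c' _ VE] /eqP UV g; rewrite UE VE in UV * => c'g cg.
  exact/UV/(component_of_eq cg c'g).
have sub U : U \in l -> U `<=` ~` ball n.
  by move=> /lE[c nc ->]; exact: component_sub_compl.
have : uniq l by exact: undup_uniq.
move: (~` ball n) sub; elim: l {lE} disj => [|U l IH] disj A sub.
  by rewrite big_nil mass_ge0.
rewrite /= big_cons => /andP[Ul lu]; rewrite (mass_split Pq A U).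
apply: lerD.
  by apply: mass_le => // g Ug; split=> //; apply: (sub U) => //; rewrite inE eqxx.
apply: IH => //.
  by move=> V W Vl Wl; apply: disj; rewrite inE ?Vl ?Wl orbT.
move=> V Vl g Vg; split; first by apply: (sub V) => //; rewrite inE Vl orbT.
apply: (disj U V) Vg; rewrite ?inE ?eqxx ?Vl ?orbT//.
by apply: contraNneq Ul => ->.
Qed.

End BoundaryMap.

(** * Hausdorff measure zero and the energy inequality *)

Section HausdorffZero.
Context {R : realType} {X : proper_CAT R} {G : groupType} (a : isom_group G X).
Context (S : set G) (S_gen : symmetric_generating_set S).
Context (o : X) (q : R) (q01 : 0 < q <= 1).
Context (Pq : (poincare_series a o q < +oo)%E).
Context (Pi : end_space S -> boundary X) (Pi_lim : is_end_limit a o Pi).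
Local Notation L := (generator_displacement a S o).
Local Notation ball n := (word_ball S (Posz n)).
Local Notation mass := (mass a o q).
Local Notation comp_diam := (comp_diam a S o q).

Let q_gt0 : 0 < q.
Proof. by case/andP: q01. Qed.

Lemma diam_ge0 (T : choiceType) (d : T -> T -> R) (U : set T) : (0 <= diam d U)%E.
Proof. by apply: ereal_sup_ubound; left. Qed.

Lemma hausdorff_gauge_ge0 (T : choiceType) (d : T -> T -> R) s (U : set T) :
  (0 <= hausdorff_gauge d s U)%E.
Proof. by rewrite /hausdorff_gauge; case: ifP => // _; exact: poweR_ge0. Qed.

Lemma diam_end_limit Q c : finite_set Q -> ~ Q c ->
  (diam (bourdon o) (Pi @` ends_in S (component_of S Q c)) <=
   (comp_diam (component_of S Q c))%:E)%E.
Proof.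
move=> Qfin Qc; apply: ge_ereal_sup => _ [->|[_ [_ [[e ce <-] [e' ce' <-] ->]]]].
  by rewrite lee_fin powR_ge0.
rewrite lee_fin bourdonE.
exact: (end_limit_diam S_gen q01 Pq Pi_lim Qc Qfin ce ce').
Qed.

Lemma eseries_nth (I : eqType) (i0 : I) (l : seq I) (f : I -> \bar R) :
  (forall i, 0 <= f i)%E -> f i0 = 0%E ->
  (\sum_(0 <= i <oo) f (nth i0 l i) = \sum_(i <- l) f i)%E.
Proof.
move=> f0 fi0; rewrite (nneseries_split 0 (size l))//.
rewrite eseries0 => [|i li _]; last by rewrite nth_default.
by rewrite adde0 [RHS](big_nth i0) add0n.
Qed.

(** The limits of the ends in the components off a large ball form a finite cover
    of the limit set; the [q]-th powers of the diameters of these sets add up to at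
    most a multiple of a tail of the Poincare series. *)
Lemma hausdorff_limit_set_eq0 :
  hausdorff_measure (bourdon o) q (limit_set a o) = 0%E.
Proof.
apply/eqP; rewrite eq_le; apply/andP; split; last first.
  apply: le_trans (ereal_sup_ubound (ex_intro2 _ _ (1 : R) ltr01 erefl)).
  apply: le_ereal_inf_tmp => _ [U _ <-].
  by apply: nneseries_ge0 => i _ _; exact: hausdorff_gauge_ge0.
apply: ge_ereal_sup => _ [delta /= delta0 <-].
apply/lee_addgt0Pr => e e0; rewrite add0e.
pose e' := Num.min (powR delta q) e / expR (q * L).
have e'0 : 0 < e' by rewrite divr_gt0 ?expR_gt0// lt_min powR_gt0.
have [n] := mass_tail S Pq e'0; rewrite /e' ltr_pdivlMr ?expR_gt0// mulrC.
rewrite lt_min => /andP[hn1 hn2].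
have [l [lP lcov lsum]] := level_components S_gen Pq n.
pose V (U : set G) := Pi @` ends_in S U.
have bfin := ball_finite S_gen n.
have V0 : V set0 = set0.
  by apply/seteqP; split => [x [e1 [r _ [N hN]] _]|//]; have := hN N (leqnn N).
have diamV U : U \in l -> (diam (bourdon o) (V U) <= (comp_diam U)%:E)%E.
  by move=> /lP[c nc ->]; exact: diam_end_limit.
have massU U : U \in l -> mass U <= mass (~` ball n).
  by move=> /lP[c nc ->]; apply: mass_le => //; exact: component_sub_compl.
apply: (@le_trans _ _ (\sum_(0 <= i <oo)
    hausdorff_gauge (bourdon o) q (V (nth set0 l i)))%E).
  apply: ereal_inf_lbound; exists (fun i => V (nth set0 l i)) => //; split.
    move=> x /(end_limit_surj S_gen q01 Pq Pi_lim)[e1 <-].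
    have [U Ul Ue] := lcov e1; exists (index U l) => //.
    by exists e1 => //; rewrite nth_index.
  move=> i; have [il|il] := ltnP i (size l); last first.
    rewrite nth_default// V0; apply: ge_ereal_sup => _ [->|[x [y [[]]]]].
    by rewrite lee_fin ltW.
  apply: (le_trans (diamV _ (mem_nth _ il))); rewrite lee_fin ltW//.
  apply: ltr_powR_root; rewrite ?mulr_ge0 ?expR_ge0 ?mass_ge0//.
  apply: le_lt_trans hn1; rewrite ler_pM2l ?expR_gt0//.
  by apply: massU; exact: mem_nth.
rewrite (@eseries_nth _ set0 l (fun U => hausdorff_gauge (bourdon o) q (V U))); first last.
- by rewrite V0 /hausdorff_gauge eqxx.
- by move=> U; exact: hausdorff_gauge_ge0.
apply: (@le_trans _ _ (\sum_(U <- l) (expR (q * L) * mass U)%:E)%E).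
  rewrite big_seq [leRHS]big_seq; apply: lee_sum => U Ul.
  rewrite /hausdorff_gauge; case: ifP => _.
    by rewrite lee_fin mulr_ge0 ?expR_ge0 ?mass_ge0.
  have -> : (expR (q * L) * mass U)%:E = poweR (comp_diam U)%:E q.
    rewrite poweR_EFin /comp_diam -powRrM mulVf ?gt_eqF// powRr1//.
    by rewrite mulr_ge0 ?expR_ge0 ?mass_ge0.
  apply: gt0_ler_poweR; rewrite ?(ltW q_gt0)// ?in_itv/= ?leey ?andbT ?diam_ge0//.
    by rewrite lee_fin powR_ge0.
  exact: diamV.
rewrite sumEFin lee_fin -mulr_sumr (le_trans _ (ltW hn2))//.
by rewrite ler_pM2l ?expR_gt0.
Qed.

End HausdorffZero.

Section Energy.
Context {R : realType} {X : proper_CAT R} {G : groupType} (a : isom_group G X).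
Context (S : set G) (S_gen : symmetric_generating_set S).
Context (o : X) (q : R) (q01 : 0 < q <= 1).
Context (Pq : (poincare_series a o q < +oo)%E).
Context (Pi : end_space S -> boundary X) (Pi_lim : is_end_limit a o Pi).
Context (D : R) (xi : G -> boundary X).
Context (xi_near : forall g, (edist_inf (ray_set o (xi g)) (a g o) <= D%:E)%E).
Local Notation d := (@mdist R X).

Let q_gt0 : 0 < q.
Proof. by case/andP: q01. Qed.

Lemma edist_infP (A : set X) x : (edist_inf A x <= D%:E)%E ->
  exists2 y, A y & d x y < D + 1.
Proof.
move=> h; have : (edist_inf A x < (D + 1)%:E)%E.
  by apply: le_lt_trans h _; rewrite lte_fin; lra.
move=> /ereal_inf_lt[_ [y Ay <-]] /ereal_inf_lt[_ [r [r0 xy] <-]].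
rewrite lte_fin => rD; exists y => //.
by move: xy; rewrite ballEmdist /= => /lt_trans; apply.
Qed.

(** The ray from [o] to [xi g] passes within [D + 1] of [a g o], where the summand [1]
    makes up for an infimum that need not be attained. *)
Lemma xi_orbit g :
  rb o (Bdry (xi g)) (Inner (a g o)) <= expR (D + 1) * expR (- d o (a g o)).
Proof.
have [_ [t /= t0 <-] hD] := edist_infP (xi_near g).
rewrite in_itv/= andbT in t0.
pose s := Num.max t (d o (a g o)).
have s0 : 0 <= s by rewrite le_max t0.
have ts : t <= s by rewrite le_max lexx.
apply: (le_trans (rb_le _ _ _ s0)).
rewrite (pr_inner_far (x := a g o))//; last by rewrite le_max lexx orbT.
have tE := pr_reach o (Bdry (xi g)) t0; have sE := pr_reach o (Bdry (xi g)) s0.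
have := pr_between o (Bdry (xi g)) t0 ts; rewrite /between tE sE /= => st.
rewrite -expRD ler_expR /gromov_product sE /=.
have := metric_triangle (pr o (Bdry (xi g)) s) (pr o (Bdry (xi g)) t) (a g o).
have := metric_triangle o (pr o (Bdry (xi g)) t) (a g o); rewrite tE /=.
rewrite (metric_sym (pr o _ s) (pr o _ t)).
move: hD; rewrite -/(pr o (Bdry (xi g)) t) (metric_sym (a g o) (pr _ _ _)).
by lra.
Qed.

Lemma tends_xi (r : cay_ray S) :
  tends o \oo (fun n => Bdry (xi (r n))) (Pi (end_class r)).
Proof.
apply: tends_near (Pi_lim r) => e e0.
have [T _ hT] := expR_le_eps (D + 1) e0.
have := cay_ray_oo q01 Pq r T; apply: filterS => n /= /hT.
by rewrite expRD; apply: le_lt_trans; exact: xi_orbit.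
Qed.

Lemma set2_eq (g h u v : G) : [set g; h] = [set u; v] ->
  g = u /\ h = v \/ g = v /\ h = u.
Proof.
move=> E; have gE : [set u; v] g by rewrite -E; left.
have hE : [set u; v] h by rewrite -E; right.
have uE : [set g; h] u by rewrite E; left.
have vE : [set g; h] v by rewrite E; right.
move: gE hE uE vE => /= [->|->] [->|->]; move=> [] ? [] ?; subst; by auto.
Qed.

Lemma edge_weightE u v :
  edge_weight o xi [set u; v] = rb o (Bdry (xi u)) (Bdry (xi v)).
Proof.
rewrite /edge_weight; case: xgetP => [w -> [g [h [/esym E ->]]]|].
  by rewrite bourdonE; case: (set2_eq E) => [[-> ->]//|[-> ->]]; rewrite rb_sym.
by move=> /(_ (bourdon o (xi u) (xi v))); case; exists u, v.
Qed.

Definition path_edges (g : G) (p : seq G) : seq (set G) :=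
  [seq [set uv.1; uv.2] | uv <- zip (belast g p) p].

Lemma path_edges_vertex g p E x : E \in path_edges g p -> E x -> x \in g :: p.
Proof.
elim: p g => //= h p IH g; rewrite inE => /orP[/eqP -> [->|->]|Ep Ex].
- by rewrite inE eqxx.
- by rewrite !inE eqxx orbT.
- by rewrite inE (IH h Ep Ex) orbT.
Qed.

Lemma path_edges_uniq g p : uniq (g :: p) -> uniq (path_edges g p).
Proof.
elim: p g => //= h p IH g /andP[gh hp]; rewrite -/(path_edges h p) IH// andbT.
by apply: contra gh => /path_edges_vertex; apply; left.
Qed.

Lemma path_edges_sub Q g p : path (cay_adj S Q) g p ->
  [set` path_edges g p] `<=` cay_edges S Q.
Proof.
elim: p g => [|h p IH] g //= /andP[gh hp] E /=; rewrite inE => /orP[/eqP ->|Ep].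
  by exists (g, h).
exact: (IH h hp).
Qed.

Lemma path_le_energy Q u v c : ~ Q c -> component_of S Q c u -> component_of S Q c v ->
  ((powR (rb o (Bdry (xi u)) (Bdry (xi v))) q)%:E <= edge_energy S q o xi Q)%E.
Proof.
move=> Qc cu cv; have [p [up <- p_uniq _]] := component_simple_path Qc cu cv.
have [->|pN] := eqVneq p [::].
  rewrite /= rb_bdry_refl powR0 ?gt_eqF//; apply: esum_ge0 => E _.
  by rewrite lee_fin powR_ge0.
apply: esum_ge; exists [set` path_edges u p].
  by split; [exact: finite_seq|exact: path_edges_sub].
rewrite -fsbig_seq ?path_edges_uniq// sumEFin lee_fin.
apply: (le_trans (path_energy o q01 (fun g => Bdry (xi g)) up pN)).
by rewrite big_map; under [leRHS]eq_bigr do rewrite edge_weightE.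
Qed.

(** Far out on rays that represent the two ends, the points [xi] are close to the
    limits of the ends, and a simple path between such vertices costs at most the
    energy of the component. *)
Lemma end_energy Q c e e' : finite_set Q -> ~ Q c ->
  ends_in S (component_of S Q c) e -> ends_in S (component_of S Q c) e' ->
  ((powR (rb o (Bdry (Pi e)) (Bdry (Pi e'))) q)%:E <= edge_energy S q o xi Q)%E.
Proof.
move=> Qfin Qc [r <- [N rN]] [r' <- [N' rN']].
have E0 : (0 <= edge_energy S q o xi Q)%E.
  by apply: esum_ge0 => E _; rewrite lee_fin powR_ge0.
move: E0; case EE : (edge_energy S q o xi Q) => [w||] w0 //; last exact: leey.
rewrite lee_fin in w0; rewrite lee_fin.
have root_ge : rb o (Bdry (Pi (end_class r))) (Bdry (Pi (end_class r'))) <= powR w q^-1.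
  apply/ler_addgt0Pr => eps eps0; have eps2 : 0 < eps / 2 by exact: divr_gt0.
  have [M _ hM] := tends_xi r eps2; have [M' _ hM'] := tends_xi r' eps2.
  pose n := maxn (maxn N N') (maxn M M').
  have h1 := hM n ltac:(rewrite /= /n; lia).
  have h2 := hM' n ltac:(rewrite /= /n; lia).
  have h3 := rN n ltac:(rewrite /n; lia).
  have h4 := rN' n ltac:(rewrite /n; lia).
  rewrite /= in h1 h2.
  have := path_le_energy Qc h3 h4; rewrite EE lee_fin => /(ler_powR_root q_gt0 (rb_ge0 _ _ _)) h5.
  have := rb_triangle o (Bdry (Pi (end_class r))) (Bdry (xi (r n))) (Bdry (Pi (end_class r'))).
  have := rb_triangle o (Bdry (xi (r n))) (Bdry (xi (r' n))) (Bdry (Pi (end_class r'))).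
  rewrite (rb_sym o (Bdry (Pi (end_class r))) (Bdry (xi (r n)))); lra.
have -> : w = powR (powR w q^-1) q by rewrite -powRrM mulVf ?powRr1// gt_eqF.
by rewrite ge0_ler_powR ?nnegrE ?powR_ge0 ?rb_ge0 ?(ltW q_gt0).
Qed.

(** A separated set of limit points with more elements than there are infinite
    components contains the limits of two ends of one component. *)
Lemma packing_energy Q m eps : finite_set Q -> few_infinite_components S Q m ->
  0 < eps -> (m%:R%:E <= packing (bourdon o) eps (limit_set a o))%E ->
  ((powR eps q)%:E <= edge_energy S q o xi Q)%E.
Proof.
move=> Qfin [k km comps_k] eps0 hm.
have [E [Esub Esep kE]] : exists E : {fset boundary X}, [/\ [set` E] `<=` limit_set a o,
    forall x y, x \in E -> y \in E -> x <> y -> eps <= bourdon o x y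
    & (k < #|` E|)%N].
  apply: contrapT => none.
  have : (packing (bourdon o) eps (limit_set a o) <= k%:R%:E)%E.
    apply: ge_ereal_sup => _ [E [Esub Esep] <-]; rewrite lee_fin ler_nat leqNgt.
    by apply/negP => kE; apply: none; exists E.
  by move=> /(le_trans hm); rewrite lee_fin ler_nat leqNgt km.
have /choice[en en_Pi] : forall x, exists e, limit_set a o x -> Pi e = x.
  move=> x; have [/(end_limit_surj S_gen q01 Pq Pi_lim)[e eE]|nx] :=
    pselect (limit_set a o x); first by exists e.
  have [y yE] : exists y, y \in E by apply/fset0Pn; rewrite -cardfs_gt0 (leq_trans _ kE).
  by have [e _] := end_limit_surj S_gen q01 Pq Pi_lim (Esub y yE); exists e.
have /choice[cm hcm] : forall x, exists U,
    infinite_components S Q U /\ ends_in S U (en x).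
  by move=> x; have [U ? ?] := end_in_component (en x) Qfin; exists U.
have cfin : finite_set (infinite_components S Q) by exists k.
have [x [y [xE yE xy cxy]]] : exists x y,
    [/\ x \in E, y \in E, x <> y & cm x = cm y].
  apply: contrapT => none.
  have cm_inj : {in E &, injective cm}.
    move=> x y xE yE cxy; apply: contrapT => xy; apply: none.
    by exists x, y.
  have : (#|` [fset cm x | x in E]%fset| <= #|` fset_set (infinite_components S Q)|)%N.
    apply/fsubset_leq_card/fsubsetP => U /imfsetP[x _ ->].
    by rewrite in_fset_set// mem_set//; exact: (hcm x).1.
  rewrite card_in_imfset; last exact: cm_inj.
  rewrite (card_fset_set comps_k).
  by rewrite leqNgt kE.
have [_ [c Qc cE]] := (hcm x).1.
have cx := (hcm x).2; have cy := (hcm y).2; rewrite -cxy cE in cy; rewrite cE in cx.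
apply: le_trans (end_energy Qfin Qc cx cy); rewrite lee_fin.
rewrite !en_Pi; [|exact: Esub..].
rewrite ge0_ler_powR ?nnegrE ?rb_ge0 ?(ltW q_gt0) ?(ltW eps0)//.
by rewrite -bourdonE; exact: Esep.
Qed.

Lemma packing_radius_energy Q m : finite_set Q -> few_infinite_components S Q m ->
  (poweR (packing_radius (bourdon o) m (limit_set a o)) q <=
   edge_energy S q o xi Q)%E.
Proof.
move=> Qfin few; have E0 : (0 <= edge_energy S q o xi Q)%E.
  by apply: esum_ge0 => E _; rewrite lee_fin powR_ge0.
have qN0 : q != 0 by rewrite gt_eqF.
have bound eps : 0 < eps ->
    (m%:R%:E <= packing (bourdon o) eps (limit_set a o))%E ->
    ((powR eps q)%:E <= edge_energy S q o xi Q)%E by exact: packing_energy.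
rewrite /packing_radius; set P := [set eps%:E | eps in _].
have [->|/set0P[_ [eps0 /= [eps00 eps0m] _]]] := eqVneq P set0.
  (* Without separated sets the radius is the empty supremum [-oo]. *)
  by rewrite ereal_sup0 poweRNyr.
move: E0 bound; case EE : (edge_energy S q o xi Q) => [w||] w0 bound //.
  2: exact: leey.
rewrite lee_fin in w0.
have -> : w = powR (powR w q^-1) q by rewrite -powRrM mulVf ?powRr1// gt_eqF.
rewrite -poweR_EFin; apply: gt0_ler_poweR; first exact: ltW.
- rewrite in_itv/= leey andbT; apply: (@le_trans _ _ eps0%:E).
    by rewrite lee_fin ltW.
  by apply: ereal_sup_ubound; exists eps0.
- by rewrite in_itv/= leey andbT lee_fin powR_ge0.
- apply: ge_ereal_sup => _ [eps /= [eps_gt0 epsm] <-]; rewrite lee_fin.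
  apply: ler_powR_root => //; first exact: ltW.
  by rewrite -lee_fin; exact: bound.
Qed.

End Energy.

(** * The limit set is a Cantor set *)

Section Dynamics.
Context {R : realType} {X : proper_CAT R} {G : groupType} (a : isom_group G X).
Context (o : X).
Local Notation d := (@mdist R X).
Local Notation act := (act_boundary a).
Implicit Types (g h : G) (xi eta zeta : boundary X).

(** The dynamics of a divergent family of isometries: away from the point [zeta]
    that repels, everything is attracted by [xi]. *)
Lemma north_south (U : set_system G) {UU : Filter U} xi zeta eta :
  tends o U (fun g => Inner (a g o)) xi ->
  tends o U (fun g => Inner (a g^-1%g o)) zeta -> eta <> zeta ->
  tends o U (fun g => Bdry (act g eta)) xi.
Proof.
move=> Uxi Uzeta ez; apply: tends_near (Uxi) => e e0.
set c := rb o (Bdry eta) (Bdry zeta).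
have c0 : 0 < c.
  rewrite lt_neqAle rb_ge0 andbT eq_sym; apply/eqP => /rb_eq0; exact: ez.
have c2 : 0 < c / 2 by exact: divr_gt0.
have [T _ hT] := expR_le_eps 0 (mulr_gt0 e0 c2).
apply: filterS (filterI (Uzeta _ c2) (tends_inner_oo Uxi T)) => g /= [h1 /hT].
rewrite sub0r -(rb_act_compl a o g eta).
have hB : c / 2 <= rb o (Bdry eta) (Inner (a g^-1%g o)).
  by have := rb_triangle o (Bdry eta) (Inner (a g^-1%g o)) (Bdry zeta); rewrite -/c; lra.
rewrite !ltNge; apply: contra => hA; rewrite -[leLHS]/(e * (c / 2)).
by apply: ler_pM hA hB; exact: ltW.
Qed.

Lemma isom_inverse_limit (U : set_system G) (UU : UltraFilter U) xi :
  tends o U (fun g => Inner (a g o)) xi ->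
  exists zeta, tends o U (fun g => Inner (a g^-1%g o)) zeta.
Proof.
move=> /tends_inner_oo Uoo; apply: rb_ultralimit => M.
by apply: filterS (Uoo M) => g /=; rewrite isom_dist1.
Qed.

End Dynamics.

Section AvoidIntervals.
Context {R : realType}.

(** By subadditivity of the Lebesgue measure. *)
Lemma avoid_intervals (l : seq (R * R)) (r : R) :
  (forall p, p \in l -> 0 <= p.2) -> \sum_(p <- l) p.2 < r ->
  exists t, [/\ 0 < t, t < r & forall p, p \in l -> ~ (p.1 <= t /\ t <= p.1 + p.2)].
Proof.
move=> l0 lr; apply: contrapT => none.
pose A i : set R := [set` `[(nth (0, 0) l i).1, (nth (0, 0) l i).1 + (nth (0, 0) l i).2]].
pose B : set R := `]0, r[%classic.
have : (lebesgue_measure B <=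
        \sum_(i < size l) lebesgue_measure (A i))%E.
  apply: content_subadditive.
  - by move=> i _; exact: measurable_itv.
  - exact: measurable_itv.
  move=> t; rewrite /B /= in_itv/= => /andP[t0 tr]; apply: contrapT => tA.
  apply: none; exists t; split => // p pl [pt tp]; apply: tA.
  rewrite -bigcup_mkord; exists (index p l); first by rewrite /= index_mem.
  by rewrite /A /= nth_index// in_itv/= pt tp.
rewrite /B lebesgue_measure_itv/= lte_fin.
have r0 : 0 < r by apply: le_lt_trans lr; rewrite big_seq sumr_ge0.
rewrite r0 -EFinD subr0.
have -> : (\sum_(i < size l) lebesgue_measure (A i) = (\sum_(p <- l) p.2)%:E)%E.
  rewrite -sumEFin (big_nth (0, 0)) big_mkord; apply: eq_bigr => i _.
  rewrite /A lebesgue_measure_itv/= lte_fin ltrDl.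
  have := l0 _ (mem_nth (0, 0) (ltn_ord i)); rewrite le_eqVlt => /orP[/eqP <-|->].
    by rewrite ltxx.
  by rewrite -EFinD; congr EFin; ring.
by rewrite lee_fin leNgt lr.
Qed.

End AvoidIntervals.

Section LimitSpace.
Context {R : realType} {X : proper_CAT R} {G : groupType} (a : isom_group G X).
Context (o : X) (x0 : limit_set a o).

(** The limit set as a pointed metric space; its topology is the visual one. *)
Definition limit_space (x : limit_set a o) : Type := limit_set a o.
HB.instance Definition _ := Choice.on (limit_space x0).
HB.instance Definition _ := isPointed.Build (limit_space x0) x0.

Let dist (x y : limit_space x0) := rb o (Bdry (val x)) (Bdry (val y)).

Let dist_refl x : dist x x = 0. Proof. exact: rb_bdry_refl. Qed.
Let dist_eq0 x y : dist x y = 0 -> x = y.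
Proof. by move=> /rb_eq0 /val_inj. Qed.
Let dist_sym x y : dist x y = dist y x. Proof. exact: rb_sym. Qed.
Let dist_tri y x z : dist x z <= dist x y + dist y z.
Proof. exact: rb_triangle. Qed.

HB.instance Definition _ :=
  isMetric.Build R (limit_space x0) dist_refl dist_eq0 dist_sym dist_tri.

Lemma limit_space_ball (x y : limit_space x0) e :
  ball x e y = (rb o (Bdry (val x)) (Bdry (val y)) < e) :> Prop.
Proof. by rewrite ballEmdist. Qed.

Lemma limit_space_continuous : continuous (id : limit_set a o -> limit_space x0).
Proof.
move=> x U /nbhs_ballP[e e0 sub].
apply: (@filterS _ _ (nbhs_filter (x : limit_set a o)) _ _ _ (limit_set_nbhs x e0)).
by move=> y /= yx; apply: sub; rewrite limit_space_ball rb_sym.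
Qed.

Lemma limit_space_continuous_inv : continuous (id : limit_space x0 -> limit_set a o).
Proof.
move=> x; apply: (limit_set_cvg (F := id @ nbhs (x : limit_space x0)) _ _).2 => e e0.
have := nbhsx_ballx (x : limit_space x0) e e0; apply: filterS => y /=.
by rewrite limit_space_ball rb_sym.
Qed.

End LimitSpace.

Section CantorSet.
Context {R : realType} {X : proper_CAT R} {G : groupType} (a : isom_group G X).
Context (o : X).
Context (G_non_elementary : non_elementary a o).
Local Notation act := (act_boundary a).
Implicit Types (xi eta zeta : boundary X).

Lemma two_limit_points zeta : exists eta1 eta2,
  [/\ limit_set a o eta1, limit_set a o eta2, eta1 <> eta2, eta1 <> zeta & eta2 <> zeta].
Proof.
have [x [y [z [[Lx Ly Lz] [xy yz xz]]]]] := G_non_elementary.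
have [xzeta|xzeta] := pselect (x = zeta).
  by exists y, z; split => //; rewrite -xzeta => /esym.
have [yzeta|yzeta] := pselect (y = zeta).
  by exists x, z; split => //; rewrite -yzeta => // /esym.
by exists x, y.
Qed.

(** Of two limit points other than the repelling point, the images under the
    elements that attract to [xi] approach [xi], and at most one of them is
    [xi]. *)
Lemma limit_set_perfect xi e : limit_set a o xi -> 0 < e ->
  exists eta, [/\ limit_set a o eta, eta <> xi & rb o (Bdry eta) (Bdry xi) < e].
Proof.
move=> /limit_ultrafilter[U [UU Uxi]] e0.
have [zeta Uzeta] := isom_inverse_limit UU Uxi.
have [eta1 [eta2 [L1 L2 eta12 ez1 ez2]]] := two_limit_points zeta.
have h1 : tends o U (fun g => Bdry (act g eta1)) xi by exact: north_south ez1.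
have h2 : tends o U (fun g => Bdry (act g eta2)) xi by exact: north_south ez2.
have [g /= [g1 g2]] := filter_ex (filterI (h1 e e0) (h2 e e0)).
have [E|nE] := pselect (act g eta1 = xi); last first.
  by exists (act g eta1); split=> //; exact: limit_act.
exists (act g eta2); split => //; first exact: limit_act.
by rewrite -E => /act_boundary_inj /esym.
Qed.

Section Bounded.
Context (S : set G) (S_gen : symmetric_generating_set S).
Context (q : R) (q01 : 0 < q <= 1) (Pq : (poincare_series a o q < +oo)%E).
Context (Pi : end_space S -> boundary X) (Pi_lim : is_end_limit a o Pi).
Local Notation L := (generator_displacement a S o).
Local Notation ball n := (word_ball S (Posz n)).
Local Notation mass := (mass a o q).
Local Notation comp_diam := (comp_diam a S o q).

(** The distances from [xi] to the limit points form a set of Lebesgue measure zero,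
    as they are covered by the intervals that the components off a large ball give
    rise to. *)
Lemma limit_set_radius xi r : 0 < r -> exists t,
  [/\ 0 < t, t < r & forall eta, limit_set a o eta -> rb o (Bdry xi) (Bdry eta) <> t].
Proof.
move=> r0; have q_gt0 : 0 < q by case/andP: q01.
have K0 : 0 < expR (q * L) by exact: expR_gt0.
have r'0 : 0 < Num.min 1 (r / 2) / expR (q * L).
  by rewrite divr_gt0// lt_min ltr01 divr_gt0.
have [n] := mass_tail S Pq r'0; rewrite ltr_pdivlMr// mulrC lt_min => /andP[hn1 hn2].
have [l [lP lcov lsum]] := level_components S_gen Pq n.
have bfin := ball_finite S_gen n.
have /choice[m hm] : forall U, exists m, U \in l -> forall e, ends_in S U e ->
    m <= rb o (Bdry xi) (Bdry (Pi e)) <= m + 2 * comp_diam U.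
  move=> U; have [[e0 Ue0]|none] := pselect (exists e, ends_in S U e); last first.
    by exists 0 => _ e Ue; case: none; exists e.
  exists (rb o (Bdry xi) (Bdry (Pi e0)) - comp_diam U) => /lP[c nc UE] e Ue.
  rewrite UE in Ue Ue0 *.
  have h := end_limit_diam S_gen q01 Pq Pi_lim nc bfin Ue0 Ue.
  have := rb_triangle o (Bdry xi) (Bdry (Pi e0)) (Bdry (Pi e)).
  have := rb_triangle o (Bdry xi) (Bdry (Pi e)) (Bdry (Pi e0)).
  by rewrite (rb_sym o (Bdry (Pi e)) (Bdry (Pi e0))) => *; apply/andP; split; lra.
have [|| t [t0 tr ht]] := @avoid_intervals _ [seq (m U, 2 * comp_diam U) | U <- l] r.
- by move=> p /mapP[U _ ->] /=; rewrite mulr_ge0// powR_ge0.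
- rewrite big_map /=; apply: (@le_lt_trans _ _ (2 * (expR (q * L) * mass (~` ball n)))).
    rewrite -mulr_sumr ler_pM2l//; apply: (@le_trans _ _ (\sum_(U <- l) expR (q * L) * mass U)).
      rewrite big_seq [leRHS]big_seq; apply: ler_sum => U /lP[c nc ->].
      set M := expR _ * _; have M0 : 0 <= M by rewrite mulr_ge0 ?expR_ge0 ?mass_ge0.
      have M1 : M <= 1.
        apply: le_trans (ltW hn1); rewrite ler_pM2l//.
        by apply: mass_le => //; exact: component_sub_compl.
      rewrite /comp_diam -/M; have [->|Mn0] := eqVneq M 0.
        by rewrite powR0// invr_eq0 gt_eqF.
      apply: ge1r_powR; first by rewrite lt_neqAle eq_sym Mn0 M0.
      by rewrite invf_ge1//; case/andP: q01.
    by rewrite -mulr_sumr ler_pM2l.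
  by rewrite mulrC -ltr_pdivlMr.
exists t; split => // eta /(end_limit_surj S_gen q01 Pq Pi_lim)[e <-] et.
have [U Ul Ue] := lcov e; apply: (ht (m U, 2 * comp_diam U)).
  by apply/mapP; exists U.
by move: (hm U Ul e Ue); rewrite et => /andP.
Qed.

Lemma limit_space_compact (x0 : limit_set a o) : compact [set: limit_space x0].
Proof.
have c1 := @Pi_set_continuous _ _ _ _ _ S_gen _ _ q01 Pq _ Pi_lim.
have c2 := continuous_compact (continuous_subspaceT c1) (end_space_compact S_gen).
have c3 := continuous_compact (continuous_subspaceT (@limit_space_continuous _ _ _ _ _ x0)) c2.
congr compact : c3; apply/seteqP; split=> // x _.
have [e eE] := end_limit_surj S_gen q01 Pq Pi_lim (set_mem (valP (x : limit_set a o))).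
by exists x => //; exists e => //; exact: val_inj.
Qed.

Lemma limit_space_cantor_like (x0 : limit_set a o) : cantor_like (limit_space x0).
Proof.
have ball_open (P : R -> Prop) x : (forall y : limit_space x0, P (mdist x y) ->
    exists2 e, 0 < e & forall z, mdist y z < e -> P (mdist x z)) ->
    open [set y : limit_space x0 | P (mdist x y)].
  move=> h; rewrite openE => y /= /h[e e0 he]; apply/nbhs_ballP; exists e => //.
split.
- apply/perfectTP => x x_open.
  have : nbhs x [set x] by exact: open_nbhs_nbhs.
  move=> /nbhs_ballP[e e0 sub].
  have [eta [Leta eta_x eta_e]] := limit_set_perfect (set_mem (valP (x : limit_set a o))) e0.
  pose y : limit_space x0 := exist _ eta (mem_set Leta).
  have /sub yx : pseudometric_structure.ball x e y by rewrite limit_space_ball rb_sym.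
  by apply: eta_x; rewrite -yx.
- exact: limit_space_compact.
- exact: metric_hausdorff.
- move=> x y; rewrite -mdist_gt0 => xy.
  have [t [t0 ty ht]] := limit_set_radius (val x) xy.
  exists [set z | mdist x z < t]; split; last 2 first.
  + by rewrite /= mdistxx.
  + by rewrite /=; apply/negP; rewrite -leNgt ltW.
  split.
    apply: (ball_open (fun s => s < t)) => z zt; exists (t - mdist x z); first by lra.
    by move=> w zw; have := metric_triangle x z w; lra.
  rewrite -[X in closed X]setCK closedC.
  have -> : ~` [set z | mdist x z < t] = [set z | mdist x z > t].
    apply/seteqP; split => z /= /negP; last by move=> zt; apply/negP; rewrite -leNgt ltW//; apply/negP.
    rewrite -leNgt le_eqVlt => /orP[/eqP tz|//].
    by case: (ht (val z) (set_mem (valP (z : limit_set a o)))).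
  apply: (ball_open (fun s => s > t)) => z zt; exists (mdist x z - t); first by lra.
  by move=> w zw; have := metric_triangle x w z; rewrite (metric_sym w z); lra.
Qed.

(** By Brouwer's characterization of the Cantor set. *)
Lemma limit_set_cantor : is_cantor_set (limit_set a o).
Proof.
have [xi [_ [_ [[Lxi _ _] _]]]] := G_non_elementary.
pose x0 : limit_set a o := exist _ xi (mem_set Lxi).
have [f [fc fcl]] := homeomorphism_cantor_like (limit_space_cantor_like x0).
have [g fK gK] := @bijTT _ _ f.
exists (f : cantor_space -> limit_set a o), (g : limit_set a o -> cantor_space).
split=> //.
- move=> x; apply: (@continuous_comp cantor_space (limit_space x0) (limit_set a o) f id).
    exact: fc.
  exact: limit_space_continuous_inv.
- have gc : continuous (g : limit_space x0 -> cantor_space).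
    apply/continuousP => A oA; rewrite -[X in open X]setCK openC.
    have -> : ~` (g @^-1` A) = f @` (~` A).
      apply/seteqP; split => [y Ay|_ [x Ax <-] /=]; last by rewrite fK.
      by exists (g y) => //; exact: gK.
    by apply: fcl; rewrite closedC.
  move=> x; apply: (@continuous_comp (limit_set a o) (limit_space x0) cantor_space id g).
    exact: limit_space_continuous.
  exact: gc.
Qed.

(** A perfect set is infinite, and the limit set is an image of the space of
    ends. *)
Lemma ends_infinite : infinite_set [set: end_space S].
Proof.
move=> efin; have Lfin : finite_set (limit_set a o : set (boundary X)).
  apply: (sub_finite_set _ (finite_image Pi efin)) => xi.
  by move=> /(end_limit_surj S_gen q01 Pq Pi_lim)[e <-]; exists e.
have [xi [_ [_ [[Lxi _ _] _]]]] := G_non_elementary.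
have /finite_seqP[l lE] := Lfin.
have [e e0 he] : exists2 e, 0 < e & forall eta, eta \in l -> eta <> xi ->
    e <= rb o (Bdry eta) (Bdry xi).
  elim: l {lE} => [|eta l [e e0 he]]; first by exists 1.
  have [->|etaxi] := pselect (eta = xi).
    by exists e => // zeta; rewrite inE => /orP[/eqP ->//|zl]; exact: he.
  have d0 : 0 < rb o (Bdry eta) (Bdry xi).
    by rewrite lt_neqAle rb_ge0 andbT eq_sym; apply/eqP => /rb_eq0.
  exists (Num.min e (rb o (Bdry eta) (Bdry xi))); first by rewrite lt_min e0.
  move=> zeta; rewrite inE => /orP[/eqP -> _|zl zxi]; rewrite ge_min ?lexx ?orbT//.
  by rewrite he.
have [eta [Leta etaxi]] := limit_set_perfect Lxi e0.
have etal : eta \in l by have : [set` l] eta by rewrite -lE.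
by rewrite ltNge he.
Qed.

End Bounded.
End CantorSet.

(** * Absence of global fixed points at infinity *)

Section NoFixedPoint.
Context {R : realType} {X : proper_CAT R} {G : groupType} (a : isom_group G X).
Context (S : set G) (S_gen : symmetric_generating_set S).
Context (o : X) (G_non_elementary : non_elementary a o).
Local Notation d := (@mdist R X).
Context (orbit_fin : forall M, finite_set [set g | d o (a g o) <= M]).
Local Notation act := (act_boundary a).
Implicit Types (g h : G) (xi eta zeta : boundary X).

Lemma attracted_fixed (U : set_system G) (UU : ProperFilter U) xi zeta eta :
  tends o U (fun g => Inner (a g o)) xi ->
  tends o U (fun g => Inner (a g^-1%g o)) zeta ->
  (forall g, act g eta = eta) -> eta <> zeta -> eta = xi.
Proof.
move=> Uxi Uzeta fix_eta ez.
apply: (tends_unique (o := o) (U := U) (z := fun g => Bdry (act g eta))).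
  by move=> e e0; apply: filterE => g /=; rewrite fix_eta rb_bdry_refl.
exact: north_south ez.
Qed.

(** If [zeta] is fixed and the orbit accumulates at [xi != zeta], then the
    inverses of the accumulating elements approach [zeta] along the ray from [o];
    each element of [G], as it fixes [zeta], moves the points of this ray by a
    bounded amount.  As only finitely many elements move [o] by a bounded amount, the
    conjugates of a generator by the accumulating elements take a single value, and
    the commutation relations that this gives survive in the limit. *)
Lemma fixed_propagates zeta xi : (forall g, act g zeta = zeta) ->
  limit_set a o xi -> xi <> zeta -> forall g, act g xi = xi.
Proof.
move=> fix_zeta /limit_ultrafilter[U [UU Uxi]] xz.
have Uoo M : U [set g | M <= d o (a g o)] by exact: tends_inner_oo Uxi M.
have [c [cz c0 _]] := ray_fromP o zeta.
set e := rb o (Bdry zeta) (Bdry xi).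
have e0 : 0 < e.
  by rewrite lt_neqAle rb_ge0 andbT eq_sym; apply/eqP => /rb_eq0/esym.
have e2 : 0 < e / 2 by exact: divr_gt0.
pose C := 2 / e.
have near : U [set g | d (a g^-1%g o) (c (d o (a g^-1%g o))) <= 2 * C].
  apply: filterS (Uxi _ e2) => g /= hg; apply: (rb_near_ray cz c0).
  have := rb_act_compl a o g zeta; rewrite fix_zeta isom_dist1 => h.
  have h2 : e / 2 <= rb o (Bdry zeta) (Inner (a g o)).
    by have := rb_triangle o (Bdry zeta) (Inner (a g o)) (Bdry xi); rewrite -/e; lra.
  rewrite rb_sym /C -ler_pdivrMl; last by rewrite divr_gt0.
  rewrite invf_div -h ler_wpM2r ?rb_ge0//.
have conj_const g : exists g', U [set m | (m * g * m^-1)%g = g'].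
  have /ray_class_eq/asboolP[K hK] : ray_class (act_ray a g c) = ray_class c.
    by rewrite -act_ray_class cz fix_zeta.
  have [|g' _ h] := ultra_finite (f := fun m => (m * g * m^-1)%g) UU
    (orbit_fin (4 * C + K)); last by exists g'.
  apply: filterS near => m /= hm; set t := d o _ in hm.
  have t0 : 0 <= t by exact: mdist_ge0.
  have -> : d o (a (m * g * m^-1)%g o) = d (a m^-1%g o) (a g (a m^-1%g o)).
    by rewrite -[RHS](isom_act_dist a m) -!isom_actM mulgV isom_act1 ?mulgA.
  have h1 := hK t t0; rewrite /= in h1.
  have h2 : d (a g (c t)) (a g (a m^-1%g o)) <= 2 * C.
    by rewrite isom_act_dist metric_sym.
  have := metric_triangle (a m^-1%g o) (c t) (a g (a m^-1%g o)).
  have := metric_triangle (c t) (a g (c t)) (a g (a m^-1%g o)).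
  by rewrite (metric_sym (c t) (a g (c t))); lra.
have /choice[cj hcj] := conj_const.
have [m hm] : exists m, forall s, S s -> (m * s * m^-1)%g = cj s.
  have [S_fin _ _] := S_gen; have /finite_seqP[l lE] := S_fin.
  have : U [set m | forall s, s \in l -> (m * s * m^-1)%g = cj s].
    elim: l {lE} => [|s l IH]; first exact: filterE.
    apply: filterS (filterI IH (hcj s)) => m /= [h1 h2] t.
    by rewrite inE => /orP[/eqP ->|]//; exact: h1.
  by move=> /filter_ex[m hm]; exists m => s; rewrite lE; exact: hm.
have fix_s s : S s -> act s (act m^-1%g xi) = act m^-1%g xi.
  move=> Ss.
  apply: (tends_unique (o := o) (U := U) (z := fun g => Inner (a (s * (m^-1 * g))%g o))).
    have h1 : tends o U (fun g => act_bordification a m^-1%g (Inner (a g o)))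
      (act m^-1%g xi) by exact: tends_act.
    have h2 : tends o U (fun g => act_bordification a s
      (act_bordification a m^-1%g (Inner (a g o)))) (act s (act m^-1%g xi)).
      exact: tends_act.
    by move=> e' e'0; apply: filterS (h2 _ e'0) => g /=; rewrite !isom_actM.
  have gs : tends o U (fun g => Inner (a (g * s)%g o)) xi by exact: tends_act_mulr.
  have h : tends o U (fun g => act_bordification a m^-1%g (Inner (a (g * s)%g o)))
    (act m^-1%g xi) by exact: tends_act.
  move=> e' e'0; apply: filterS (filterI (h _ e'0) (hcj s)) => g /= [h1 h2].
  suff -> : (s * (m^-1 * g) = m^-1 * (g * s))%g by rewrite isom_actM.
  have := hm s Ss; rewrite -h2 => E.
  apply: (mulgI m); rewrite !mulgA mulgV mul1g.
  by rewrite E -mulgA mulVg mulg1.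
have fix_m g : act g (act m^-1%g xi) = act m^-1%g xi.
  have [_ _ /(_ g)[n [l [_ lS ->]]]] := S_gen.
  elim: l lS => [|s l IH] lS; first by rewrite big_nil act_boundary1.
  rewrite big_cons act_boundaryM IH; first by apply: fix_s; apply: lS; rewrite inE eqxx.
  by move=> t tl; apply: lS; rewrite inE tl orbT.
have xi_m : act m^-1%g xi = xi.
  by rewrite -{1}(fix_m m) -act_boundaryM mulgV act_boundary1.
by move=> g; rewrite -xi_m.
Qed.

(** A fixed point at infinity would force all other limit points to be fixed as
    well; but a fixed point that is not the repelling point [z] of a divergent
    family is its attracting point [xi], and there are three limit points. *)
Lemma no_fixed_point zeta : exists g, act g zeta <> zeta.
Proof.
apply: contrapT => none.
have fix_zeta g : act g zeta = zeta by apply: contrapT => h; apply: none; exists g.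
have [xi [eta [Lxi Leta xe xz ez]]] := two_limit_points G_non_elementary zeta.
have fix_eta := fixed_propagates fix_zeta Leta ez.
have [U [UU Uxi]] := limit_ultrafilter Lxi.
have [z Uz] := isom_inverse_limit UU Uxi.
have [ezz|nezz] := pselect (eta = z).
  apply: xz; apply/esym/(attracted_fixed _ Uxi Uz fix_zeta).
  by rewrite -ezz; apply/nesym.
by apply: xe; apply/esym/(attracted_fixed _ Uxi Uz fix_eta).
Qed.

End NoFixedPoint.

(** * A free semigroup with large exponent *)

Section HeavySets.
Context {R : realType} {X : proper_CAT R} {G : groupType} (a : isom_group G X).
Context (o : X).
Local Notation d := (@mdist R X).
Context (orbit_fin : forall M, finite_set [set g | d o (a g o) <= M]).
Implicit Types (g h : G) (A B : set G) (l : seq G).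
Local Notation wsum s A := (\esum_(g in A) (expR (- s * d o (a g o)))%:E)%E.

Let w0 s : forall A g, A g -> (0 <= (expR (- s * d o (a g o)))%:E)%E.
Proof. by move=> A g _; rewrite lee_fin expR_ge0. Qed.

(** The complements of the sets over which the series converges form a filter.  The
    members of an ultrafilter above it carry the divergence of the series, and
    yet orbits converge along it. *)
Lemma heavy_ultrafilter s : poincare_series a o s = +oo%E ->
  exists U : set_system G, [/\ UltraFilter U,
    forall A, U A -> wsum s A = +oo%E & forall A, finite_set A -> U (~` A)].
Proof.
move=> Poo; pose F : set_system G := [set A | (wsum s (~` A) < +oo)%E].
have FF : ProperFilter F.
  split; last split.
  - by rewrite /F /= setC0 -/(poincare_series a o s) Poo.
  - by rewrite /F /= setCT esum_set0.
  - move=> A B; rewrite /F /= => FA FB; rewrite setCI.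
    rewrite (esumID (~` A)); last exact: w0.
    apply: lte_add_pinfty; first by apply: le_lt_trans FA; apply: le_esum_sub => g [].
    by apply: le_lt_trans FB; apply: le_esum_sub => g [[]].
  - move=> A B AB; rewrite /F /=; apply: le_lt_trans; apply: le_esum_sub.
    exact: subsetC.
have [U [UU FU]] := ultraFilterLemma FF.
exists U; split=> // A.
- move=> UA; apply: contrapT => /eqP; rewrite -ltey => Afin.
  have : U (~` A) by apply: FU; rewrite /F /= setCK.
  by move=> /(filterI UA); rewrite setICr => /filter_ex[].
- move=> Afin; apply: FU; rewrite /F /= setCK esum_fset//.
    by rewrite fsbig_finite//= sumEFin ltry.
Qed.

(** If the number of orbit points of [A] at distance about [n] from [o] were
    [O(expR (s * n))], then the series with the larger exponent [s'] would be
    dominated by a geometric one. *)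
Lemma heavy_annulus s s' A K : 0 <= s' -> s < s' -> 0 <= K -> wsum s' A = +oo%E ->
  exists (n : nat) l, [/\ uniq l, [set` l] `<=` A,
    forall g, g \in l -> n%:R <= d o (a g o) < n.+1%:R &
    K * expR (s * n%:R) < (size l)%:R].
Proof.
move=> s'0 ss' K0 Aoo; apply: contrapT => none.
have size_le (n : nat) l : uniq l -> [set` l] `<=` A ->
    (forall g, g \in l -> n%:R <= d o (a g o) < n.+1%:R) ->
    (size l)%:R <= K * expR (s * n%:R).
  by move=> lu lA ln; rewrite leNgt; apply/negP => h; apply: none; exists n, l.
pose rho := expR (s - s'); have rho1 : rho < 1 by rewrite -expR0 ltr_expR; lra.
have rho0 : 0 <= rho by exact: expR_ge0.
suff : (wsum s' A <= (K / (1 - rho))%:E)%E by rewrite Aoo leye_eq.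
apply: ge_ereal_sup => _ [F [Ffin FA] <-].
have [l lE] : exists l : seq G, uniq l /\ F = [set` l].
  have /finite_seqP[l lE] := Ffin; exists (undup l); rewrite undup_uniq; split=> //.
  by rewrite lE; apply/seteqP; split => g /=; rewrite mem_undup.
move: lE => [lu FE]; rewrite FE -fsbig_seq// sumEFin lee_fin.
pose idx g := Num.truncn (d o (a g o)).
have idxP g : (idx g)%:R <= d o (a g o) < (idx g).+1%:R by exact/truncn_itv/mdist_ge0.
pose M := (\max_(g <- l) idx g)%N.
have idxM g : g \in l -> (idx g < M.+1)%N by move=> gl; rewrite ltnS /M (leq_bigmax_seq g).
rewrite (partition_big (fun g => inord (idx g) : 'I_M.+1) xpredT)//=.
apply: (@le_trans _ _ (\sum_(j < M.+1) K * rho ^+ j)).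
  apply: ler_sum => j _; pose lj := [seq g <- l | inord (idx g) == j].
  have ljP g : g \in lj -> idx g = j :> nat /\ g \in l.
    rewrite mem_filter => /andP[/eqP <- gl]; split => //.
    by rewrite inordK// idxM.
  rewrite -big_filter -/lj.
  apply: (@le_trans _ _ (\sum_(g <- lj) expR (- s' * j%:R))).
    rewrite big_seq [leRHS]big_seq; apply: ler_sum => g /ljP[gj _].
    rewrite ler_expR !mulNr lerN2 ler_wpM2l//.
    by rewrite -gj; case/andP: (idxP g).
  rewrite big_const_seq count_predT iter_addr_0 -[leLHS]mulr_natl.
  have szj : (size lj)%:R <= K * expR (s * j%:R).
    apply: size_le; first exact: filter_uniq.
    - by move=> g /= /ljP[_ gl]; apply: FA; rewrite FE.
    - by move=> g /ljP[<- _]; exact: idxP.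
  apply: le_trans (ler_wpM2r (expR_ge0 _) szj) _.
  rewrite -mulrA -expRD -expRM_natr ler_wpM2l// ler_expR.
  by rewrite mulrBl mulNr.
rewrite -mulr_sumr ler_wpM2l//.
have sub : 0 < 1 - rho by rewrite subr_gt0.
rewrite -(ler_pM2l sub) divff ?gt_eqF//.
have := subrX1 rho M.+1; have := exprn_ge0 M.+1 rho0; lra.
Qed.

(** Greedy choice: each chosen element excludes at most [N] others. *)
Lemma separated_subseq (T : eqType) (close : rel T) (N : nat) (l : seq T) :
  reflexive close -> symmetric close -> uniq l ->
  (forall x, x \in l -> (count (close x) l <= N)%N) ->
  exists F, [/\ uniq F, {subset F <= l},
    forall x y, x \in F -> y \in F -> x != y -> ~~ close x y &
    (size l <= N * size F)%N].
Proof.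
move=> rfl sym; have [n] := ubnP (size l); elim: n l => // n IH [|x l] ln lu cl.
  by exists [::].
pose l' := [seq y <- x :: l | ~~ close x y].
have l'sub : {subset l' <= x :: l} by move=> y; rewrite mem_filter => /andP[].
have size_eq : (size (x :: l) = count (close x) (x :: l) + size l')%N.
  by rewrite size_filter count_predC.
have l'n : (size l' < n)%N.
  have : (0 < count (close x) (x :: l))%N by rewrite -has_count /= rfl.
  by rewrite /= in ln size_eq *; lia.
have [|y yl'|F [Fu Fl' Fsep Fsize]] := IH l' l'n.
- exact: filter_uniq.
- apply: leq_trans (cl y (l'sub y yl')).
  by rewrite count_filter; apply: sub_count => z /= /andP[].
exists (x :: F); split.
- rewrite /= Fu andbT; apply/negP => /Fl'; rewrite mem_filter rfl//.
- by move=> y; rewrite inE => /orP[/eqP ->|/Fl'/l'sub//]; rewrite inE eqxx.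
- have xF y : y \in F -> ~~ close x y by move=> /Fl'; rewrite mem_filter => /andP[].
  move=> y z; rewrite !inE => /orP[/eqP ->|yF] /orP[/eqP ->|zF]; rewrite ?eqxx//.
  + by move=> _; exact: xF.
  + by move=> _; rewrite sym; exact: xF.
  + exact: Fsep.
- have := cl x (mem_head _ _); rewrite size_eq /= mulnS => cx.
  by apply: leq_add.
Qed.

(** By homogeneity, the count at [a g o] is the count at [o]. *)
Lemma close_count (T : R) l g : uniq l ->
  (count (fun h => (d (a g o) (a h o) < T)%R) l <=
   #|` fset_set [set g' | (d o (a g' o) <= T)%R]|)%N.
Proof.
move=> lu; rewrite -size_filter -(size_map (fun h => g^-1 * h)%g).
apply: uniq_leq_size.
  by rewrite map_inj_uniq ?filter_uniq//; exact: mulgI.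
move=> k /mapP[h]; rewrite mem_filter => /andP[gh _] ->.
by rewrite in_fset_set// inE /= -isom_distV ltW.
Qed.

End HeavySets.

Section Letters.
Context {R : realType} {X : proper_CAT R} {G : groupType} (a : isom_group G X).
Context (S : set G) (S_gen : symmetric_generating_set S).
Context (o : X) (G_non_elementary : non_elementary a o).
Local Notation d := (@mdist R X).
Context (orbit_fin : forall M, finite_set [set g | d o (a g o) <= M]).
Local Notation act := (act_boundary a).
Implicit Types (g h : G).

(** Letters with a uniform transversality: the inverse of a letter and another
    letter point in directions that are at a definite distance, because the
    repelling point of the family has been moved off the attracting one. *)
Lemma transversal_family s : poincare_series a o s = +oo%E ->
  exists (k : G) (al : R), 0 < al /\ forall N, exists E : set G,
    [/\ (\esum_(g in E) (expR (- s * d o (a g o)))%:E = +oo)%E,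
        forall g, E g -> N <= d o (a g o) &
        forall g g', E g -> E g' ->
          al <= exp_gp o (a (k * g^-1)%g o) (a (g' * k^-1)%g o)].
Proof.
move=> Poo; have [U [UU Uheavy Ufin]] := heavy_ultrafilter Poo.
have Uoo M : U [set g | M <= d o (a g o)].
  apply: filterS (Ufin _ (orbit_fin M)) => g /= /negP.
  by rewrite -ltNge => /ltW.
have [zp Uzp] := rb_ultralimit UU Uoo.
have [zm Uzm] := isom_inverse_limit UU Uzp.
have [k kz] : exists k, act k zm <> zp.
  have [E|] := pselect (zm = zp); last by exists 1%g; rewrite act_boundary1.
  have [k hk] := no_fixed_point S_gen G_non_elementary orbit_fin zm.
  by exists k; rewrite -E.
set c := rb o (Bdry (act k zm)) (Bdry zp).
have c0 : 0 < c.
  by rewrite lt_neqAle rb_ge0 andbT eq_sym; apply/eqP => /rb_eq0/kz.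
have c4 : 0 < c / 4 by exact: divr_gt0.
exists k, (c / 2); split; first exact: divr_gt0.
move=> N.
have h1 : tends o U (fun g => act_bordification a k (Inner (a g^-1%g o))) (act k zm).
  exact: tends_act.
have h2 : tends o U (fun g => Inner (a (g * k^-1)%g o)) zp by exact: tends_act_mulr.
exists ([set g | rb o (act_bordification a k (Inner (a g^-1%g o)))
                   (Bdry (act k zm)) < c / 4] `&`
        [set g | rb o (Inner (a (g * k^-1)%g o)) (Bdry zp) < c / 4] `&`
        [set g | N <= d o (a g o)]).
split.
- by apply: Uheavy; apply: filterI (Uoo N); exact: filterI (h1 _ c4) (h2 _ c4).
- by move=> g [_].
- move=> g g' [[/= g1 _] _] [[_ /= g2] _]; rewrite -rb_inner isom_actM.
  have := rb_triangle o (Bdry (act k zm)) (Inner (a k (a g^-1%g o))) (Bdry zp).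
  have := rb_triangle o (Inner (a k (a g^-1%g o))) (Inner (a (g' * k^-1)%g o)) (Bdry zp).
  by rewrite -/c (rb_sym o (Bdry (act k zm))); lra.
Qed.

(** Let the elements of an annulus of radius about [l] carry [expR (s * l)] points
    or more, up to a large factor.  Thinning them out to a [T]-separated set costs a
    bounded factor, so the sum of the [expR (- s * d o (a h o))] can still exceed
    [1]; and the Gromov products of points of an annulus of bounded width that are
    [T] apart are at most [l - T / 2], up to a constant. *)
Lemma schottky_letters s s' : 0 <= s -> s < s' -> poincare_series a o s' = +oo%E ->
  exists al ka : R, 0 < al /\ forall T N, 0 < T -> exists (H : seq G) (l : R),
    [/\ N <= l, uniq H,
        forall h, h \in H -> l <= d o (a h o),
        forall h h', h \in H -> h' \in H -> al <= exp_gp o (a h^-1%g o) (a h' o) &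
        (forall h h', h \in H -> h' \in H -> h != h' ->
           gromov_product o (a h o) (a h' o) <= l + ka - T / 2) /\
        1 <= \sum_(h <- H) expR (- s * d o (a h o))].
Proof.
move=> s0 ss' Poo; have [k [al [al0 hE]]] := transversal_family Poo.
pose ka := d o (a k^-1%g o).
have letter_dist g : `|d o (a (g * k^-1)%g o) - d o (a g o)| <= ka.
  have := metric_triangle o (a g o) (a (g * k^-1)%g o).
  have := metric_triangle o (a (g * k^-1)%g o) (a g o).
  rewrite isom_actM (metric_sym (a g (a _ o))) isom_act_dist -/ka ler_norml.
  by move=> *; apply/andP; split; lra.
exists al, (1 + 3 * ka); split=> // T N T0.
have [E [Eoo EN Eal]] := hE (N + ka + 1).
pose NT := #|` fset_set [set g | d o (a g o) <= T]|.
have s'0 : 0 <= s' by exact: le_trans (ltW ss').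
have K0 : 0 <= NT%:R * expR (s * (1 + ka)) by rewrite mulr_ge0// expR_ge0.
have [n [l [lu lE ln lsize]]] := heavy_annulus s'0 ss' K0 Eoo.
pose close g h := d (a g o) (a h o) < T.
have [||||F [Fu Fl Fsep Fsize]] := @separated_subseq G close NT l.
- by move=> g; rewrite /close mdistxx.
- by move=> g h; rewrite /close metric_sym.
- by [].
- by move=> g gl; exact: close_count.
have F0 : (0 < size l)%N.
  by rewrite -(@ltr_nat R); apply: le_lt_trans lsize; rewrite mulr_ge0// expR_ge0.
have lN : N <= n%:R - ka.
  have /mem_nth xl := F0; have /andP[_ h] := ln _ (xl 1%g).
  by have := EN _ (lE _ (xl 1%g)); rewrite -natr1 in h; lra.
exists [seq (g * k^-1)%g | g <- F], (n%:R - ka); split => //.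
- by rewrite map_inj_uniq//; exact: mulIg.
- move=> _ /mapP[g /Fl gl ->]; have /andP[h _] := ln g gl.
  by have := letter_dist g; rewrite ler_norml => /andP[]; lra.
- move=> _ _ /mapP[g /Fl gl ->] /mapP[g' /Fl gl' ->].
  by rewrite invgM invgK; apply: Eal; exact: lE.
split.
- move=> _ _ /mapP[g gF ->] /mapP[g' gF' ->] gg'.
  have {}gg' : g != g' by apply: contraNneq gg' => ->.
  have := Fsep g g' gF gF' gg'; rewrite /close -leNgt => dT.
  have /andP[_ h] := ln g (Fl _ gF); have /andP[_ h'] := ln g' (Fl _ gF').
  have := letter_dist g; have := letter_dist g'.
  rewrite !ler_norml => /andP[_ h1] /andP[_ h2].
  have dk g1 : d (a g1 o) (a (g1 * k^-1)%g o) = ka by rewrite isom_actM isom_act_dist.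
  have := metric_triangle (a g o) (a (g * k^-1)%g o) (a g' o).
  have := metric_triangle (a (g * k^-1)%g o) (a (g' * k^-1)%g o) (a g' o).
  rewrite -natr1 in h; rewrite -natr1 in h'.
  rewrite dk (metric_sym (a (g' * _)%g o) (a g' o)) dk /gromov_product.
  by lra.
- rewrite big_map; apply: (@le_trans _ _ (\sum_(g <- F) expR (- s * (n%:R + 1 + ka)))).
    rewrite big_const_seq count_predT iter_addr_0 -[leRHS]mulr_natl.
    have NT0 : 0 < NT%:R :> R.
      by rewrite ltr0n; case: (NT) Fsize => // ; rewrite mul0n leqNgt F0.
    have e0 := expR_gt0 (- s * (n%:R + 1 + ka)).
    rewrite mulNr expRN ler_pdivlMr ?expR_gt0// mul1r.
    rewrite -(ler_pM2l NT0) -natrM; apply: (@le_trans _ _ (size l)%:R).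
      apply: le_trans (ltW lsize); rewrite -mulrA -expRD.
      by rewrite le_eqVlt; apply/orP; left; apply/eqP; congr (_ * expR _); ring.
    by rewrite ler_nat.
  rewrite big_seq [leRHS]big_seq; apply: ler_sum => g gF.
  have /andP[_ h] := ln g (Fl _ gF); have := letter_dist g.
  rewrite ler_norml => /andP[_ h1]; rewrite ler_expR !mulNr lerN2 ler_wpM2l//.
  by rewrite -natr1 in h; lra.
Qed.

End Letters.

Section Words.
Context {R : realType} {X : proper_CAT R} {G : groupType} (a : isom_group G X).
Context (o : X).
Local Notation d := (@mdist R X).
Implicit Types (g h : G) (u v w : seq G).

Definition word_point w : X := a (\prod_(h <- w) h)%g o.
Local Notation pt := word_point.

Lemma word_point_cons h w : pt (h :: w) = a h (pt w).
Proof. by rewrite /pt big_cons isom_actM. Qed.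

Lemma word_point_cat u v : pt (u ++ v) = a (\prod_(h <- u) h)%g (pt v).
Proof. by rewrite /pt big_cat isom_actM. Qed.

Lemma exp_gp_act g x y :
  expR (- d o (a g o)) * exp_gp o x y <= exp_gp o (a g x) (a g y).
Proof.
rewrite expRN ler_pdivrMl ?expR_gt0//.
have := exp_gp_origin (a g o) o (a g x) (a g y); rewrite metric_sym.
by rewrite {1}/exp_gp /gromov_product !isom_act_dist.
Qed.

Lemma exp_gp_compl h x :
  exp_gp o (a h x) (a h o) * exp_gp o (a h^-1%g o) x = expR (- d o (a h o)).
Proof.
rewrite /exp_gp -expRD; congr expR; rewrite /gromov_product isom_dist1 isom_act_dist.
rewrite -(isom_act_dist a h (a h^-1%g o)) -isom_actM mulgV isom_act1.
by rewrite (metric_sym x o); field.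
Qed.

Section Letters.
Context (H : seq G) (l m al : R).
Hypothesis al_gt0 : 0 < al.
Hypothesis H_long : forall h, h \in H -> l <= d o (a h o).
Hypothesis H_transversal :
  forall h h', h \in H -> h' \in H -> al <= exp_gp o (a h^-1%g o) (a h' o).
Hypothesis H_apart : forall h h', h \in H -> h' \in H -> h != h' ->
  gromov_product o (a h o) (a h' o) <= m.
Hypothesis l_large : expR (1 - l) <= (al / 2) ^+ 2.
Hypothesis m_small : 4 * expR (m - l) <= al / 2.

Let al2 : 0 < al / 2. Proof. exact: divr_gt0. Qed.

Let letter_small h x : h \in H -> al / 2 <= exp_gp o (a h^-1%g o) x ->
  exp_gp o (a h x) (a h o) <= expR (- l) / (al / 2).
Proof.
move=> hH hx; rewrite ler_pdivlMr//.
apply: (@le_trans _ _ (expR (- d o (a h o)))); last by rewrite ler_expR lerN2 H_long.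
by rewrite -(exp_gp_compl h x) ler_wpM2l// exp_gp_ge0.
Qed.

(** Seen from [o], a word ends almost in the direction of its first letter, because
    letters are long and are transversal to the inverses of letters. *)
Lemma word_transversal h w : h \in H -> {subset w <= H} ->
  al / 2 <= exp_gp o (a h^-1%g o) (pt w).
Proof.
elim: w h => [|h1 w IH] h hH wH.
  have -> : exp_gp o (a h^-1%g o) (pt [::]) = 1.
    rewrite /pt big_nil isom_act1 /exp_gp /gromov_product mdistxx.
    by rewrite metric_sym addr0 subrr mul0r oppr0 expR0.
  have := H_transversal hH hH.
  have : exp_gp o (a h^-1%g o) (a h o) <= 1.
    by rewrite -expR0 ler_expR oppr_le0 gromov_product_ge0.
  lra.
have h1H : h1 \in H by apply: wH; rewrite inE eqxx.
have {}IH : al / 2 <= exp_gp o (a h1^-1%g o) (pt w).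
  by apply: IH => // k kw; apply: wH; rewrite inE kw orbT.
have := exp_gp_triangle o (a h^-1%g o) (pt (h1 :: w)) (a h1 o).
have := H_transversal hH h1H; rewrite word_point_cons.
have := letter_small h1H IH.
have : expR (- l) / (al / 2) <= al / 2.
  rewrite ler_pdivrMr// -expr2; apply: le_trans l_large.
  by rewrite ler_expR; lra.
lra.
Qed.

Lemma word_point_size w : {subset w <= H} -> (size w)%:R <= d o (pt w).
Proof.
elim: w => [|h w IH] wH; first exact: mdist_ge0.
have hH : h \in H by apply: wH; rewrite inE eqxx.
have wH' : {subset w <= H} by move=> k kw; apply: wH; rewrite inE kw orbT.
have tr := word_transversal hH wH'.
have gpE : 2 * gromov_product o (a h^-1%g o) (pt w) =
    d o (a h o) + d o (pt w) - d o (pt (h :: w)).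
  rewrite /gromov_product isom_dist1 word_point_cons.
  rewrite -(isom_act_dist a h (a h^-1%g o)) -isom_actM mulgV isom_act1.
  by field.
have : 2 * gromov_product o (a h^-1%g o) (pt w) <= l - 1.
  rewrite -lerN2 -ler_expR opprB.
  apply: le_trans l_large _; apply: (@le_trans _ _ (exp_gp o (a h^-1%g o) (pt w) ^+ 2)).
    by rewrite ler_pXn2r// ?nnegrE ?exp_gp_ge0// ltW.
  by rewrite -expRM_natl mulrN.
have := H_long hH; have := IH wH'; rewrite /= -natr1; lra.
Qed.

(** Seen from [pt u], the two words end almost in the directions of [h] and [h'],
    which [H_apart] keeps apart. *)
Lemma word_branch u h h' w w' : {subset u ++ h :: w <= H} ->
  {subset u ++ h' :: w' <= H} -> h != h' ->
  expR (- m) / 2 * expR (- d o (pt u)) <=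
  exp_gp o (pt (u ++ h :: w)) (pt (u ++ h' :: w')).
Proof.
move=> uw uw' hh'; rewrite !word_point_cat mulrC.
apply: le_trans (exp_gp_act _ _ _); rewrite ler_wpM2l ?expR_ge0//.
have step k v : {subset u ++ k :: v <= H} ->
    k \in H /\ exp_gp o (pt (k :: v)) (a k o) <= expR (- m) / 4.
  move=> uv; have kH : k \in H by apply: uv; rewrite mem_cat inE eqxx orbT.
  have vH : {subset v <= H} by move=> g gv; apply: uv; rewrite mem_cat inE gv !orbT.
  split=> //; rewrite word_point_cons.
  apply: le_trans (letter_small kH (word_transversal kH vH)) _.
  rewrite ler_pdivrMr// ; have := m_small; rewrite -(ler_pM2l (expR_gt0 (- m))).
  rewrite mulrCA -expRD; have -> : - m + (m - l) = - l by ring.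
  by lra.
have [hH s1] := step _ _ uw; have [h'H s2] := step _ _ uw'.
have : expR (- m) <= exp_gp o (a h o) (a h' o) by rewrite ler_expR lerN2 H_apart.
have := exp_gp_triangle o (a h o) (pt (h :: w)) (a h' o).
have := exp_gp_triangle o (pt (h :: w)) (pt (h' :: w')) (a h' o).
by rewrite (exp_gp_sym o (a h o) (pt (h :: w))); lra.
Qed.

End Letters.
End Words.

(** * Infinite words and Hausdorff measure *)

Section Prefixes.
Context {R : realType} {T : choiceType} (H : seq T) (wt : seq T -> R).
Hypothesis H_uniq : uniq H.
Hypothesis wt_ge0 : forall u, 0 <= wt u.
Hypothesis wt_children : forall u, {subset u <= H} ->
  wt u <= \sum_(h <- H) wt (rcons u h).

(** Walking down the tree of words: if the chosen words below [u] weigh less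
    than [u], the same holds for some child of [u], since the children of [u]
    weigh at least as much as [u] together. A walk of this kind avoids all the
    chosen words. *)
Lemma avoid_words (c : nat -> seq T) :
  (\sum_(0 <= i <oo) (wt (c i))%:E < (wt [::])%:E)%E ->
  exists2 sg : nat -> T, forall n, sg n \in H & forall i n, c i <> mkseq sg n.
Proof.
move=> small.
pose below u : set nat := [set i | prefix u (c i)].
pose load u := (\esum_(i in below u) (wt (c i))%:E)%E.
have wtE0 i : (0 <= (wt (c i))%:E)%E by rewrite lee_fin.
pose ok u := {subset u <= H} /\ (load u < (wt u)%:E)%E.
have children u : (\sum_(h <- H) load (rcons u h) <= load u)%E.
  rewrite /load; under eq_bigr do rewrite esum_mkcond.
  rewrite -esum_sum; last by move=> i h _ _; case: ifP.
  rewrite [leRHS]esum_mkcond; apply: le_esum => i _.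
  have [[h hH hi]|none] := pselect (exists2 h, h \in H & prefix (rcons u h) (c i)).
    rewrite (bigD1_seq h)//= [X in (_ + X)%E]big1 => [|h' h'h].
      rewrite adde0 !mem_set//=.
      by apply: prefix_trans hi; rewrite prefix_rcons.
    rewrite memNset//= => h'i; move/eqP: h'h; apply.
    move: h'i hi; rewrite /below /= !prefixE !size_rcons => /eqP -> /eqP.
    by move=> /rcons_inj[].
  rewrite big_seq big1 => [|h hH]; first by case: ifP.
  by rewrite memNset// => hi; apply: none; exists h.
have step u : ok u -> exists h, ok (rcons u h).
  move=> [uH ul]; apply: contrapT => none.
  have : ((wt u)%:E <= load u)%E.
    apply: le_trans (children u); apply: (@le_trans _ _ (\sum_(h <- H) wt (rcons u h))%:E).
      by rewrite lee_fin wt_children.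
    rewrite -sumEFin big_seq [leRHS]big_seq; apply: lee_sum => h hH.
    rewrite leNgt; apply/negP => hl; apply: none; exists h; split=> // k.
    by rewrite mem_rcons inE => /orP[/eqP ->|/uH].
  by rewrite leNgt ul.
have ok0 : ok [::].
  split=> //; apply: le_lt_trans small.
  by rewrite nneseries_esumT//; apply: le_esum_sub.
have [next hnext] : exists next, forall u, ok u -> ok (rcons u (next u)).
  have : forall u, exists h, ok u -> ok (rcons u h).
    move=> u; have [/step[h hh]|nok] := pselect (ok u); first by exists h.
    have [h _] := step _ ok0; by exists h.
  by move=> /choice[next hn]; exists next.
pose word := fix word n := if n is m.+1 then rcons (word m) (next (word m)) else [::].
have word_ok n : ok (word n) by elim: n => //= n; exact: hnext.
pose sg n := next (word n).
have wordE n : word n = mkseq sg n.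
  by elim: n => // n IH; rewrite mkseqS -IH.
exists sg => [n|i n].
  by have [+ _] := word_ok n.+1; apply; rewrite /= mem_rcons inE eqxx.
move=> ci; have [_] := word_ok n; rewrite wordE -ci ltNge => /negP; apply.
have -> : (wt (c i))%:E = (\esum_(j in [set i]) (wt (c j))%:E)%E by rewrite esum_set1.
by apply: le_esum_sub => _ ->; exact: prefix_refl.
Qed.

End Prefixes.

Section Coding.
Context {R : realType} {X : proper_CAT R} {G : groupType} (a : isom_group G X).
Context (o : X).
Local Notation d := (@mdist R X).
Local Notation pt := (word_point a o).
Context (H : seq G) (s eta : R).
Hypothesis s_gt0 : 0 < s.
Hypothesis eta_gt0 : 0 < eta.
Hypothesis H_uniq : uniq H.
Hypothesis H_size : forall w, {subset w <= H} -> (size w)%:R <= d o (pt w).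
Hypothesis H_branch : forall u h h' w w', {subset u ++ h :: w <= H} ->
  {subset u ++ h' :: w' <= H} -> h != h' ->
  eta * expR (- d o (pt u)) <= exp_gp o (pt (u ++ h :: w)) (pt (u ++ h' :: w')).
Hypothesis H_heavy : 1 <= \sum_(h <- H) expR (- s * d o (a h o)).
Implicit Types (u w : seq G) (sg tau : nat -> G).

Let wgt u := expR (- s * d o (pt u)).
Let letters sg := forall n, sg n \in H.

Let mkseq_letters n sg : letters sg -> {subset mkseq sg n <= H}.
Proof. by move=> sgH _ /mapP[i _ ->]. Qed.

Let mkseq_split sg n N : (n < N)%N ->
  mkseq sg N = mkseq sg n ++ sg n :: map sg (iota n.+1 (N - n.+1)).
Proof.
move=> nN; rewrite -[RHS]/(map sg (iota 0 n) ++ map sg (iota (0 + n) (N - n.+1).+1)).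
by rewrite -map_cat -iotaD /mkseq; congr (map sg (iota 0 _)); lia.
Qed.

Let first_difference sg tau n : mkseq sg n <> mkseq tau n ->
  exists2 m, (m < n)%N & mkseq sg m = mkseq tau m /\ sg m <> tau m.
Proof.
elim: n => // n IH; rewrite !mkseqS => neq.
have [E|/IH[m mn hm]] := pselect (mkseq sg n = mkseq tau n).
  by exists n => //; split=> // En; apply: neq; rewrite E En.
by exists m => //; exact: ltnW.
Qed.

Let constant_letters : exists sg, letters sg.
Proof.
have [E|[h hH]] : H = [::] \/ exists h, h \in H.
- by case: (H) => [|h l]; [left | right; exists h; exact: mem_head].
- by move: H_heavy; rewrite E big_nil; lra.
- by exists (fun=> h) => n.
Qed.

Let word_small e : 0 < e -> exists n, forall w, {subset w <= H} ->
  (n <= size w)%N -> wgt w <= e.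
Proof.
move=> e0; have [T _ hT] := expR_le_eps 0 e0.
exists (Num.truncn `|T / s|).+1 => w wH nw; apply/ltW.
rewrite -[wgt w]/(expR (- s * d o (pt w))) mulNr -sub0r; apply: hT.
rewrite mulrC -ler_pdivrMr//; apply: le_trans (ler_norm _) _.
apply: le_trans (ltW (truncnS_gt _)) _; apply: le_trans (H_size wH).
by rewrite ler_nat.
Qed.

Let wgt_children u : {subset u <= H} -> wgt u <= \sum_(h <- H) wgt (rcons u h).
Proof.
move=> uH; apply: (@le_trans _ _ (wgt u * \sum_(h <- H) expR (- s * d o (a h o)))).
  by rewrite ler_peMr// expR_ge0.
rewrite mulr_sumr; apply: ler_sum => h _; rewrite /wgt -expRD ler_expR -mulrDr.
rewrite !mulNr lerN2 ler_pM2l// -cats1 word_point_cat /word_point big_seq1.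
by rewrite -isom_actM; exact: isom_distM.
Qed.

(** The points of the initial parts of an infinite word go to infinity.  Limits along
    one ultrafilter on [nat], the same for all words, suffice to carry over
    [H_branch]. *)
Lemma coding : exists x : (nat -> G) -> boundary X,
  (forall sg, letters sg -> limit_set a o (x sg)) /\
  forall sg tau n, letters sg -> letters tau ->
    mkseq sg n = mkseq tau n -> sg n <> tau n ->
    eta * expR (- d o (pt (mkseq sg n))) <= rb o (Bdry (x sg)) (Bdry (x tau)).
Proof.
have [U [UU Uoo]] := nat_ultrafilter.
have lim sg : letters sg ->
    exists xi, tends o U (fun n => Inner (pt (mkseq sg n))) xi.
  move=> sgH; apply: rb_ultralimit => M; apply: filterS (ultra_nat_ge UU Uoo M).
  move=> n /= /le_trans; apply; have := H_size (@mkseq_letters n sg sgH).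
  by rewrite size_mkseq.
have /choice[x hx] : forall sg, exists xi,
    letters sg -> tends o U (fun n => Inner (pt (mkseq sg n))) xi.
  move=> sg; have [/lim[xi h]|nsg] := pselect (letters sg); first by exists xi.
  by have [sg0 /lim[xi _]] := constant_letters; exists xi.
exists x; split => [sg sgH|sg tau n sgH tauH E neq].
  by apply: (tends_limit (F := U)); exact: hx.
apply/ler_addgt0Pr => e e0; have e2 : 0 < e / 2 by exact: divr_gt0.
have [N [h1 h2 nN]] : exists N : nat,
    [/\ rb o (Inner (pt (mkseq sg N))) (Bdry (x sg)) < e / 2,
        rb o (Inner (pt (mkseq tau N))) (Bdry (x tau)) < e / 2 & (n < N)%N].
  have U1 := hx _ sgH _ e2; have U2 := hx _ tauH _ e2.
  have U3 := ultra_nat_ge UU Uoo (n.+1%:R : R).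
  have [N [[/= h1 h2] /=]] := filter_ex (filterI (filterI U1 U2) U3).
  by rewrite ler_nat => nN; exists N.
have sgE := mkseq_split sg nN; have tauE := mkseq_split tau nN.
have neq' : sg n != tau n by exact/eqP.
have := @mkseq_letters N _ tauH; have := @mkseq_letters N _ sgH.
rewrite sgE tauE -E => sub1 sub2; have := H_branch sub1 sub2 neq'.
rewrite {3}E -sgE -tauE -rb_inner.
have := rb_triangle o (Inner (pt (mkseq sg N))) (Bdry (x sg)) (Inner (pt (mkseq tau N))).
have := rb_triangle o (Bdry (x sg)) (Bdry (x tau)) (Inner (pt (mkseq tau N))).
by rewrite (rb_sym o (Bdry (x tau))); lra.
Qed.

Section Cover.
Context (x : (nat -> G) -> boundary X).
Hypothesis x_apart : forall sg tau n, letters sg -> letters tau ->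
    mkseq sg n = mkseq tau n -> sg n <> tau n ->
    eta * expR (- d o (pt (mkseq sg n))) <= rb o (Bdry (x sg)) (Bdry (x tau)).

(** The word [u] is the longest one with which all the infinite words that have
    their limit point in [V] begin; where two of them part, [x_apart] bounds the
    weight of [u] by the diameter of [V].  If there is at most one such infinite word, a long
    initial part of it weighs less than [e]. *)
Lemma cover_word q e (V : set (boundary X)) : 0 <= q <= s -> 0 < e ->
  (diam (bourdon o) V <= 1%:E)%E ->
  exists u, (forall sg, letters sg -> V (x sg) -> exists n, u = mkseq sg n) /\
    ((wgt u)%:E <= ((powR eta s)^-1)%:E * hausdorff_gauge (bourdon o) q V + e%:E)%E.
Proof.
move=> /andP[q0 qs] e0 V1.
have eta_s : 0 < powR eta s by exact: powR_gt0.
have g0 : (0 <= ((powR eta s)^-1)%:E * hausdorff_gauge (bourdon o) q V)%E.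
  by rewrite mule_ge0 ?hausdorff_gauge_ge0// lee_fin invr_ge0 ltW.
pose part n := `[< exists sg tau, [/\ letters sg, letters tau, V (x sg), V (x tau)
  & mkseq sg n = mkseq tau n /\ sg n <> tau n] >].
have [[n partn]|none] := pselect (exists n, part n); last first.
  have [sg0 [sg0H hsg0]] : exists sg0, letters sg0 /\
      forall sg, letters sg -> V (x sg) -> V (x sg0).
    have [[sg [sgH sgV]]|none'] := pselect (exists sg, letters sg /\ V (x sg)).
      by exists sg.
    have [sg sgH] := constant_letters; exists sg; split=> // tau tauH tauV.
    by exfalso; apply: none'; exists tau.
  have [n hn] := word_small e0; exists (mkseq sg0 n); split.
    move=> sg sgH sgV; exists n; apply: contrapT => /first_difference[m _ hm].
    apply: none; exists m; apply/asboolP; exists sg0, sg; split=> //.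
    exact: hsg0 sgV.
  apply: (@le_trans _ _ e%:E); last by rewrite leeDr.
  by rewrite lee_fin hn ?size_mkseq//; exact: mkseq_letters.
have := ex_minnP (ex_intro _ n partn); case: ex_minnP => {partn}n.
move=> /asboolP[sg [tau [sgH tauH sgV tauV [E neq]]]] n_min _.
exists (mkseq sg n); split.
  move=> rh rhH rhV; exists n; apply: contrapT => /first_difference[m mn hm].
  have : part m by apply/asboolP; exists sg, rh.
  by move=> /n_min; rewrite leqNgt mn.
apply: (@le_trans _ _ (((powR eta s)^-1)%:E * hausdorff_gauge (bourdon o) q V)%E); last first.
  by rewrite leeDl// lee_fin ltW.
rewrite /hausdorff_gauge ifF; last by apply/eqP => V0; move: sgV; rewrite V0.
have dV : (diam (bourdon o) V = (fine (diam (bourdon o) V))%:E)%E.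
  by rewrite fineK// ge0_fin_numE ?diam_ge0// (le_lt_trans V1)// ltry.
have sep : eta * expR (- d o (pt (mkseq sg n))) <= fine (diam (bourdon o) V).
  apply: le_trans (x_apart sgH tauH E neq) _; rewrite -lee_fin -dV -bourdonE.
  by apply: ereal_sup_ubound; right; exists (x sg), (x tau).
move: sep V1; rewrite dV; set D := fine _ => sep; rewrite lee_fin => D1.
have D0 : 0 < D by apply: lt_le_trans sep; rewrite mulr_gt0// expR_gt0.
rewrite poweR_EFin -EFinM lee_fin ler_pdivlMl//.
apply: (@le_trans _ _ (powR D s)); last by apply: ger_powR => //; rewrite D0 D1.
rewrite /wgt mulNr -mulrN -powR_expR -powRM ?expR_ge0// ?(ltW eta_gt0)//.
by apply: ge0_ler_powR; rewrite ?nnegrE ?mulr_ge0 ?expR_ge0// ltW.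
Qed.

End Cover.

(** A cover with small gauges would, by [cover_word], give words of total weight less
    than [1], one for each set; by [avoid_words] the limit point of some infinite
    word would not be covered. *)
Lemma hausdorff_measure_neq0 q : 0 <= q <= s ->
  hausdorff_measure (bourdon o) q (limit_set a o) <> 0%E.
Proof.
move=> qs H0.
have [x [xL x_apart]] := coding.
have eta_s : 0 < powR eta s by exact: powR_gt0.
have : (hausdorff_premeasure (bourdon o) q 1 (limit_set a o) < (powR eta s / 4)%:E)%E.
  apply: (@le_lt_trans _ _ 0%E); last by rewrite lte_fin divr_gt0.
  by rewrite -H0; apply: ereal_sup_ubound; exists (1 : R) => //=; exact: ltr01.
move=> /ereal_inf_lt[_ [V [cov V1] <-]] small.
have /choice[c hc] : forall i, exists u,
    (forall sg, letters sg -> V i (x sg) -> exists n, u = mkseq sg n) /\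
    ((wgt u)%:E <= ((powR eta s)^-1)%:E * hausdorff_gauge (bourdon o) q (V i)
      + (2^-1 / (2 ^ i.+1)%:R)%:E)%E.
  by move=> i; apply: (cover_word x_apart).
have wgt0 u : 0 <= wgt u by exact: expR_ge0.
have [|sg sgH avoid] := avoid_words H_uniq wgt0 wgt_children (c := c).
  have -> : wgt [::] = 1 by rewrite /wgt /word_point big_nil isom_act1 mdistxx mulr0 expR0.
  have K0 : 0 <= (powR eta s)^-1 by rewrite invr_ge0 ltW.
  have term0 i : (0 <= ((powR eta s)^-1)%:E * hausdorff_gauge (bourdon o) q (V i))%E.
    by rewrite mule_ge0// hausdorff_gauge_ge0.
  apply: (@le_lt_trans _ _ (((powR eta s)^-1)%:E *
      (\sum_(0 <= i <oo) hausdorff_gauge (bourdon o) q (V i)) + 2^-1%:E)%E).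
    rewrite -nneseriesZl => [|i _]; last exact: hausdorff_gauge_ge0.
    apply: le_trans (epsilon_trick _ term0 _); last by rewrite invr_ge0.
    apply: lee_nneseries => i *; [by rewrite lee_fin | exact: (hc i).2].
  move: small; set sum := (\sum_(0 <= i <oo) _)%E => small.
  have [r sumE] : exists r, sum = r%:E.
    exists (fine sum); rewrite fineK// ge0_fin_numE; first exact: lt_trans small (ltry _).
    by apply: nneseries_ge0 => i _ _; exact: hausdorff_gauge_ge0.
  move: small; rewrite sumE -EFinM -EFinD !lte_fin -ltr_pdivrMl// => small.
  lra.
have [i _ Vi] := cov _ (xL _ sgH).
by have [/(_ sg sgH Vi)[n] /avoid] := hc i.
Qed.

End Coding.

(** * The dimension of the limit set *)

Section Dimension.
Context {R : realType} {X : proper_CAT R} {G : groupType} (a : isom_group G X).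
Context (S : set G) (S_gen : symmetric_generating_set S).
Context (o : X) (G_non_elementary : non_elementary a o).
Local Notation d := (@mdist R X).

(** Below the critical exponent, the limit set contains the limit points of a
    free semigroup of isometries whose own exponent is larger than [q]. *)
Lemma critical_exponent_le q : (forall M, finite_set [set g | d o (a g o) <= M]) ->
  0 <= q -> hausdorff_measure (bourdon o) q (limit_set a o) = 0%E ->
  (critical_exponent a o <= q%:E)%E.
Proof.
move=> orbit_fin q0 Hq; rewrite leNgt; apply/negP => qcrit.
have [s' qs' Ps'] : exists2 s', q < s' & poincare_series a o s' = +oo%E.
  have [s' qs' s'crit] : exists2 s', q < s' & (s'%:E < critical_exponent a o)%E.
    move: qcrit; case: (critical_exponent a o) => [r| |]//.
      rewrite lte_fin => qr; exists ((q + r) / 2); rewrite ?lte_fin; lra.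
    by move=> _; exists (q + 1); rewrite ?ltry// ltrDl.
  exists s' => //; apply: contrapT => /eqP; rewrite -ltey => Pfin.
  move: s'crit; rewrite ltNge => /negP; apply; apply: ereal_inf_lbound.
  by exists s' => //; split => //; exact: le_lt_trans qs'.
pose s := (q + s') / 2; have s0 : 0 < s by rewrite /s; lra.
have ss' : s < s' by rewrite /s; lra.
have [al [ka [al0 hH]]] :=
  schottky_letters S_gen G_non_elementary orbit_fin (ltW s0) ss' Ps'.
have al2 : 0 < (al / 2) ^+ 2 by rewrite exprn_gt0// divr_gt0.
have al8 : 0 < al / 8 by exact: divr_gt0.
have [N _ hN] := expR_le_eps 1 al2.
have [T T0 hT] := expR_le_eps ka al8.
have [|H [l [Nl Hu Hlong Htrans [Hapart Hheavy]]]] := hH (2 * (T + 1)) N.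
  by lra.
pose m := l + ka - 2 * (T + 1) / 2.
have l_large : expR (1 - l) <= (al / 2) ^+ 2 by exact/ltW/hN.
have m_small : 4 * expR (m - l) <= al / 2.
  have -> : m - l = ka - (T + 1) by rewrite /m; field.
  have := hT (T + 1) ltac:(lra); lra.
have Hsize := word_point_size al0 Hlong Htrans l_large.
have Hbranch := word_branch al0 Hlong Htrans Hapart l_large m_small.
have eta0 : 0 < expR (- m) / 2 by rewrite divr_gt0 ?expR_gt0.
apply: (hausdorff_measure_neq0 s0 eta0 Hu Hsize Hbranch Hheavy _ Hq).
by rewrite q0 /s; lra.
Qed.

Lemma hausdorff_dim_limit_set : (critical_exponent a o < 1%:E)%E ->
  hausdorff_dim (bourdon o) (limit_set a o) = critical_exponent a o.
Proof.
move=> crit1; have [_ [s [s0 Ps] <-] s1] := ereal_inf_lt crit1.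
have orbit_fin := orbit_finite s0 Ps.
have le_dim q : 0 < q <= 1 -> (poincare_series a o q < +oo)%E ->
    (hausdorff_dim (bourdon o) (limit_set a o) <= q%:E)%E.
  move=> q01 Pq; apply: ereal_inf_lbound; exists q => //.
  split; first by case/andP: q01 => /ltW.
  have [Pi Pi_lim] := end_limit_exists S_gen q01 Pq.
  exact: (hausdorff_limit_set_eq0 S_gen q01 Pq Pi_lim).
rewrite lte_fin in s1; apply/eqP; rewrite eq_le; apply/andP; split; last first.
  by apply: le_ereal_inf_tmp => _ [q [q0 Hq] <-]; exact: critical_exponent_le.
apply: le_ereal_inf_tmp => _ [q [q0 Pq] <-].
have [q1|q1] := leP q 1; first by apply: le_dim => //; rewrite q0.
apply: le_trans (le_dim s _ Ps) _; first by rewrite s0 ltW.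
by rewrite lee_fin ltW// (lt_trans s1).
Qed.

End Dimension.

(** * Groups with convergent Poincare series *)

Theorem corollary1p6 (R : realType) (X : metricType R)
    (X_proper : proper_space X) (X_CAT : CAT_minus1 X)
    (G : groupType) (a : isom_group G X)
    (G_discrete : discrete_isom_group a)
    (S : set G) (S_gen : symmetric_generating_set S)
    (o : X) (G_non_elementary : non_elementary a o)
    (delta_gt0 : (0 < critical_exponent a o)%E)
    (delta_fin : (critical_exponent a o < +oo)%E)
    (A B : boundary X) (A_lim : limit_set a o A) (B_lim : limit_set a o B)
    (A_neq_B : A <> B)
    (o_on_AB : exists2 l : set X, side (Bdry A) (Bdry B) l & l o)
    (D : R) (D_thin : thin_triangle_constant X D)
    (xi : G -> boundary X)
    (xi_AB : forall g, xi g = act_boundary a g A \/ xi g = act_boundary a g B)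
    (xi_near : forall g, (edist_inf (ray_set o (xi g)) (a g o) <= D%:E)%E) :
  (forall q : R, 0 < q <= 1 -> (poincare_series a o q < +oo)%E ->
     (exists (F : end_compactification S -> limit_completion a o)
             (Pi : end_space S -> limit_set a o),
        [/\ continuous F,
            forall g, val (F (Vtx g)) = Inner (a g o),
            forall g z, val (F (act_end_compactification g z)) =
                        act_bordification a g (val (F z)),
            forall e, val (F (End e)) = Bdry (val (Pi e))
          & quotient_map Pi /\
            forall e e', bourdon o (val (Pi e)) (val (Pi e')) <=
                         end_dist a D q o e e']) /\
     hausdorff_measure (bourdon o) q (limit_set a o) = 0%E) /\
  ((critical_exponent a o < 1%:E)%E ->
     [/\ hausdorff_dim (bourdon o) (limit_set a o) = critical_exponent a o,
         is_cantor_set (limit_set a o)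
       & infinite_set [set: end_space S]]) /\
  (forall m : nat, (2 <= m)%N ->
   forall q : R, 0 < q <= 1 -> (poincare_series a o q < +oo)%E ->
     (poweR (packing_radius (bourdon o) m (limit_set a o)) q <=
      ereal_inf [set edge_energy S q o xi Q |
        Q in [set Q : set G |
          finite_set Q /\ few_infinite_components S Q m]])%E).
Proof.
pose pX : proper_CAT R := ProperCAT X_proper X_CAT.
have limits q : 0 < q <= 1 -> (poincare_series a o q < +oo)%E ->
    exists Pi : end_space S -> boundary pX, is_end_limit (X := pX) a o Pi.
  by move=> q01 Pq; exact: (@end_limit_exists R pX G a S S_gen o q q01 Pq).
have D0 : 0 <= D by rewrite -lee_fin (le_trans _ (xi_near 1%g))// edist_inf_ge0.
split; [|split].
- move=> q q01 Pq; have [Pi Pi_lim] := limits q q01 Pq.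
  split; last exact: (@hausdorff_limit_set_eq0 R pX G a S S_gen o q q01 Pq Pi Pi_lim).
  exists (F_set (X := pX) Pi_lim), (Pi_set (X := pX) Pi_lim).
  split=> //.
  + exact: (@F_set_continuous R pX G a S S_gen o q q01 Pq Pi Pi_lim).
  + exact: (@compactification_map_act R pX G a S o Pi Pi_lim).
  split; first exact: (@Pi_set_quotient R pX G a S S_gen o q q01 Pq Pi Pi_lim).
  move=> e e'.
  exact: (@end_dist_bound R pX G a S S_gen o q q01 Pq Pi Pi_lim D e e' D0).
- move=> crit1; have [_ [q [q0 Pq] <-]] := ereal_inf_lt crit1.
  rewrite lte_fin => q1; have q01 : 0 < q <= 1 by rewrite q0 ltW.
  have [Pi Pi_lim] := limits q q01 Pq; split.
  + exact: (@hausdorff_dim_limit_set R pX G a S S_gen o).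
  + exact: (@limit_set_cantor R pX G a o G_non_elementary S S_gen q q01 Pq Pi).
  + exact: (@ends_infinite R pX G a o G_non_elementary S S_gen q q01 Pq Pi).
- move=> m _ q q01 Pq; have [Pi Pi_lim] := limits q q01 Pq.
  apply: le_ereal_inf_tmp => _ [Q [Qfin few] <-].
  exact: (@packing_radius_energy R pX G a S S_gen o q q01 Pq Pi Pi_lim D xi xi_near).
Qed.
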